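(* Let $p$ be a prime and let $(R,\mathfrak m)$ be a reduced Noetherian local ring of characteristic $p>0$ which is a residue class ring of a Gorenstein local ring. If $R$ is $F$-coherent and $F$-injective, then $R$ is Cohen-Macaulay.
   Context: All rings are commutative with unit. A ring is coherent if every finitely generated ideal is finitely presented. For a ring $R$ of characteristic $p>0$, the perfect closure $R^{\infty}$ is obtained by adjoining to $R_{\mathrm{red}}$ all $p^e$-th roots ($e\ge1$) of all elements of $R_{\mathrm{red}}$; equivalently it is the direct limit of $R\xrightarrow{F}R\xrightarrow{F}R\to\cdots$ with $F$ the Frobenius map. A Noetherian ring $R$ of characteristic $p>0$ is $F$-coherent if $R^{\infty}$ is coherent. For a Noetherian local ring $(R,\mathfrak m)$ of characteristic $p>0$, the Frobenius map of $R$ induces a map on the Čech complex of $R$ (with respect to a system of parameters), and hence a Frobenius action $H^{k}_{\mathfrak m}(R)\to H^{k}_{\mathfrak m}(R)$ on the local cohomology modules; $R$ is called $F$-injective if this action is injective for all $0\le k\le\dim R$. *)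

(* Defs.v *)
From HB Require Import structures.
From mathcomp Require Import all_boot all_order all_algebra.
From mathcomp Require Import boolp classical_sets.
From mathcomp Require Import ring.

Set Implicit Arguments.
Unset Strict Implicit.
Unset Printing Implicit Defensive.

Import GRing.Theory.
Local Open Scope ring_scope.
Local Open Scope quotient_scope.

Section Ideals.
Variable R : comNzRingType.
Implicit Types (I J P m : set R) (s t : seq R).

Definition is_ideal I : Prop :=
  [/\ I 0, forall a b, I a -> I b -> I (a + b) & forall r a, I a -> I (r * a)].

Definition is_prime I : Prop :=
  [/\ is_ideal I, ~ I 1 & forall a b, I (a * b) -> I a \/ I b].

Definition is_maximal I : Prop :=
  [/\ is_ideal I, ~ I 1 &
      forall J, is_ideal J -> (I `<=` J)%classic -> ~ J 1 -> J = I].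

Definition ideal_gen s : set R :=
  [set y | exists a : 'I_(size s) -> R, y = \sum_i a i * s`_i]%classic.

Definition noetherian : Prop :=
  forall I, is_ideal I -> exists s, I = ideal_gen s.

Definition reduced_ring : Prop := forall (a : R) n, a ^+ n = 0 -> a = 0.

Definition local_ring m : Prop :=
  is_maximal m /\ forall m', is_maximal m' -> m' = m.

(* An ideal is finitely presented when it is the cokernel of some
   A : R^k -> R^n, the map R^n -> I being given by n generators. *)
Definition finitely_presented I : Prop :=
  exists n (x : 'cV[R]_n) k (A : 'M[R]_(k, n)),
    I = [set y | exists v : 'rV[R]_n, y = (v *m x) 0 0]%classic /\
    forall v : 'rV[R]_n, v *m x = 0 <-> exists u : 'rV[R]_k, v = u *m A.

Definition coherent : Prop := forall s, finitely_presented (ideal_gen s).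

Definition has_prime_chain (n : nat) : Prop :=
  exists P : nat -> set R,
    (forall i, (i <= n)%N -> is_prime (P i)) /\
    (forall i, (i < n)%N -> (P i `<` P i.+1)%classic).

Definition krull_dim (n : nat) : Prop :=
  has_prime_chain n /\ forall k, has_prime_chain k -> (k <= n)%N.

Definition regular_sequence s : Prop :=
  ~ ideal_gen s 1 /\
  forall i, (i < size s)%N ->
    forall a, ideal_gen (take i s) (s`_i * a) -> ideal_gen (take i s) a.

Definition depth m (n : nat) : Prop :=
  (exists s, [/\ size s = n, (forall a, a \in s -> m a) & regular_sequence s]) /\
  (forall s, (forall a, a \in s -> m a) -> regular_sequence s -> (size s <= n)%N).

(* To be used for a Noetherian local ring with maximal ideal m. *)
Definition cohen_macaulay m : Prop :=
  exists n, krull_dim n /\ depth m n.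

(* (x_1, ..., x_d) is m-primary, i.e. its radical is m. *)
Definition system_of_parameters m d (x : d.-tuple R) : Prop :=
  [/\ krull_dim d, (forall i, m (tnth x i)) &
      forall a, m a -> exists n, ideal_gen x (a ^+ n)].

End Ideals.

Arguments noetherian : clear implicits.
Arguments reduced_ring : clear implicits.
Arguments coherent : clear implicits.
Arguments krull_dim : clear implicits.

Section Gorenstein.
Variable A : comNzRingType.

Definition injective_module (E : lmodType A) : Prop :=
  forall (M N : lmodType A) (i : {linear M -> N}) (f : {linear M -> E}),
    injective i -> exists g : {linear N -> E}, forall x, g (i x) = f x.

(* There is an exact sequence 0 -> M -> E_0 -> ... -> E_n -> 0 with all the
   E_i injective. *)
Definition finite_injective_dimension (M : lmodType A) : Prop :=
  exists (n : nat) (E : nat -> lmodType A) (e : {linear M -> E 0%N})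
         (d : forall i, {linear E i -> E i.+1}),
    [/\ forall i, injective_module (E i),
        injective e,
        forall y, d 0%N y = 0 <-> exists x, y = e x,
        forall i y, d i.+1 y = 0 <-> exists x, y = d i x &
        forall i, (n < i)%N -> forall y : E i, y = 0].

Definition gorenstein_local (n : set A) : Prop :=
  [/\ noetherian A, local_ring n & finite_injective_dimension A^o].

End Gorenstein.

(* R^oo as the direct limit of R -F-> R -F-> ...: the class of (a, n) is
   a^(1/p^n). *)
Section PerfectClosure.
Variables (R : comNzRingType) (p : nat) (chRp : p \in [pchar R]).

Let frobD n (a b : R) : (a + b) ^+ (p ^ n) = a ^+ (p ^ n) + b ^+ (p ^ n).
Proof.
by apply: exprDn_pchar; rewrite pnatX (pnatE _ (pcharf_prime chRp)) chRp.
Qed.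

Let frobN n (a : R) : (- a) ^+ (p ^ n) = - a ^+ (p ^ n).
Proof.
by apply/eqP; rewrite -addr_eq0 -frobD addNr expr0n expn_eq0
  (negPf (lt0n_neq0 (prime_gt0 (pcharf_prime chRp)))) eqxx.
Qed.


Definition pc_rel (x y : R * nat) : bool :=
  `[< exists k, x.1 ^+ (p ^ (k + y.2)) = y.1 ^+ (p ^ (k + x.2)) >].

Let pc_refl : reflexive pc_rel.
Proof. by move=> x; apply/asboolP; exists 0%N. Qed.

Let pc_sym : symmetric pc_rel.
Proof. by move=> x y; apply/asboolP/asboolP => -[k E]; exists k. Qed.

Let pc_trans : transitive pc_rel.
Proof.
move=> [b m] [a n] [c q] /asboolP[/= k E1] /asboolP[/= l E2].
apply/asboolP; exists (k + l + m)%N => /=.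
rewrite (_ : k + l + m + q = (k + m) + (l + q))%N; last by ring.
rewrite (_ : k + l + m + n = (l + m) + (k + n))%N; last by ring.
rewrite expnD exprM E1 -exprM -expnD addnC expnD exprM E2.
by rewrite -exprM -expnD.
Qed.

Definition pc_equiv := EquivRel pc_rel pc_refl pc_sym pc_trans.

Definition perfect_closure of p \in [pchar R] := {eq_quot pc_equiv}.
Local Notation Rinf := (perfect_closure chRp).

HB.instance Definition _ := EqQuotient.on Rinf.
HB.instance Definition _ := Choice.on Rinf.

Let piP (x y : R * nat) :
  reflect (exists k, x.1 ^+ (p ^ (k + y.2)) = y.1 ^+ (p ^ (k + x.2)))
          (\pi_Rinf x == \pi_Rinf y).
Proof. by rewrite eqmodE; apply: asboolP. Qed.

Let reprP x : exists k,
  (repr (\pi_Rinf x)).1 ^+ (p ^ (k + x.2)) =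
  x.1 ^+ (p ^ (k + (repr (\pi_Rinf x)).2)).
Proof. by apply/piP; rewrite reprK. Qed.

Let addf (x y : R * nat) :=
  (x.1 ^+ (p ^ y.2) + y.1 ^+ (p ^ x.2), (x.2 + y.2)%N).
Let oppf (x : R * nat) := (- x.1, x.2).
Let mulf (x y : R * nat) :=
  (x.1 ^+ (p ^ y.2) * y.1 ^+ (p ^ x.2), (x.2 + y.2)%N).

Let pc_add := lift_op2 Rinf addf.
Let pc_opp := lift_op1 Rinf oppf.
Let pc_mul := lift_op2 Rinf mulf.

Let expE (a a' : R) (n n' k l m m' : nat) :
  a ^+ (p ^ (k + n')) = a' ^+ (p ^ (k + n)) ->
  (a ^+ (p ^ m)) ^+ (p ^ (k + l + (n' + m'))) =
  (a' ^+ (p ^ m')) ^+ (p ^ (k + l + (n + m))).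
Proof.
move=> E; rewrite -!exprM -!expnD.
rewrite (_ : m + (k + l + (n' + m')) = (k + n') + (l + m + m'))%N; last by ring.
rewrite (_ : m' + (k + l + (n + m)) = (k + n) + (l + m + m'))%N; last by ring.
by rewrite expnD exprM E -exprM -expnD.
Qed.

Let pi_add : {morph \pi_Rinf : x y / addf x y >-> pc_add x y}.
Proof.
move=> x y; unlock pc_add; apply/esym/eqP/piP => /=.
have [k E] := reprP x; have [l E'] := reprP y.
exists (k + l)%N; rewrite !frobD; congr (_ + _).
  exact: expE.
rewrite [(k + l)%N]addnC [(x.2 + y.2)%N]addnC [(_ + (repr (\pi_Rinf y)).2)%N]addnC.
exact: expE.
Qed.

Let pi_opp : {morph \pi_Rinf : x / oppf x >-> pc_opp x}.
Proof.
move=> x; unlock pc_opp; apply/esym/eqP/piP => /=.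
by have [k E] := reprP x; exists k; rewrite !frobN E.
Qed.

Let pi_mul : {morph \pi_Rinf : x y / mulf x y >-> pc_mul x y}.
Proof.
move=> x y; unlock pc_mul; apply/esym/eqP/piP => /=.
have [k E] := reprP x; have [l E'] := reprP y.
exists (k + l)%N; rewrite !exprMn; congr (_ * _).
  exact: expE.
rewrite [(k + l)%N]addnC [(x.2 + y.2)%N]addnC [(_ + (repr (\pi_Rinf y)).2)%N]addnC.
exact: expE.
Qed.

Let piE := (fun x y => esym (pi_add x y), fun x => esym (pi_opp x),
            fun x y => esym (pi_mul x y)).

Let eq_pi a b n : a = b -> \pi_Rinf (a, n) = \pi_Rinf (b, n).
Proof. by move=> ->. Qed.

Let pc_addA : associative pc_add.
Proof.
elim/quotW=> -[a n]; elim/quotW=> -[b m]; elim/quotW=> -[c q].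
rewrite !piE /addf /= -addnA; apply: eq_pi.
by rewrite !frobD -!exprM -!expnD addrA [(q + n)%N]addnC [(m + n)%N]addnC.
Qed.

Let pc_addC : commutative pc_add.
Proof.
elim/quotW=> -[a n]; elim/quotW=> -[b m].
by rewrite !piE /addf /= addnC addrC.
Qed.

Let pc_add0 : left_id (\pi_Rinf (0, 0%N)) pc_add.
Proof.
elim/quotW=> -[a n]; rewrite !piE /addf /= add0n expr1.
by rewrite expr0n expn_eq0 (negPf (lt0n_neq0 (prime_gt0 (pcharf_prime chRp)))) add0r.
Qed.

Let pi0 n : \pi_Rinf (0, n) = \pi_Rinf (0, 0%N).
Proof.
apply/eqP/piP; exists 0%N => /=.
by rewrite !expr0n !expn_eq0 (negPf (lt0n_neq0 (prime_gt0 (pcharf_prime chRp)))).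
Qed.

Let pc_addN : left_inverse (\pi_Rinf (0, 0%N)) pc_opp pc_add.
Proof.
elim/quotW=> -[a n]; rewrite !piE /addf /oppf /= frobN addNr; exact: pi0.
Qed.

HB.instance Definition _ :=
  GRing.isZmodule.Build Rinf pc_addA pc_addC pc_add0 pc_addN.

Let pc_mulA : associative pc_mul.
Proof.
elim/quotW=> -[a n]; elim/quotW=> -[b m]; elim/quotW=> -[c q].
rewrite !piE /mulf /= -addnA; apply: eq_pi.
by rewrite !exprMn -!exprM -!expnD mulrA [(q + n)%N]addnC [(m + n)%N]addnC.
Qed.

Let pc_mulC : commutative pc_mul.
Proof.
elim/quotW=> -[a n]; elim/quotW=> -[b m].
by rewrite !piE /mulf /= addnC mulrC.
Qed.

Let pc_mul1 : left_id (\pi_Rinf (1, 0%N)) pc_mul.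
Proof.
by elim/quotW=> -[a n]; rewrite !piE /mulf /= add0n expr1 expr1n mul1r.
Qed.

Let pc_mulD : left_distributive pc_mul pc_add.
Proof.
elim/quotW=> -[a n]; elim/quotW=> -[b m]; elim/quotW=> -[c q].
rewrite !piE /mulf /addf /=; apply/eqP/piP; exists 0%N => /=.
rewrite !frobD !exprMn !frobD -!exprM -!expnD mulrDl.
by congr (_ ^+ (p ^ _) * _ ^+ (p ^ _) + _ ^+ (p ^ _) * _ ^+ (p ^ _)); ring.
Qed.

Let pc_1neq0 : \pi_Rinf (1, 0%N) != \pi_Rinf (0, 0%N).
Proof.
apply/negP => /piP[k /=]; rewrite expr1n expr0n expn_eq0.
rewrite (negPf (lt0n_neq0 (prime_gt0 (pcharf_prime chRp)))) /= => /eqP.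
by rewrite oner_eq0.
Qed.

HB.instance Definition _ := GRing.Zmodule_isComNzRing.Build Rinf
  pc_mulA pc_mulC pc_mul1 pc_mulD pc_1neq0.

Definition to_perfect_closure (a : R) : Rinf := \pi_Rinf (a, 0%N).

Lemma to_perfect_closure_zmod_morphism : zmod_morphism to_perfect_closure.
Proof.
by move=> a b; rewrite /to_perfect_closure [RHS]/(pc_add _ (pc_opp _)) !piE -/pc_add piE /addf /= !expr1.
Qed.

Lemma to_perfect_closure_monoid_morphism : monoid_morphism to_perfect_closure.
Proof.
by split=> [|a b] //; rewrite /to_perfect_closure [RHS]/(pc_mul _ _) -/pc_mul piE /mulf /= !expr1.
Qed.

HB.instance Definition _ := GRing.isZmodMorphism.Build R Rinf
  to_perfect_closure to_perfect_closure_zmod_morphism.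
HB.instance Definition _ := GRing.isMonoidMorphism.Build R Rinf
  to_perfect_closure to_perfect_closure_monoid_morphism.

Lemma to_perfect_closure_eq0 a :
  to_perfect_closure a = 0 <-> exists n, a ^+ n = 0.
Proof.
have p0 n : (p ^ n == 0)%N = false.
  by rewrite expn_eq0 (negPf (lt0n_neq0 (prime_gt0 (pcharf_prime chRp)))).
split=> [/eqP /piP[k /=]|[n E]].
  by rewrite expr0n p0 => E; exists (p ^ (k + 0))%N.
apply/eqP/piP; exists n; rewrite /= expr0n p0 /=.
have ltn : (n < p ^ (n + 0))%N.
  by rewrite addn0; apply: ltn_expl; apply/prime_gt1/(pcharf_prime chRp).
by rewrite -(subnK (ltnW ltn)) exprD E mulr0.
Qed.

Let piX (x : R * nat) k : \pi_Rinf x ^+ k = \pi_Rinf (x.1 ^+ k, x.2).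
Proof.
case: x => a n; elim: k => [|k IHk].
  rewrite !expr0; apply/eqP/piP; exists 0%N.
  by rewrite /= !expr1n.
rewrite exprS IHk [LHS]/(pc_mul _ _) -/pc_mul piE /mulf /=.
apply/eqP/piP; exists 0%N.
by rewrite /= exprS -exprMn -exprM -expnD add0n.
Qed.

Lemma to_perfect_closure_root (y : Rinf) :
  exists n a, y ^+ (p ^ n) = to_perfect_closure a.
Proof.
elim/quotW: y => -[a n]; exists n, a; rewrite piX /to_perfect_closure.
by apply/eqP/piP; exists 0%N; rewrite /= !add0n expn0 expr1.
Qed.

Lemma perfect_closure_perfect : bijective (fun y : Rinf => y ^+ p).
Proof.
pose root (x : R * nat) := (x.1, x.2.+1).
exists (lift_op1 Rinf root) => y; elim/quotW: y => x.
  unlock; rewrite piX; apply/eqP/piP.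
  have [k E] := reprP (x.1 ^+ p, x.2); exists k => /=.
  by rewrite [X in _ = _ ^+ (p ^ X)]addnS expnS exprM -E.
unlock; rewrite piX; apply/eqP/piP => /=.
have [k E] := reprP x; exists k => /=.
by rewrite exprAC E -exprM -expnSr -addnS.
Qed.

End PerfectClosure.

(* R_f: the class of (a, n) is a / f^n. It is the zero ring when f is
   nilpotent. *)
Section Localization.
Variables (R : comNzRingType).

Definition loc_rel (f : R) (x y : R * nat) : bool :=
  `[< exists k, f ^+ (k + y.2) * x.1 = f ^+ (k + x.2) * y.1 >].

Let loc_refl f : reflexive (loc_rel f).
Proof. by move=> x; apply/asboolP; exists 0%N. Qed.

Let loc_sym f : symmetric (loc_rel f).
Proof. by move=> x y; apply/asboolP/asboolP => -[k E]; exists k. Qed.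

Let loc_trans f : transitive (loc_rel f).
Proof.
move=> [b m] [a n] [c q] /asboolP[/= k E1] /asboolP[/= l E2].
apply/asboolP; exists (k + l + m)%N => /=.
rewrite (_ : k + l + m + q = (l + q) + (k + m))%N; last by ring.
rewrite (_ : k + l + m + n = (k + n) + (l + m))%N; last by ring.
by rewrite exprD -mulrA E1 mulrCA E2 mulrA -exprD.
Qed.

Definition loc_equiv f :=
  EquivRel (loc_rel f) (@loc_refl f) (@loc_sym f) (@loc_trans f).

Definition localization (f : R) := {eq_quot (loc_equiv f)}.

HB.instance Definition _ f := EqQuotient.on (localization f).
HB.instance Definition _ f := Choice.on (localization f).

Variable f : R.
Local Notation Rf := (localization f).

Definition frac (a : R) (n : nat) : Rf := \pi_Rf (a, n).

Lemma frac_eqP (a b : R) (n m : nat) :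
  frac a n = frac b m <-> exists k, f ^+ (k + m) * a = f ^+ (k + n) * b.
Proof.
split=> [/eqP|H]; first by rewrite eqmodE => /asboolP.
by apply/eqP; rewrite eqmodE; apply/asboolP.
Qed.

Let fracP (y : Rf) : exists a n, y = frac a n.
Proof. by elim/quotW: y => -[a n]; exists a, n. Qed.

Let addf (x y : R * nat) :=
  (f ^+ y.2 * x.1 + f ^+ x.2 * y.1, (x.2 + y.2)%N).
Let oppf (x : R * nat) := (- x.1, x.2).
Let mulf (x y : R * nat) := (x.1 * y.1, (x.2 + y.2)%N).

Definition loc_add (y z : Rf) : Rf := \pi_Rf (addf (repr y) (repr z)).
Definition loc_opp (y : Rf) : Rf := \pi_Rf (oppf (repr y)).
Definition loc_mul (y z : Rf) : Rf := \pi_Rf (mulf (repr y) (repr z)).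

Let reprP a n : exists k,
  f ^+ (k + n) * (repr (frac a n)).1 = f ^+ (k + (repr (frac a n)).2) * a.
Proof. by apply/frac_eqP; rewrite /frac -surjective_pairing reprK. Qed.

Let addE a n b m :
  loc_add (frac a n) (frac b m) = frac (f ^+ m * a + f ^+ n * b) (n + m).
Proof.
have [k E] := reprP a n; have [l E'] := reprP b m.
apply/frac_eqP; exists (k + l)%N => /=.
set r := repr _ in E *; set r' := repr _ in E' *.
transitivity (f ^+ (l + r'.2 + m) * (f ^+ (k + n) * r.1) +
              f ^+ (k + r.2 + n) * (f ^+ (l + m) * r'.1)).
  by rewrite !exprD; ring.
by rewrite E E' !exprD; ring.
Qed.

Let oppE a n : loc_opp (frac a n) = frac (- a) n.
Proof.
by have [k E] := reprP a n; apply/frac_eqP; exists k; rewrite !mulrN E.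
Qed.

Let mulE a n b m : loc_mul (frac a n) (frac b m) = frac (a * b) (n + m).
Proof.
have [k E] := reprP a n; have [l E'] := reprP b m.
apply/frac_eqP; exists (k + l)%N => /=.
set r := repr _ in E *; set r' := repr _ in E' *.
transitivity ((f ^+ (k + n) * r.1) * (f ^+ (l + m) * r'.1)).
  by rewrite !exprD; ring.
by rewrite E E' !exprD; ring.
Qed.

Let loc_addA : associative loc_add.
Proof.
move=> y z t; have [a [n ->]] := fracP y; have [b [m ->]] := fracP z.
have [c [q ->]] := fracP t; rewrite !addE addnA; congr frac.
by rewrite !exprD; ring.
Qed.

Let loc_addC : commutative loc_add.
Proof.
move=> y z; have [a [n ->]] := fracP y; have [b [m ->]] := fracP z.
by rewrite !addE addnC addrC.
Qed.

Let loc_add0 : left_id (frac 0 0) loc_add.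
Proof.
move=> y; have [a [n ->]] := fracP y.
by rewrite addE add0n expr0 mulr0 mul1r add0r.
Qed.

Let loc_addN : left_inverse (frac 0 0) loc_opp loc_add.
Proof.
move=> y; have [a [n ->]] := fracP y; rewrite oppE addE.
by apply/frac_eqP; exists 0%N; rewrite mulrN addNr !mulr0.
Qed.

HB.instance Definition _ :=
  GRing.isZmodule.Build Rf loc_addA loc_addC loc_add0 loc_addN.

Let loc_mulA : associative loc_mul.
Proof.
move=> y z t; have [a [n ->]] := fracP y; have [b [m ->]] := fracP z.
by have [c [q ->]] := fracP t; rewrite !mulE addnA mulrA.
Qed.

Let loc_mulC : commutative loc_mul.
Proof.
move=> y z; have [a [n ->]] := fracP y; have [b [m ->]] := fracP z.
by rewrite !mulE addnC mulrC.
Qed.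

Let loc_mul1 : left_id (frac 1 0) loc_mul.
Proof.
by move=> y; have [a [n ->]] := fracP y; rewrite mulE mul1r.
Qed.

Let loc_mulD : left_distributive loc_mul loc_add.
Proof.
move=> y z t; have [a [n ->]] := fracP y; have [b [m ->]] := fracP z.
have [c [q ->]] := fracP t; rewrite !(mulE, addE); apply/frac_eqP.
by exists 0%N; rewrite !exprD; ring.
Qed.

HB.instance Definition _ := GRing.Zmodule_isComPzRing.Build Rf
  loc_mulA loc_mulC loc_mul1 loc_mulD.

Lemma frac_surj (y : Rf) : exists a n, y = frac a n.
Proof. exact: fracP. Qed.

Lemma frac0 n : frac 0 n = 0.
Proof. by apply/frac_eqP; exists 0%N; rewrite !mulr0. Qed.

Lemma fracD a n b m :
  frac a n + frac b m = frac (f ^+ m * a + f ^+ n * b) (n + m).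
Proof. exact: addE. Qed.

Lemma fracN a n : - frac a n = frac (- a) n.
Proof. exact: oppE. Qed.

Lemma fracM a n b m : frac a n * frac b m = frac (a * b) (n + m).
Proof. exact: mulE. Qed.

Lemma fracX a n k : frac a n ^+ k = frac (a ^+ k) (n * k).
Proof.
elim: k => [|k IHk]; first by rewrite muln0 !expr0.
by rewrite !exprS IHk fracM mulnS.
Qed.

Section Frobenius.
Variables (p : nat) (chRp : p \in [pchar R]).

Let pD (a b : R) : (a + b) ^+ p = a ^+ p + b ^+ p.
Proof. by rewrite exprDn_pchar // (pnatE _ (pcharf_prime chRp)). Qed.

Let p_neq0 : (p == 0)%N = false.
Proof. by rewrite (negPf (lt0n_neq0 (prime_gt0 (pcharf_prime chRp)))). Qed.

Lemma loc_frobeniusD (y z : Rf) : (y + z) ^+ p = y ^+ p + z ^+ p.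
Proof.
have [a [n ->]] := frac_surj y; have [b [m ->]] := frac_surj z.
rewrite fracD !fracX fracD mulnDl; congr frac.
by rewrite pD !exprMn -!exprM.
Qed.

Lemma loc_frobeniusN (y : Rf) : (- y) ^+ p = - y ^+ p.
Proof.
apply/eqP; rewrite -addr_eq0 -loc_frobeniusD addNr.
by rewrite expr0n p_neq0.
Qed.

Lemma loc_frobenius_sum (I : finType) (P : pred I) (F : I -> Rf) :
  (\sum_(i | P i) F i) ^+ p = \sum_(i | P i) F i ^+ p.
Proof.
by apply: (big_morph (fun y : Rf => y ^+ p) loc_frobeniusD); rewrite expr0n p_neq0.
Qed.

Lemma loc_frobenius_sign n : ((-1 : Rf) ^+ n) ^+ p = (-1) ^+ n.
Proof. by rewrite exprAC loc_frobeniusN expr1n. Qed.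

End Frobenius.

End Localization.

(* The canonical ring map R_f -> R_h when h = f * g, a / f^n |-> a g^n / h^n.
   It is only meant to be used under that equation, see loc_map_frac. *)
Section LocalizationMap.
Variables (R : comNzRingType).

Definition loc_map (f g h : R) (y : localization f) : localization h :=
  frac h ((repr y).1 * g ^+ (repr y).2) (repr y).2.

Variables (f g h : R) (hE : h = f * g).

Lemma loc_map_frac a n : loc_map g h (frac f a n) = frac h (a * g ^+ n) n.
Proof.
rewrite /loc_map; set r := repr _.
have: frac f r.1 r.2 = frac f a n.
  by rewrite /frac -surjective_pairing /r reprK.
move=> /frac_eqP[k E]; apply/frac_eqP; exists k; rewrite hE !exprMn.
transitivity (f ^+ (k + n) * r.1 * g ^+ (k + n + r.2)).
  by rewrite !exprD; ring.
by rewrite E !exprD; ring.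
Qed.

Lemma loc_map_zmod_morphism : zmod_morphism (@loc_map f g h).
Proof.
move=> y z; have [a [n ->]] := frac_surj y; have [b [m ->]] := frac_surj z.
rewrite fracN fracD !loc_map_frac fracN fracD; congr frac.
by rewrite hE !exprMn exprD; ring.
Qed.

Lemma loc_map_monoid_morphism : monoid_morphism (@loc_map f g h).
Proof.
split=> [|y z].
  by rewrite [LHS]loc_map_frac mulr1.
have [a [n ->]] := frac_surj y; have [b [m ->]] := frac_surj z.
by rewrite fracM !loc_map_frac fracM exprD mulrACA.
Qed.

End LocalizationMap.

Section LocalCohomology.
Variables (R : comNzRingType) (d : nat) (x : d.-tuple R).

Definition prod_on (I : {set 'I_d}) : R := \prod_(i in I) tnth x i.

Lemma prod_onD (I J : {set 'I_d}) :
  I \subset J -> prod_on J = prod_on I * prod_on (J :\: I).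
Proof.
by move=> IJ; rewrite /prod_on (big_setID I) /= (finset.setIidPr IJ).
Qed.

Definition ksub k := {I : {set 'I_d} | #|I| == k}.

Definition cech k := forall I : ksub k, localization (prod_on (val I)).

HB.instance Definition _ k := gen_eqMixin (cech k).
HB.instance Definition _ k := gen_choiceMixin (cech k).

Section Zmod.
Variable k : nat.
Let add (c c' : cech k) : cech k := fun I => c I + c' I.
Let opp (c : cech k) : cech k := fun I => - c I.
Let zero : cech k := fun I => 0.

Let addA : associative add.
Proof. by move=> a b c; apply: functional_extensionality_dep => I; apply: addrA. Qed.
Let addC : commutative add.
Proof. by move=> a b; apply: functional_extensionality_dep => I; apply: addrC. Qed.
Let add0 : left_id zero add.
Proof. by move=> a; apply: functional_extensionality_dep => I; apply: add0r. Qed.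
Let addN : left_inverse zero opp add.
Proof. by move=> a; apply: functional_extensionality_dep => I; apply: addNr. Qed.

HB.instance Definition _ := GRing.isZmodule.Build (cech k) addA addC add0 addN.
End Zmod.

(* The number of elements of J preceding the element of J \ I. *)
Definition cech_sign (I J : {set 'I_d}) : nat :=
  #|[set i in J | [exists j in J :\: I, (i < j)%N]]|.

Definition cech_map (I J : {set 'I_d}) :
    localization (prod_on I) -> localization (prod_on J) :=
  loc_map (prod_on (J :\: I)) (prod_on J).

Definition cech_d k (c : cech k) : cech k.+1 := fun J =>
  \sum_(I : ksub k | val I \subset val J)
     (-1) ^+ cech_sign (val I) (val J) * cech_map (val J) (c I).

Lemma cech_d_zmod_morphism k : zmod_morphism (@cech_d k).
Proof.
move=> a b; apply: functional_extensionality_dep => J.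
transitivity (cech_d a J - cech_d b J) => [|//]; rewrite /cech_d -sumrB.
apply: eq_bigr => I IJ; rewrite -mulrBr; congr (_ * _).
exact: (loc_map_zmod_morphism (prod_onD IJ)).
Qed.

HB.instance Definition _ k := GRing.isZmodMorphism.Build (cech k) (cech k.+1)
  (@cech_d k) (@cech_d_zmod_morphism k).

Definition is_cocycle k : {pred cech k} := fun c => cech_d c == 0.

Lemma is_cocycle_zmod_closed k : zmod_closed (@is_cocycle k).
Proof.
split=> [|a b]; rewrite !unfold_in; first by rewrite raddf0.
by move=> /eqP E /eqP E'; rewrite raddfB /= E E' subr0.
Qed.

HB.instance Definition _ k := GRing.isZmodClosed.Build (cech k) (@is_cocycle k)
  (@is_cocycle_zmod_closed k).

Record cocycle k := Cocycle { cocycle_val :> cech k; _ : is_cocycle cocycle_val }.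

HB.instance Definition _ k := [isSub for @cocycle_val k].
HB.instance Definition _ k := [Choice of cocycle k by <:].
HB.instance Definition _ k := [SubChoice_isSubZmodule of cocycle k by <:].

Definition is_coboundary k : cech k -> Prop :=
  match k with
  | 0 => fun c => c = 0
  | k'.+1 => fun c => exists b : cech k', c = cech_d b
  end.

Definition coboundary k : {pred cocycle k} := fun z => `[< is_coboundary (val z) >].

Lemma coboundary_zmod_closed k : zmod_closed (@coboundary k).
Proof.
split=> [|u v]; rewrite !unfold_in.
  by apply/asboolP; case: k => [|k] //=; exists 0; rewrite raddf0.
move=> /asboolP Hu /asboolP Hv; apply/asboolP; rewrite raddfB /=.
case: k u v Hu Hv => [|k] u v /=; first by move=> -> ->; rewrite subr0.
by move=> [b ->] [c ->]; exists (b - c); rewrite raddfB.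
Qed.

HB.instance Definition _ k := GRing.isZmodClosed.Build (cocycle k)
  (@coboundary k) (@coboundary_zmod_closed k).

(* H^k_m(R), when x is a system of parameters of (R, m) *)
Definition local_cohomology k := Quotient.quot (@coboundary k).

HB.instance Definition _ k := ZmodQuotient.on (local_cohomology k).

Variables (p : nat) (chRp : p \in [pchar R]).

Definition cech_frobenius k (c : cech k) : cech k := fun I => c I ^+ p.

Lemma cech_frobenius_zmod_morphism k : zmod_morphism (@cech_frobenius k).
Proof.
move=> a b; apply: functional_extensionality_dep => I.
transitivity (a I ^+ p - b I ^+ p) => //.
by rewrite -(loc_frobeniusN chRp) -(loc_frobeniusD chRp).
Qed.

Lemma cech_d_frobenius k (c : cech k) :
  cech_d (cech_frobenius c) = cech_frobenius (cech_d c).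
Proof.
apply: functional_extensionality_dep => J.
rewrite /cech_frobenius /cech_d (loc_frobenius_sum chRp).
apply: eq_bigr => I IJ; rewrite exprMn (loc_frobenius_sign _ chRp).
congr (_ * _); rewrite /cech_map.
have [a [n ->]] := frac_surj (c I).
rewrite fracX !(loc_map_frac (prod_onD IJ)) fracX.
by rewrite exprMn -exprM.
Qed.

Lemma cech_frobenius_cocycle k (z : cocycle k) :
  is_cocycle (cech_frobenius (val z)).
Proof.
rewrite /is_cocycle cech_d_frobenius (eqP (valP z)).
apply/eqP/functional_extensionality_dep => J.
by rewrite /cech_frobenius expr0n
  (negPf (lt0n_neq0 (prime_gt0 (pcharf_prime chRp)))).
Qed.

Definition cocycle_frobenius k (z : cocycle k) : cocycle k :=
  Cocycle (cech_frobenius_cocycle z).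

Definition lc_frobenius k : local_cohomology k -> local_cohomology k :=
  lift_op1 (local_cohomology k) (@cocycle_frobenius k).

Lemma is_coboundary_frobenius k (c : cech k) :
  is_coboundary c -> is_coboundary (cech_frobenius c).
Proof.
case: k c => [|k] c /=; last first.
  by move=> [b ->]; exists (cech_frobenius b); rewrite cech_d_frobenius.
move=> ->; apply: functional_extensionality_dep => I.
by rewrite /cech_frobenius expr0n
  (negPf (lt0n_neq0 (prime_gt0 (pcharf_prime chRp)))).
Qed.

Lemma pi_lc_frobenius k (z : cocycle k) :
  lc_frobenius (\pi_(local_cohomology k) z) =
  \pi_(local_cohomology k) (cocycle_frobenius z).
Proof.
rewrite /lc_frobenius; unlock.
set r := repr _; have: r - z \in @coboundary k.
  by rewrite Quotient.idealrBE /r reprK.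
rewrite unfold_in => /asboolP H; apply/eqP; rewrite -Quotient.idealrBE.
rewrite unfold_in; apply/asboolP; rewrite raddfB /=.
rewrite -cech_frobenius_zmod_morphism.
by apply: is_coboundary_frobenius; move: H; rewrite raddfB.
Qed.

Lemma lc_frobenius_zmod_morphism k : zmod_morphism (@lc_frobenius k).
Proof.
elim/quotW=> z; elim/quotW=> t.
rewrite -raddfB !pi_lc_frobenius -raddfB; congr (\pi _).
apply: val_inj; rewrite [RHS]raddfB /= -cech_frobenius_zmod_morphism.
by congr cech_frobenius; rewrite -[LHS]/(val (z - t)) raddfB.
Qed.

End LocalCohomology.

Section FRings.
Variables (R : comNzRingType) (p : nat) (chRp : p \in [pchar R]).

Definition F_coherent : Prop := coherent (perfect_closure chRp).

(* The size d of a system of parameters is dim R. *)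
Definition F_injective (m : set R) : Prop :=
  exists d (x : d.-tuple R), system_of_parameters m x /\
    forall k, (k <= d)%N -> injective (@lc_frobenius R d x p chRp k).

End FRings.

(* Main.v *)
Require Import Defs.
From mathcomp Require Import all_boot all_order all_algebra.
From mathcomp Require Import boolp classical_sets.
From mathcomp Require Import functions ring zify.

(* Let S be the perfect closure of R and x a system of parameters of length
   d = dim R; the point is that the Koszul cohomology H^k(x; S) vanishes for
   k < d, and this uses only the coherence of S.  By coherence H^k(x; S) is
   finitely generated and, if it is nonzero, it has a nonzero cyclic subquotient
   S / J with J finitely generated.  Applying the Frobenius map e times, with
   q = p ^ e, one finds R / (J^[q] S \cap R) inside a subquotient of
   H^k(x^q; R).  The length of the former grows at least as fast as q ^ d
   (Artin-Rees along a chain of primes of length d), that of the latter is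
   O(q ^ k) (devissage to the modules R / Q with Q prime), a contradiction.

   Hence a Koszul cocycle over R of degree k < d becomes a coboundary after some
   iterate of the Frobenius map, and F-injectivity makes its class in
   H^k_m(R) zero.  As H^k(x; R) embeds into H^k_m(R) once the lower Koszul
   cohomology of all powers of x is known to vanish, H^k(x; R) = 0 for all
   k < d, so that x is a regular sequence, in any order, by Nakayama's lemma. *)

Set Implicit Arguments.
Unset Strict Implicit.
Unset Printing Implicit Defensive.

Import GRing.Theory.
Local Open Scope classical_set_scope.
Local Open Scope ring_scope.

(** * Ideals in Noetherian rings *)

(** Koszul cochains are free of finite rank, so coherence applies to them; this is why S is probed
    with Koszul and not Cech cohomology. S need not be Noetherian, hence all lengths are measured
    over R: finitely many elements of S have q-th powers in R for q a large power of p, and a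
    relation over R between these q-th powers yields one over S by extracting q-th roots. The
    coefficients of the new relation lie in S, so it can be tested against J. The exponents k and d
    have similar origins. A variable outside a prime Q is regular on R / Q and lowers the
    cohomological degree by one at the price of a factor q, so at most k such factors arise.
    Conversely, each strict inclusion in a chain of primes contributes a factor proportional to q.
    Reducedness embeds R into S. The map from H^k(x; R) to H^k_m(R) is a direct limit of
    multiplication maps, and raising the exponent of one variable is injective on H^k as soon as
    H^(k-1) vanishes for a sequence of powers with unequal exponents. The induction on k therefore
    has to treat all sequences of positive powers of x at once. *)

Section IdealFacts.
Variable R : comNzRingType.
Implicit Types (I J P : set R).

Lemma ideal0 I : is_ideal I -> I 0. Proof. by case. Qed.

Lemma idealD I a b : is_ideal I -> I a -> I b -> I (a + b).
Proof. by case=> _ + _; apply. Qed.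

Lemma idealM I r a : is_ideal I -> I a -> I (r * a).
Proof. by case=> _ _; apply. Qed.

Lemma idealMr I r a : is_ideal I -> I a -> I (a * r).
Proof. by rewrite mulrC; apply: idealM. Qed.

Lemma idealN I a : is_ideal I -> I a -> I (- a).
Proof. by move=> hI Ia; rewrite -mulN1r; apply: idealM. Qed.

Lemma idealB I a b : is_ideal I -> I a -> I b -> I (a - b).
Proof. by move=> hI Ia Ib; apply: idealD => //; apply: idealN. Qed.

Lemma ideal_sum I (T : Type) (r : seq T) (P : pred T) (F : T -> R) :
  is_ideal I -> (forall i, P i -> I (F i)) -> I (\sum_(i <- r | P i) F i).
Proof.
move=> hI IF; apply: big_ind => //; first exact: ideal0.
by move=> a b; apply: idealD.
Qed.

Lemma ideal_zero : is_ideal [set (0 : R)].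
Proof.
by split=> //= [a b -> ->|r a ->]; rewrite ?addr0 ?mulr0.
Qed.

Definition ideal_adj I (u : R) : set R := [set y | exists i r, I i /\ y = i + r * u].

Definition ideal_colon I (u : R) : set R := [set r | I (r * u)].

Lemma ideal_adjP I u : is_ideal I -> is_ideal (ideal_adj I u).
Proof.
move=> hI; split.
- by exists 0, 0; rewrite mul0r addr0; split=> //; apply: ideal0.
- move=> _ _ [i [r [Ii ->]]] [j [t [Ij ->]]]; exists (i + j), (r + t).
  by split; [apply: idealD | ring].
- move=> a _ [i [r [Ii ->]]]; exists (a * i), (a * r).
  by split; [apply: idealM | ring].
Qed.

Lemma ideal_adjS I u : I `<=` ideal_adj I u.
Proof. by move=> a Ia; exists a, 0; rewrite mul0r addr0. Qed.

Lemma ideal_adj_gen I u : is_ideal I -> ideal_adj I u u.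
Proof. by move=> hI; exists 0, 1; rewrite mul1r add0r; split=> //; apply: ideal0. Qed.

Lemma ideal_adj_min I J u : is_ideal J -> I `<=` J -> J u -> ideal_adj I u `<=` J.
Proof.
move=> hJ IJ Ju _ [i [r [Ii ->]]].
by apply: idealD => //; [apply: IJ | apply: idealM].
Qed.

Lemma ideal_colonP I u : is_ideal I -> is_ideal (ideal_colon I u).
Proof.
move=> hI; rewrite /ideal_colon; split=> /= [|a b Ia Ib|r a Ia].
- by rewrite mul0r; apply: ideal0.
- by rewrite mulrDl; apply: idealD.
- by rewrite -mulrA; apply: idealM.
Qed.

Lemma ideal_colonS I u : is_ideal I -> I `<=` ideal_colon I u.
Proof. by move=> hI a Ia; apply: idealMr. Qed.

Lemma ideal_genP (s : seq R) : is_ideal (ideal_gen s).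
Proof.
split.
- by exists (fun=> 0); rewrite big1 // => i _; rewrite mul0r.
- move=> _ _ [a ->] [b ->]; exists (fun i => a i + b i).
  by rewrite -big_split; apply: eq_bigr => i _; rewrite mulrDl.
- move=> r _ [a ->]; exists (fun i => r * a i).
  by rewrite mulr_sumr; apply: eq_bigr => i _; rewrite mulrA.
Qed.

Lemma ideal_gen_mem (s : seq R) a : a \in s -> ideal_gen s a.
Proof.
move=> /(nthP 0)[i ltis <-]; exists (fun j => (j == Ordinal ltis)%:R).
rewrite (bigD1 (Ordinal ltis)) //= eqxx mul1r big1 ?addr0 // => j /negPf ->.
by rewrite mul0r.
Qed.

Lemma ideal_gen_min (s : seq R) I :
  is_ideal I -> (forall a, a \in s -> I a) -> ideal_gen s `<=` I.
Proof.
move=> hI sI _ [a ->]; apply: ideal_sum => // i _; apply: idealM => //.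
by apply/sI/mem_nth.
Qed.

Lemma ideal_gen_cons x (s : seq R) y :
  ideal_gen (x :: s) y <-> exists r z, ideal_gen s z /\ y = r * x + z.
Proof.
split=> [[a ->]|[r [z [sz ->]]]].
  rewrite big_ord_recl /=; exists (a ord0), (\sum_(i < size s) a (lift ord0 i) * s`_i).
  by split=> //; exists (fun i => a (lift ord0 i)).
apply: idealD; first exact: ideal_genP.
  by apply: idealM; [apply: ideal_genP | apply/ideal_gen_mem/mem_head].
move: z sz; apply: ideal_gen_min; first exact: ideal_genP.
by move=> a sa; apply: ideal_gen_mem; rewrite inE sa orbT.
Qed.

Lemma prime_exp P a n : is_prime P -> P (a ^+ n) -> P a.
Proof.
move=> [_ P1 PM]; elim: n => [|n IHn]; first by rewrite expr0 => /P1.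
by rewrite exprS => /PM[//|/IHn].
Qed.

End IdealFacts.

Section Noetherian.
Variables (R : comNzRingType) (R_noeth : noetherian R).
Implicit Types (I J P : set R).

Lemma noetherian_acc (I : nat -> set R) :
  (forall n, is_ideal (I n)) -> (forall n, I n `<=` I n.+1) ->
  exists n, forall k, I k `<=` I n.
Proof.
move=> hI mono.
have le_mono n k : (n <= k)%N -> I n `<=` I k.
  move=> /subnK <-; elim: (k - n)%N => [|l IHl] //=.
  by apply: subset_trans IHl _; rewrite addSn; apply: mono.
have hU : is_ideal (\bigcup_n I n).
  split; first by exists 0%N => //; apply: ideal0.
    move=> a b [n _ Ia] [k _ Ib]; exists (n + k)%N => //.
    by apply: idealD => //; [apply: le_mono Ia | apply: le_mono Ib];
      rewrite ?leq_addr ?leq_addl.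
  by move=> r a [n _ Ia]; exists n => //; apply: idealM.
have [s Es] := R_noeth hU.
have [n sn] : exists n, forall a, a \in s -> I n a.
  have : forall a, a \in s -> (\bigcup_n I n) a.
    by move=> a sa; rewrite Es; apply: ideal_gen_mem.
  elim: (s) => [|x t IHt] h; first by exists 0%N.
  have [n tn] : exists n, forall a, a \in t -> I n a.
    by apply: IHt => a ta; apply: h; rewrite inE ta orbT.
  have [k _ xk] := h x (mem_head _ _); exists (n + k)%N => a.
  rewrite inE => /predU1P[->|/tn]; first exact: le_mono (leq_addl _ _) _ xk.
  exact: le_mono (leq_addr _ _) _.
exists n => k a Ia; apply: (ideal_gen_min (hI n) sn).
by rewrite -Es; exists k.
Qed.

Lemma noetherian_max (F : set (set R)) I0 :
  F I0 -> (forall I, F I -> is_ideal I) ->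
  exists I, [/\ F I, I0 `<=` I & forall J, F J -> I `<=` J -> J = I].
Proof.
move=> FI0 Fid; apply: contrapT => H.
have step (I : {I | F I /\ I0 `<=` I}) :
    exists J : {I | F I /\ I0 `<=` I}, sval I `<=` sval J /\ sval J <> sval I.
  case: I => I [FI I0I] /=; apply: contrapT => H'; apply: H; exists I; split=> //.
  move=> J FJ IJ; apply: contrapT => JI; apply: H'.
  by exists (exist _ J (conj FJ (subset_trans I0I IJ))).
have [f fP] := choice step.
pose g n := iter n f (exist _ I0 (conj FI0 (@subset_refl _ I0))).
have [||n gn] := @noetherian_acc (fun n => sval (g n)).
- by move=> n; apply: Fid; have [] := svalP (g n).
- by move=> n; have [] := fP (g n).
have [h1 h2] := fP (g n); apply: h2.
by apply/seteqP; split=> //; exact: (gn n.+1).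
Qed.

(** This yields an associated prime of R / I, as a maximal element among the colon ideals at
    elements outside I: if [b * u] is not in I, the colon ideal at [b * u] contains the one at u,
    hence equals it. *)
Lemma exists_prime_colon I :
  is_ideal I -> ~ I 1 -> exists u, ~ I u /\ is_prime (ideal_colon I u).
Proof.
move=> hI I1; pose F : set (set R) := [set J | exists2 u, ~ I u & J = ideal_colon I u].
have [||J [[u Iu ->] _ Jmax]] := @noetherian_max F (ideal_colon I 1).
- by exists 1.
- by move=> J [u _ ->]; apply: ideal_colonP.
exists u; split=> //; split; first exact: ideal_colonP.
  by rewrite /ideal_colon /= mul1r.
move=> a b Iab; have [Ibu|Ibu] := pselect (I (b * u)); first by right.
left; rewrite -(Jmax (ideal_colon I (b * u))).
- by rewrite /ideal_colon /= mulrA.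
- by exists (b * u).
by move=> c Icu; rewrite /ideal_colon /= mulrCA; apply: idealM.
Qed.

(** Noetherian induction along 0 -> R / (I : u) -> R / I -> R / (I + (u)) -> 0: in a maximal
    counterexample I, an element u with I : u prime exists, and I + (u) is strictly larger. *)
Lemma devissage (I0 : set R) (Phi : set R -> Prop) : is_ideal I0 ->
  Phi setT ->
  (forall Q, is_prime Q -> I0 `<=` Q -> Phi Q) ->
  (forall I u, is_ideal I -> Phi (ideal_colon I u) -> Phi (ideal_adj I u) -> Phi I) ->
  Phi I0.
Proof.
move=> hI0 PhiT PhiQ Phi_ext; apply: contrapT => NPhi.
pose F : set (set R) := [set I | [/\ is_ideal I, I0 `<=` I & ~ Phi I]].
have [||I [[hI I0I NI] _ Imax]] := @noetherian_max F I0; first by split.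
  by move=> I [].
have NI1 : ~ I 1.
  move=> I1; apply: NI; rewrite (_ : I = setT) //; apply/seteqP; split=> // a _.
  by rewrite -(mulr1 a); apply: idealM.
have [u [Iu Pu]] := exists_prime_colon hI NI1.
apply: NI; apply: (Phi_ext _ u) => //.
  by apply: PhiQ => //; apply: subset_trans I0I _; apply: ideal_colonS.
apply: contrapT => N; apply: Iu; rewrite -(Imax (ideal_adj I u)).
- exact: ideal_adj_gen.
- split=> //; first exact: ideal_adjP.
  exact: subset_trans I0I (@ideal_adjS _ _ _).
- exact: ideal_adjS.
Qed.

Lemma prime_avoiding (I : set R) (M : set R) :
  is_ideal I -> M 1 -> (forall a b, M a -> M b -> M (a * b)) ->
  (forall a, I a -> ~ M a) ->
  exists Q, [/\ is_prime Q, I `<=` Q & forall a, Q a -> ~ M a].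
Proof.
move=> hI M1 MM IM.
pose F : set (set R) := [set J | is_ideal J /\ forall a, J a -> ~ M a].
have [||Q [[hQ QM] IQ Qmax]] := @noetherian_max F I => //; first by move=> J [].
have meet a : ~ Q a -> exists q r, Q q /\ M (q + r * a).
  move=> Qa; apply: contrapT => H; apply: Qa; rewrite -(Qmax (ideal_adj Q a)).
  - exact: ideal_adj_gen.
  - split; first exact: ideal_adjP.
    by move=> _ [q [r [Qq ->]]] Mq; apply: H; exists q, r.
  - exact: ideal_adjS.
exists Q; split=> //; split=> //; first by move=> Q1; exact: QM Q1 M1.
move=> a b Qab; have [Qa|/meet[q [r [Qq Ma]]]] := pselect (Q a); first by left.
have [Qb|/meet[q' [r' [Qq' Mb]]]] := pselect (Q b); first by right.
case: (QM _ _ (MM _ _ Ma Mb)).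
rewrite (_ : _ * _ = q * (q' + r' * b) + (r * a) * q' + r * r' * (a * b)); last by ring.
by apply: idealD => //; [apply: idealD => //; [apply: idealMr|apply: idealM] | apply: idealM].
Qed.

Lemma local_proper (m I : set R) :
  local_ring m -> is_ideal I -> ~ I 1 -> I `<=` m.
Proof.
move=> [_ m_uniq] hI I1.
have [||J [[hJ J1] IJ Jmax]] :=
  @noetherian_max [set J | is_ideal J /\ ~ J 1] I => //; first by move=> J [].
suff -> : m = J by [].
apply/esym/m_uniq; split=> // K hK JK K1; apply: Jmax => //.
Qed.

Lemma local_unit (m : set R) a : local_ring m -> ~ m a -> exists b, b * a = 1.
Proof.
move=> m_loc ma; apply: contrapT => H; apply: ma.
apply: (local_proper m_loc (ideal_adjP a (@ideal_zero R))).
  by move=> [_ [r [-> E]]]; apply: H; exists r; rewrite E add0r.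
exact/ideal_adj_gen/ideal_zero.
Qed.

End Noetherian.

(** * Lengths of subquotients *)

Section Chains.
Variable R : comNzRingType.

Definition submod (V : lmodType R) (K : set V) : Prop :=
  K 0 /\ forall a u v, K u -> K v -> K (a *: u + v).

Section Submod.
Variable V : lmodType R.
Implicit Types (A B C K X : set V).

Lemma submodD K u v : submod K -> K u -> K v -> K (u + v).
Proof. by move=> [_ h] Ku Kv; rewrite -(scale1r u); apply: h. Qed.

Lemma submodZ K a u : submod K -> K u -> K (a *: u).
Proof. by move=> [h0 h] Ku; rewrite -(addr0 (_ *: _)); apply: h. Qed.

Lemma submodB K u v : submod K -> K u -> K v -> K (u - v).
Proof. by move=> hK Ku Kv; apply: submodD => //; rewrite -scaleN1r; apply: submodZ. Qed.

Lemma submod_sum K (T : Type) (r : seq T) (P : pred T) (F : T -> V) :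
  submod K -> (forall i, P i -> K (F i)) -> K (\sum_(i <- r | P i) F i).
Proof.
move=> hK KF; apply: big_ind => //; first by case: hK.
by move=> u v; apply: submodD.
Qed.

Definition add_set A B : set V := [set v | exists a b, [/\ A a, B b & v = a + b]].

Lemma add_setP A B : submod A -> submod B -> submod (add_set A B).
Proof.
move=> hA hB; split; first by exists 0, 0; rewrite addr0; split=> //; [case: hA|case: hB].
move=> r _ _ [a [b [Aa Bb ->]]] [a' [b' [Aa' Bb' ->]]].
exists (r *: a + a'), (r *: b + b'); split; [exact: (hA.2)|exact: (hB.2)|].
by rewrite scalerDr addrACA.
Qed.

Lemma setI_submod A B : submod A -> submod B -> submod (A `&` B).
Proof. by move=> [A0 hA] [B0 hB]; split=> // a u v [? ?] [? ?]; split; auto. Qed.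

(** For submodules A of B this says that B / A has length at least n. Counting strict inclusions
    avoids quotient modules and also makes sense when the length is infinite. *)
Fixpoint chain A n B : Prop :=
  match n with
  | 0 => A `<=` B
  | n.+1 => exists C, [/\ submod C, chain A n C, C `<=` B & exists2 b, B b & ~ C b]
  end.

Definition len_le A B N := forall n, chain A n B -> (n <= N)%N.

Lemma chain_sub A n B : chain A n B -> A `<=` B.
Proof.
elim: n B => //= n IHn B [C [_ /IHn sAC CB _]]; exact: subset_trans sAC CB.
Qed.

Lemma chain_monor A n B B' : B `<=` B' -> chain A n B -> chain A n B'.
Proof.
case: n => [|n] /= BB'; first by move=> AB; apply: subset_trans AB BB'.
move=> [C [hC sAC CB [b Bb NCb]]]; exists C; split=> //; last by exists b => //; apply: BB'.
exact: subset_trans CB BB'.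
Qed.

Lemma chain_monol A A' n B : A' `<=` A -> chain A n B -> chain A' n B.
Proof.
move=> A'A; elim: n B => [|n IHn] B /=; first exact: subset_trans.
by move=> [C [hC /IHn sAC CB NC]]; exists C.
Qed.

Lemma chain_cat A n B k C : submod B -> chain A n B -> chain B k C -> chain A (n + k) C.
Proof.
move=> hB AB; elim: k C => [|k IHk] C /=.
  by rewrite addn0 => BC; apply: chain_monor AB.
by rewrite addnS => -[D [hD /IHk AD DC ND]]; exists D.
Qed.

(** By the modular law, a strict inclusion of submodules remains strict after intersecting with X or
    after adding X, so every step of the chain is counted at least once. *)
Lemma chain_split A n B X : submod X -> A `<=` X -> submod B -> chain A n B ->
  exists n1 n2, [/\ (n <= n1 + n2)%N, chain A n1 (B `&` X) & chain X n2 (add_set B X)].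
Proof.
move=> hX AX; elim: n B => [|n IHn] B hB /=.
  move=> AB; exists 0%N, 0%N; split=> //=; first by move=> a Aa; split; [apply: AB|apply: AX].
  by move=> a Xa; exists 0, a; rewrite add0r; split=> //; case: hB.
move=> [C [hC sAC CB [b Bb NCb]]].
have [n1 [n2 [le_n h1 h2]]] := IHn _ hC sAC.
have CBX : C `&` X `<=` B `&` X by move=> a [/CB].
have sCBX : add_set C X `<=` add_set B X.
  by move=> _ [a [x [/CB Ba Xx ->]]]; exists a, x.
have [[c CcX]|nb] := pselect (exists c, (B `&` X) c /\ ~ C c).
  exists n1.+1, n2; split; [by rewrite addSn ltnS| |exact: (chain_monor sCBX h2)].
  exists (C `&` X); split=> //; first exact: setI_submod.
  by exists c => [|[]]; case: CcX.
exists n1, n2.+1; split; [by rewrite addnS ltnS|exact: (chain_monor CBX h1)|].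
exists (add_set C X); split=> //; first exact: add_setP.
exists b; first by exists b, 0; rewrite addr0; split=> //; case: hX.
move=> [c [x [Cc Xx Eb]]]; apply: nb; exists x; split.
  split=> //; have -> : x = b - c by rewrite Eb addrC addKr.
  by apply: submodB => //; apply: CB.
by move=> Cx; apply: NCb; rewrite Eb; apply: submodD.
Qed.

Lemma len_split A X B N1 N2 : submod X -> submod B -> A `<=` X -> X `<=` B ->
  len_le A X N1 -> len_le X B N2 -> len_le A B (N1 + N2).
Proof.
move=> hX hB AX XB l1 l2 n AB.
have [n1 [n2 [le_n h1 h2]]] := chain_split hX AX hB AB.
apply: leq_trans le_n _; apply: leq_add; first by apply: l1; apply: (chain_monor _ h1) => v [].
by apply: l2; apply: (chain_monor _ h2) => _ [b [x [Bb /XB Bx ->]]]; apply: submodD.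
Qed.

Lemma len_triv A B N : B `<=` A -> len_le A B N.
Proof.
move=> BA [|n] //= [C [_ sAC CB [b /BA Ab NCb]]].
by case: NCb; apply: chain_sub sAC _ Ab.
Qed.

Lemma len_leW A B N N' : (N <= N')%N -> len_le A B N -> len_le A B N'.
Proof. by move=> le_N h n /h /leq_trans; apply. Qed.

End Submod.

(* A linear relation inducing an injection B / A -> B' / A' carries chains
   along; relations are needed for the connecting maps of long exact
   sequences. *)
Lemma chain_rel (V W : lmodType R) (A B : set V) (A' B' : set W)
    (rho : V -> W -> Prop) n :
  submod B -> submod A' -> submod B' -> A' `<=` B' ->
  rho 0 0 ->
  (forall a u v u' v', rho u u' -> rho v v' -> rho (a *: u + v) (a *: u' + v')) ->
  (forall b, B b -> exists2 w, B' w & rho b w) ->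
  (forall b w, B b -> A' w -> rho b w -> A b) ->
  chain A n B -> chain A' n B'.
Proof.
move=> hB hA' hB' A'B' rho0 rhoL tot inj.
pose im (C : set V) : set W :=
  add_set [set w | B' w /\ exists2 c, C c & rho c w] A'.
have im_sub C : submod C -> submod (im C).
  move=> [C0 hC]; apply: add_setP => //; split.
    by split; [case: hB' | exists 0].
  move=> a u v [Bu [c Cc cu]] [Bv [c' Cc' cv]]; split; first exact: hB'.2.
  by exists (a *: c + c'); auto.
suff H C : submod C -> C `<=` B -> chain A n C -> chain A' n (im C).
  move=> AB; apply: chain_monor (H B hB _ AB) => // _ [w [a [[Bw _] Aa ->]]].
  by apply: submodD => //; apply: A'B'.
elim: n C => [|n IHn] C hC CB /=.
  move=> sAC a Aa; exists 0, a; rewrite add0r; split=> //; split; first by case: hB'.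
  by exists 0 => //; case: hC.
move=> [D [hD AD DC [c Cc NDc]]]; exists (im D); split.
- exact: im_sub.
- by apply: IHn => //; apply: subset_trans DC CB.
- move=> _ [w [a [[Bw [d Dd dw]] Aa ->]]]; exists w, a; split=> //; split=> //.
  by exists d => //; apply: DC.
have [w Bw cw] := tot c (CB _ Cc); exists w.
  by exists w, 0; rewrite addr0; split=> //; [split=> //; exists c|case: hA'].
move=> [w1 [a [[_ [d Dd dw1]] Aa Ew]]]; apply: NDc.
rewrite -(subrK d c); apply: submodD => //; apply: (chain_sub AD).
apply: (inj _ a) => //; first by apply: submodB => //; apply: CB => //; apply: DC.
have := rhoL (- 1) _ _ _ _ dw1 cw.
by rewrite !scaleN1r Ew addKr addrC.
Qed.

Lemma chain_lin (V W : lmodType R) (A B : set V) (A' B' : set W) (f : V -> W) n :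
  submod B -> submod A' -> submod B' -> A' `<=` B' -> linear f ->
  (forall b, B b -> B' (f b)) ->
  (forall b, B b -> A' (f b) -> A b) ->
  chain A n B -> chain A' n B'.
Proof.
move=> hB hA' hB' A'B' lin fB fA.
have f0 : f 0 = 0 by rewrite -[0 in LHS](subrr (0 : V)) -scaleN1r addrC lin scaleN1r addNr.
apply: (@chain_rel _ _ _ _ _ _ (fun v w => w = f v)) => //.
- by move=> a u v _ _ -> ->; rewrite lin.
- by move=> b Bb; exists (f b) => //; apply: fB.
- by move=> b w Bb A'w Eb; apply: fA => //; rewrite -Eb.
Qed.

Lemma ideal_submod (I : set R) : is_ideal I -> submod (I : set R^o).
Proof.
move=> hI; split; first exact: ideal0.
by move=> a u v Iu Iv; apply: idealD => //; apply: idealM.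
Qed.

Lemma submod_ideal (I : set R) : submod (I : set R^o) -> is_ideal I.
Proof.
move=> hI; split; first by case: hI.
- by move=> a b; apply: (@submodD R^o).
- by move=> r a; apply: (@submodZ R^o).
Qed.

End Chains.

(** * Koszul cohomology *)

Section Koszul.
Variable R : comNzRingType.
Implicit Types (s : seq R) (I Q : set R) (c b e : bitseq -> R^o) (w : bitseq).

(* A cochain assigns a coefficient to each subset of the index set of s, given
   as the bit sequence of its characteristic function; the complex of x :: s is
   the cone of multiplication by x on the complex of s. *)
Fixpoint kd s (c : bitseq -> R) (w : bitseq) : R :=
  match s, w with
  | x :: s', b :: w' =>
      if b then x * c (false :: w') - kd s' (fun v => c (true :: v)) w'
      else kd s' (fun v => c (false :: v)) w'
  | _, _ => 0
  end.

Lemma scaled_addE a (u v : bitseq -> R^o) w : (a *: u + v) w = a * u w + v w.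
Proof. by []. Qed.

Definition wt (d k : nat) w := (size w == d) && (count id w == k).

Definition tl (i : bool) (c : bitseq -> R^o) : bitseq -> R^o := fun w => c (i :: w).

Definition join (u v : bitseq -> R^o) : bitseq -> R^o :=
  fun w => if w is i :: w' then (if i then v w' else u w') else 0.

(** Cocycles with coefficients in R / I, represented by R-valued functions. Values at words of the
    wrong length or weight are unconstrained, so one ambient module serves every degree and every
    I. *)
Definition cocyc s I k : set (bitseq -> R^o) :=
  [set c | forall w, wt (size s) k.+1 w -> I (kd s c w)].

Definition cobd s I k : set (bitseq -> R^o) :=
  [set c | exists b : bitseq -> R^o,
     forall w, wt (size s) k w -> I (c w - kd s b w)].

Lemma wt_false d k w : wt d.+1 k (false :: w) = wt d k w.
Proof. by rewrite /wt /= eqSS add0n. Qed.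

Lemma wt_true d k w : wt d.+1 k.+1 (true :: w) = wt d k w.
Proof. by rewrite /wt /= !eqSS. Qed.

Lemma wt_true0 d w : wt d.+1 0 (true :: w) = false.
Proof. by rewrite /wt /= andbF. Qed.

Lemma kd_ext s (c c' : bitseq -> R) w : c =1 c' -> kd s c w = kd s c' w.
Proof.
elim: s c c' w => [|x s IHs] c c' [|[] w] //= cc'; last exact: IHs.
by rewrite cc' (IHs _ (fun v => c' (true :: v))).
Qed.

Lemma kd_lin s a (c c' : bitseq -> R) w :
  kd s (fun v => a * c v + c' v) w = a * kd s c w + kd s c' w.
Proof.
elim: s c c' w => [|x s IHs] c c' w /=; first by rewrite mulr0 addr0.
case: w => [|[] w]; first by rewrite mulr0 addr0.
  rewrite (IHs (fun v => c (true :: v)) (fun v => c' (true :: v))); ring.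
exact: (IHs (fun v => c (false :: v)) (fun v => c' (false :: v))).
Qed.

Lemma kdD s (c c' : bitseq -> R) w :
  kd s (fun v => c v + c' v) w = kd s c w + kd s c' w.
Proof.
rewrite -[kd s c w]mul1r -kd_lin; apply: kd_ext => v; by rewrite mul1r.
Qed.

Lemma kd0 s w : kd s (fun=> 0) w = 0.
Proof.
transitivity (kd s (fun=> -1 * 0 + 0) w).
  by apply: kd_ext => v; rewrite mulr0 addr0.
by rewrite (kd_lin s (-1) (fun=> 0) (fun=> 0)) mulN1r addNr.
Qed.

Lemma kdZ s a (c : bitseq -> R) w : kd s (fun v => a * c v) w = a * kd s c w.
Proof.
rewrite -[RHS]addr0 -(kd0 s w) -kd_lin; apply: kd_ext => v; by rewrite addr0.
Qed.

Lemma kdN s (c : bitseq -> R) w : kd s (fun v => - c v) w = - kd s c w.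
Proof. by rewrite -mulN1r -kdZ; apply: kd_ext => v; rewrite mulN1r. Qed.

Lemma kdB s (c c' : bitseq -> R) w :
  kd s (fun v => c v - c' v) w = kd s c w - kd s c' w.
Proof. by rewrite kdD kdN. Qed.

Lemma kd_kd s (c : bitseq -> R) w : kd s (kd s c) w = 0.
Proof.
elim: s c w => [|x s IHs] c [|[] w] //=.
by rewrite (kdB s (fun v => x * _)) kdZ IHs subr0 subrr.
Qed.

Lemma kd_wt0 s (c : bitseq -> R) w : wt (size s) 0 w -> kd s c w = 0.
Proof.
elim: s c w => [|x s IHs] c [|[] w] //=; first by rewrite wt_true0.
by rewrite wt_false => /IHs.
Qed.

Lemma kd_ideal s I k (c : bitseq -> R) : is_ideal I ->
  (forall w, wt (size s) k w -> I (c w)) ->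
  forall w, wt (size s) k.+1 w -> I (kd s c w).
Proof.
move=> hI; elim: s k c => [|x s IHs] k c cI [|[] w] //=; try by move=> _; apply: ideal0.
  rewrite wt_true => hw; apply: idealB => //.
    by apply: idealM => //; apply: cI; rewrite wt_false.
  case: k cI hw => [|k] cI hw; first by rewrite (kd_wt0 _ hw); apply: ideal0.
  by apply: IHs hw => v hv; apply: cI; rewrite wt_true.
by rewrite wt_false; apply: IHs => v hv; apply: cI; rewrite wt_false.
Qed.

Lemma cocycP s I k : is_ideal I -> submod (cocyc s I k).
Proof.
move=> hI; split=> [w _|a u v hu hv w hw]; first by rewrite [kd s _ w]kd0; apply: ideal0.
rewrite [kd s _ w]kd_lin; apply: idealD => //; last exact: hv.
by apply: idealM => //; apply: hu.
Qed.

Lemma cobdP s I k : is_ideal I -> submod (cobd s I k).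
Proof.
move=> hI; split=> [|a u v [b hb] [e he]].
  by exists 0 => w _; rewrite [kd s _ w]kd0 subr0; apply: ideal0.
exists (a *: b + e) => w hw; rewrite [kd s _ w]kd_lin.
rewrite scaled_addE.
rewrite (_ : _ - _ = a * (u w - kd s b w) + (v w - kd s e w)); last by ring.
by apply: idealD; [|apply: idealM => //; apply: hb|apply: he].
Qed.

Lemma cobd_cocyc s I k : is_ideal I -> cobd s I k `<=` cocyc s I k.
Proof.
move=> hI c [b hb] w hw; rewrite -[kd s c w]subr0 -(kd_kd s b w) -kdB.
exact: kd_ideal hb w hw.
Qed.

Lemma cobdS s I J k : I `<=` J -> cobd s I k `<=` cobd s J k.
Proof. by move=> IJ c [b hb]; exists b => w /hb/IJ. Qed.

Lemma cocyc_cons x s I k c : is_ideal I ->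
  cocyc (x :: s) I k c <->
  cocyc s I k (tl false c) /\
  forall w, wt (size s) k w -> I (x * tl false c w - kd s (tl true c) w).
Proof.
move=> hI; split=> [h|[h0 h1]].
  split=> w hw; first by have := h (false :: w); rewrite wt_false; apply.
  by have := h (true :: w); rewrite wt_true; apply.
by move=> [|[] w] //; rewrite ?wt_true ?wt_false => hw; [apply: h1 | apply: h0].
Qed.

(** The weight condition is imposed on [true :: w] and not on w so that k = 0 is included: it is
    then never satisfied. *)
Lemma cobd_cons x s I k c : is_ideal I ->
  cobd (x :: s) I k c <->
  exists b e : bitseq -> R^o,
    (forall w, wt (size s) k w -> I (c (false :: w) - kd s b w)) /\
    (forall w, wt (size s).+1 k (true :: w) ->
       I (c (true :: w) - (x * b w - kd s e w))).
Proof.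
move=> hI; split=> [[b hb]|[b [e [h0 h1]]]].
  exists (tl false b), (tl true b); split=> w hw.
    by have := hb (false :: w); rewrite wt_false; apply.
  exact: hb.
exists (join b e) => -[|[] w] //; last by rewrite wt_false; apply: h0.
exact: h1.
Qed.

Local Notation coh_le s I k := (len_le (cobd s I k) (cocyc s I k)).

Lemma len_cone0 x s I N : is_ideal I ->
  coh_le s I 0 N -> coh_le (x :: s) I 0 N.
Proof.
move=> hI hN n ch; apply: hN; move: ch; apply: (chain_lin (f := tl false)) => //.
- exact: cocycP.
- exact: cobdP.
- exact: cocycP.
- exact: cobd_cocyc.
- by move=> c /cocyc_cons[].
- move=> c _ [b hb]; apply/cobd_cons => //; exists b, 0; split=> [w /hb //|w].
  by rewrite wt_true0.
Qed.

(** From the exact sequence H^k(s) -> H^(k+1)(x :: s) -> H^(k+1)(s) of a cone; X is the kernel of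
    the second map. *)
Lemma len_cone x s I k N N' : is_ideal I ->
  coh_le s I k N -> coh_le s I k.+1 N' -> coh_le (x :: s) I k.+1 (N + N').
Proof.
move=> hI hN hN'.
pose X := cocyc (x :: s) I k.+1 `&` [set c | cobd s I k.+1 (tl false c)].
have hX : submod X.
  apply: setI_submod; first exact: cocycP.
  have [h0 h] := cobdP s k.+1 hI; split=> // a u v hu hv; exact: (h a _ _ hu hv).
apply: (@len_split _ _ _ X) => //; first exact: cocycP.
- move=> c cb; split; first exact: cobd_cocyc cb.
  by have [b [e [h0 _]]] := (cobd_cons x s k.+1 c hI).1 cb; exists b => w /h0.
- by move=> c [].
- move=> n ch; apply: hN; move: ch.
  (* When b bounds [tl false c], the cochain [tl true c] minus x times b is a cocycle of s. It
     depends on the choice of b, whence a relation. *)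
  pose rho c (v : bitseq -> R^o) := exists b : bitseq -> R^o,
    (forall w, wt (size s) k.+1 w -> I (c (false :: w) - kd s b w)) /\
    (forall w, v w = c (true :: w) - x * b w).
  apply: (chain_rel (rho := rho)) => //.
  + exact: cobdP.
  + exact: cocycP.
  + exact: cobd_cocyc.
  + exists 0; split=> w => [_|]; first by rewrite [kd s _ _]kd0 subr0; apply: ideal0.
    by rewrite mulr0 subr0.
  + move=> a u v u' v' [b [hb1 hb2]] [e [he1 he2]]; exists (a *: b + e); split=> w.
      move=> hw; rewrite [kd s _ _]kd_lin scaled_addE.
      rewrite (_ : _ - _ = a * (u (false :: w) - kd s b w) + (v (false :: w) - kd s e w));
        last by ring.
      by apply: idealD; [|apply: idealM => //; apply: hb1|apply: he1].
    by rewrite !scaled_addE hb2 he2; ring.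
  + move=> c [hc [b hb]]; exists (fun w => c (true :: w) - x * b w); last by exists b.
    have [_ h] := (cocyc_cons x s k.+1 c hI).1 hc.
    move=> w hw; rewrite (kdB s (tl true c) (fun v => x * b v)) kdZ.
    rewrite (_ : _ - _ = x * (tl false c w - kd s b w) -
      (x * tl false c w - kd s (tl true c) w)); last by ring.
    by apply: idealB => //; [apply: idealM => //; apply: hb|apply: h].
  + move=> c v [hc _] [e he] [b [hb Ev]]; apply/cobd_cons => //.
    exists b, (fun w => - e w); split=> // w; rewrite wt_true kdN => hw.
    rewrite (_ : _ - _ = v w - kd s e w); last by rewrite Ev; ring.
    exact: he.
- move=> n ch; apply: hN'; move: ch; apply: (chain_lin (f := tl false)) => //.
  + exact: cocycP.
  + exact: cobdP.
  + exact: cocycP.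
  + exact: cobd_cocyc.
  + by move=> c /cocyc_cons[].
Qed.

Lemma len_reg0 x s Q N : is_ideal Q -> (forall a, Q (x * a) -> Q a) ->
  coh_le (x :: s) Q 0 N.
Proof.
move=> hQ reg; apply: len_triv => c /(cocyc_cons x s 0 c hQ)[_ h].
exists 0 => -[|[] w] //; first by rewrite wt_true0.
rewrite [size _]/= wt_false => hw; rewrite [kd _ _ _]kd0 subr0; apply: reg.
by have := h w hw; rewrite (kd_wt0 _ hw) subr0.
Qed.

(** As x is regular on R / Q, the cone of multiplication by x computes the cohomology of s on R / (Q
    + (x)), one degree lower. This shift is what ties the growth exponent to the degree. *)
Lemma len_reg x s Q k N : is_ideal Q -> (forall a, Q (x * a) -> Q a) ->
  coh_le s (ideal_adj Q x) k N -> coh_le (x :: s) Q k.+1 N.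
Proof.
move=> hQ reg hN n ch; apply: hN; move: ch.
have hQx := ideal_adjP x hQ.
apply: (chain_lin (f := tl true)) => //.
- exact: cocycP.
- exact: cobdP.
- exact: cocycP.
- exact: cobd_cocyc.
- move=> c /(cocyc_cons x s k.+1 c hQ)[_ h] w /h hw.
  exists (- (x * tl false c w - kd s (tl true c) w)), (tl false c w).
  by split; [exact: idealN | ring].
- move=> c /(cocyc_cons x s k.+1 c hQ)[_ hc] [e he].
  (* Modulo Q, [tl true c] differs from a coboundary by x times g; the cocycle condition and
     cancellation of x then show that g bounds [tl false c]. *)
  have /choice[g hg] : forall w, exists g : R, wt (size s) k w ->
      Q (c (true :: w) - kd s e w - x * g).
    move=> w; have [hw|] := boolP (wt (size s) k w); last by exists 0.
    have [i [r [Qi E]]] := he w hw; exists r => _.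
    by move: E; rewrite /tl => ->; rewrite [x * r]mulrC addrK.
  apply/cobd_cons => //; exists g, (fun w => - e w); split=> w; last first.
    rewrite wt_true kdN => /hg; congr Q; ring.
  move=> hw; apply: reg.
  rewrite (_ : x * _ = (x * tl false c w - kd s (tl true c) w) +
     kd s (fun v => tl true c v - kd s e v - x * g v) w).
    apply: idealD => //; first exact: hc.
    by apply: (kd_ideal hQ) hw => v hv; apply: hg.
  by rewrite kdB kdB kd_kd kdZ /tl; ring.
Qed.

(** Long exact sequence of 0 -> R / (I : u) -> R / I -> R / (I + (u)) -> 0, whose first map is
    multiplication by u. X consists of the cocycles that bound modulo I + (u); [rho] lifts them to R
    / (I : u). *)
Lemma len_ext s I u k N N' : is_ideal I ->
  coh_le s (ideal_colon I u) k N -> coh_le s (ideal_adj I u) k N' ->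
  coh_le s I k (N + N').
Proof.
move=> hI hN hN'.
have hc := ideal_colonP u hI; have ha := ideal_adjP u hI.
pose X := cocyc s I k `&` cobd s (ideal_adj I u) k.
apply: (@len_split _ _ _ X).
- by apply: setI_submod; [apply: cocycP|apply: cobdP].
- exact: cocycP.
- move=> c cb; split; first exact: cobd_cocyc cb.
  by apply: cobdS cb; apply: ideal_adjS.
- by move=> c [].
- move=> n ch; apply: hN; move: ch.
  pose rho c (v : bitseq -> R^o) := exists b : bitseq -> R^o,
    forall w, wt (size s) k w -> I (c w - kd s b w - u * v w).
  apply: (chain_rel (rho := rho)).
  + by apply: setI_submod; [apply: cocycP|apply: cobdP].
  + exact: cobdP.
  + exact: cocycP.
  + exact: cobd_cocyc.
  + exists 0 => w _; rewrite [kd s _ _]kd0 mulr0 !subr0; exact: ideal0.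
  + move=> a v1 v2 u1 u2 [b hb] [e he]; exists (a *: b + e) => w hw.
    rewrite [kd s _ _]kd_lin !scaled_addE.
    rewrite (_ : _ - _ = a * (v1 w - kd s b w - u * u1 w) + (v2 w - kd s e w - u * u2 w));
      last by ring.
    by apply: idealD; [|apply: idealM => //; apply: hb|apply: he].
  + move=> c [hcc [b hb]].
    have /choice[g hg] : forall w, exists g : R, wt (size s) k w ->
        I (c w - kd s b w - u * g).
      move=> w; have [hw|] := boolP (wt (size s) k w); last by exists 0.
      by have [i [r [Ii E]]] := hb w hw; exists r => _; rewrite E [u * r]mulrC addrK.
    exists g; last by exists b.
    move=> w hw; rewrite /ideal_colon /= mulrC.
    rewrite (_ : u * _ = kd s c w - kd s (fun v => c v - kd s b v - u * g v) w).
      by apply: idealB => //; [apply: hcc | apply: (kd_ideal hI) hw => v; apply: hg].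
    by rewrite !kdB kd_kd kdZ; ring.
  + move=> c v _ [e he] [b hb]; exists (fun w => b w + u * e w) => w hw.
    rewrite kdD kdZ (_ : _ - _ = (c w - kd s b w - u * v w) + (v w - kd s e w) * u);
      last by ring.
    by apply: idealD => //; [apply: hb | apply: he].
- move=> n ch; apply: hN'; move: ch; apply: (chain_lin (f := id)) => //.
  + exact: cocycP.
  + exact: cobdP.
  + exact: cocycP.
  + exact: cobd_cocyc.
  + by move=> c hcc w /hcc; apply: ideal_adjS.
Qed.

(** The powers of x filter R / (Q + (x^(n+1))) with n + 1 factors, each isomorphic to R / (Q + (x))
    because x is regular modulo Q. *)
Lemma len_pow x s Q k N n : is_ideal Q -> (forall a, Q (x * a) -> Q a) ->
  coh_le s (ideal_adj Q x) k N -> coh_le s (ideal_adj Q (x ^+ n.+1)) k (n.+1 * N).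
Proof.
move=> hQ reg hN; elim: n => [|n IHn]; first by rewrite expr1 mul1n.
have regn l a : Q (x ^+ l * a) -> Q a.
  by elim: l => [|l IHl]; rewrite ?expr0 ?mul1r // exprS -mulrA => /reg.
have hI := ideal_adjP (x ^+ n.+2) hQ.
rewrite mulSn; apply: (@len_ext _ _ (x ^+ n.+1)) => //.
  rewrite (_ : ideal_colon _ _ = ideal_adj Q x) //; apply/seteqP; split=> a.
    move=> [i [r [Qi E]]]; exists (a - r * x), r; split; last by ring.
    by apply: (regn n.+1); rewrite mulrC mulrBl E -mulrA -exprS addrK.
  move=> [i [r [Qi ->]]]; exists (i * x ^+ n.+1), r.
  by split; [apply: idealMr | rewrite mulrDl -mulrA -exprS].
rewrite (_ : ideal_adj _ _ = ideal_adj Q (x ^+ n.+1)) //; apply/seteqP; split.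
  apply: ideal_adj_min; [exact: ideal_adjP| |exact: ideal_adj_gen].
  apply: ideal_adj_min; [exact: ideal_adjP|exact: ideal_adjS|].
  by rewrite [x ^+ n.+2]exprS; apply: idealM; [exact: ideal_adjP|exact: ideal_adj_gen].
apply: ideal_adj_min; [exact: ideal_adjP| |exact: ideal_adj_gen].
exact: subset_trans (@ideal_adjS _ _ _) (@ideal_adjS _ _ _).
Qed.

Definition powers s n := [seq x ^+ n.+1 | x <- s].

(* The cohomology in degree k is the homology in degree (size s) - k, which is
   small except in homological degree 0. *)
Theorem koszul_length_bound (m : set R) s I k :
  noetherian R -> is_maximal m -> is_ideal I ->
  (forall Q, is_prime Q -> I `<=` Q -> (forall x, x \in s -> Q x) -> m `<=` Q) ->
  exists C, forall n, coh_le (powers s n) I k (C * n.+1 ^ k).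
Proof.
move=> R_noeth m_max; elim: s I k => [|x s IHs] I k hI prim.
  suff [C hC] : exists C, coh_le [::] I k C.
    by exists C => n; apply: len_leW hC; rewrite leq_pmulr // expn_gt0.
  apply: (devissage (Phi := fun J => exists C, coh_le [::] J k C) R_noeth hI).
  - by exists 0%N; apply: len_triv => c _; exists 0.
  - move=> Q hQ IQ; have mQ : m `<=` Q by apply: prim.
    have [hQi Q1 _] := hQ; have EQ : Q = m by have [_ _ h] := m_max; apply: h.
    (* Since Q = m, the degree 0 cohomology is the field R / m, and it is zero in other degrees: an
       element b outside D' has [b [::]] invertible modulo m, so D already contains every
       cochain. *)
    exists 1%N => -[|[|n]] //= [D [hD [D' [hD' sub D'D [b Db ND'b]]] _ [c _ NDc]]].
    case: NDc; case: k D'D sub => [|k] D'D sub; last first.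
      apply: D'D; apply: (chain_sub sub); exists 0 => -[|[] w] //.
    have QD (e : bitseq -> R^o) : Q (e [::]) -> D' e.
      move=> Qe; apply: (chain_sub sub); exists 0 => -[|a w] // _.
      by rewrite /= subr0.
    have Nb : ~ Q (b [::]) by move=> /QD.
    have [i [r [Qi E]]] : ideal_adj Q (b [::]) 1.
      apply: contrapT => N1; apply: Nb; rewrite {1}EQ.
      have [_ _ h] := m_max; rewrite -(h (ideal_adj Q (b [::]))) //.
      + exact: ideal_adj_gen.
      + exact: ideal_adjP.
      + by rewrite -EQ; apply: ideal_adjS.
    rewrite (_ : c = (c [::] * r) *: b + (c - (c [::] * r) *: b)); last by rewrite addrC subrK.
    apply: submodD => //; first exact: submodZ.
    apply: D'D; apply: QD; rewrite -[X in Q X]/(c [::] - c [::] * r * b [::]).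
    rewrite (_ : _ - _ = c [::] * i); first exact: idealM.
    by rewrite -[X in X - _]mulr1 E; ring.
  - move=> J u hJ [C hC] [C' hC']; exists (C + C')%N; exact: len_ext hC hC'.
apply: (devissage (Phi := fun J => exists C, forall n,
  coh_le (powers (x :: s) n) J k (C * n.+1 ^ k)) R_noeth hI) => [|Q hQ IQ|J u hJ [C hC] [C' hC']].
- by exists 0%N => n; apply: len_triv => c _; exists 0.
- have [hQi Q1 QM] := hQ; have [Qx|NQx] := pselect (Q x).
    have prim' Q' : is_prime Q' -> Q `<=` Q' -> (forall y, y \in s -> Q' y) -> m `<=` Q'.
      move=> hQ' QQ' sQ'; apply: prim => //; first exact: subset_trans IQ QQ'.
      by move=> y; rewrite inE => /predU1P[->|/sQ' //]; apply: QQ'.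
    case: k => [|k].
      have [C hC] := IHs Q 0%N hQi prim'; exists C => n; exact: (len_cone0 (x := x ^+ n.+1) hQi (hC n)).
    have [C hC] := IHs Q k hQi prim'; have [C' hC'] := IHs Q k.+1 hQi prim'.
    exists (C + C')%N => n; rewrite mulnDl.
    apply: len_leW (len_cone (x := x ^+ n.+1) hQi (hC n) (hC' n)).
    by rewrite leq_add2r leq_mul2l leq_pexp2l ?orbT.
  have reg a : Q (x * a) -> Q a by move=> /QM[].
  have regn n a : Q (x ^+ n * a) -> Q a.
    by move=> /QM[/(prime_exp hQ)|].
  case: k => [|k].
    by exists 0%N => n; apply: (len_reg0 (x := x ^+ n.+1) _ hQi (regn _)).
  have [||C hC] := IHs (ideal_adj Q x) k.
  - exact: ideal_adjP.
  - move=> Q' hQ' QQ' sQ'; apply: prim => //.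
      exact: subset_trans IQ (subset_trans (@ideal_adjS _ _ _) QQ').
    by move=> y; rewrite inE => /predU1P[->|/sQ' //]; apply/QQ'/ideal_adj_gen.
  exists C => n; rewrite expnS mulnCA.
  exact: (len_reg (x := x ^+ n.+1) hQi (regn _) (len_pow (n := n) hQi reg (hC n))).
- exists (C + C')%N => n; rewrite mulnDl; exact: len_ext (hC n) (hC' n).
Qed.

End Koszul.

(** * Growth along a chain of primes *)

Section HilbertBasis.
Variables (A : comNzRingType) (A_noeth : noetherian A).
Implicit Types (f g : {poly A}) (s : seq {poly A}) (I : set {poly A}).

(** Multiplying each f by the power of 'X that raises its size to N aligns all leading coefficients
    at index [N.-1]. *)
Lemma lead_coef_ideal s N c :
  (forall f, f \in s -> (0 < size f <= N)%N) ->
  ideal_gen [seq lead_coef f | f <- s] c ->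
  exists g, [/\ ideal_gen s g, (size g <= N)%N & g`_N.-1 = c].
Proof.
elim: s c => [|f s IHs] c sN /=.
  move=> [a ->]; rewrite big_ord0; exists 0; rewrite size_poly0 coef0; split=> //.
  by apply: (ideal0 (ideal_genP _)).
move=> /ideal_gen_cons[r [c' [sc' ->]]].
have [||g [sg leg Eg]] := IHs c' => // [h sh|]; first by apply: sN; rewrite inE sh orbT.
have /andP[f0 fN] := sN f (mem_head _ _).
have Xf : 'X^(N - size f) * f = f * 'X^(N - size f) by rewrite mulrC.
exists (r *: 'X^(N - size f) * f + g); split.
- by apply/ideal_gen_cons; exists (r *: 'X^(N - size f)), g.
- rewrite (leq_trans (size_polyD _ _)) // geq_max leg andbT -scalerAl Xf.
  rewrite (leq_trans (size_scale_leq _ _)) // (leq_trans (size_polyMleq _ _)) //.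
  by rewrite size_polyXn addnS /= subnKC.
- rewrite coefD -scalerAl coefZ Xf coefMXn Eg ltn_subRL.
  have -> : (size f + N.-1 < N)%N = false by apply/negbTE; lia.
  by have -> : (N.-1 - (N - size f) = (size f).-1)%N by lia.
Qed.

(** If I is not finitely generated, adjoin repeatedly an element of I of least size outside the
    ideal generated so far. Once the ideals of leading coefficients are stationary, the next element
    can be reduced to a smaller size, against its choice. *)
Theorem hilbert_basis : noetherian {poly A}.
Proof.
move=> I hI; apply: contrapT => NI.
have step s : exists f, (forall g, g \in s -> I g) ->
    [/\ I f, ~ ideal_gen s f &
        forall g, I g -> ~ ideal_gen s g -> (size f <= size g)%N].
  have [sI|] := pselect (forall g, g \in s -> I g); last by exists 0.
  pose Q n := `[< exists f, [/\ I f, ~ ideal_gen s f & size f = n] >].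
  have exQ : exists n, Q n.
    apply: contrapT => H; apply: NI; exists s; apply/seteqP; split.
      move=> f If; apply: contrapT => Nf; apply: H; exists (size f).
      by apply/asboolP; exists f.
    exact: ideal_gen_min hI sI.
  case: (ex_minnP exQ) => n /asboolP[f [If Nf <-]] f_min; exists f => _; split=> //.
  by move=> g Ig Ng; apply: f_min; apply/asboolP; exists g.
have [F FP] := choice step.
pose S n := iter n (fun s => F s :: s) [::].
have SI n g : g \in S n -> I g.
  elim: n g => [|n IHn] g //=; rewrite inE => /predU1P[->|/IHn //].
  by have [] := FP (S n) IHn.
have lt_gen n k : (n <= k)%N -> ideal_gen (S n) `<=` ideal_gen (S k).
  move=> /subnK <-; elim: (k - n)%N => [|l IHl] // g /IHl.
  rewrite addSn /= => h; apply/ideal_gen_cons; exists 0, g.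
  by rewrite mul0r add0r.
pose f n := F (S n).
have f_mono n k : (n <= k)%N -> (size (f n) <= size (f k))%N.
  move=> lenk; have [_ _] := FP (S n) (SI n); apply.
    by have [] := FP (S k) (SI k).
  by move=> /(lt_gen _ _ lenk); have [] := FP (S k) (SI k).
have f_pos n : (0 < size (f n))%N.
  rewrite lt0n size_poly_eq0; apply/eqP => f0; have [_ + _] := FP (S n) (SI n).
  by apply; rewrite -/(f n) f0; apply: (ideal0 (ideal_genP _)).
have sizeS n g k : g \in S n -> (n <= k)%N -> (0 < size g <= size (f k))%N.
  elim: n g => [|n IHn] g //=; rewrite inE => /predU1P[-> /ltnW lenk|/IHn h /ltnW /h //].
  by rewrite f_pos f_mono.
have [||n Ln] := noetherian_acc A_noeth
    (I := fun n => ideal_gen [seq lead_coef g | g <- S n]).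
- by move=> n; apply: ideal_genP.
- move=> n c h; apply/ideal_gen_cons; exists 0, c; rewrite mul0r add0r; split=> //.
have lead_in : ideal_gen [seq lead_coef g | g <- S n] (lead_coef (f n)).
  by apply: (Ln n.+1); apply: ideal_gen_mem; rewrite /= mem_head.
have [|g [Sg leg Eg]] := lead_coef_ideal (N := size (f n)) _ lead_in.
  by move=> g /sizeS; apply.
have [If Nf f_min] := FP (S n) (SI n).
have Ig : I g by apply: (ideal_gen_min hI (SI n)).
have := f_min (f n - g); rewrite leqNgt -/(f n).
have -> : (size (f n - g : {poly A})%R < size (f n))%N.
  rewrite -(prednK (f_pos n)) ltnS; apply/leq_sizeP => j.
  rewrite leq_eqVlt coefB => /predU1P[<-|lt_j]; first by rewrite Eg subrr.
  have le_j : (size (f n) <= j)%N by rewrite -(prednK (f_pos n)).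
  by rewrite !nth_default ?subrr // (leq_trans leg).
move=> /(_ (idealB hI If Ig)) H; suff : ~~ true by [].
apply: H => Sfg; apply: Nf; rewrite -/(f n) -(subrK g (f n)).
exact: idealD (ideal_genP _) Sfg Sg.
Qed.

End HilbertBasis.

(** * Ideal powers, the Rees algebra and the Artin-Rees lemma *)

Section IdealPowers.
Variable R : comNzRingType.
Implicit Types (J P : set R).

Inductive ipow (J : set R) : nat -> R -> Prop :=
| ipow0 a : ipow J 0 a
| ipow_zero n : ipow J n 0
| ipowM n a b : J a -> ipow J n b -> ipow J n.+1 (a * b)
| ipowD n a b : ipow J n a -> ipow J n b -> ipow J n (a + b).

Lemma ipow_ideal J n : is_ideal J -> is_ideal (ipow J n).
Proof.
move=> hJ; split; [exact: ipow_zero|exact: ipowD|move=> r a].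
elim=> [{}a|k|k b c Jb hc _|k b c _ IHb _ IHc].
- exact: ipow0.
- by rewrite mulr0; apply: ipow_zero.
- by rewrite mulrA; apply: ipowM => //; apply: idealM.
- by rewrite mulrDr; apply: ipowD.
Qed.

Lemma ipow_le J n k a : is_ideal J -> (k <= n)%N -> ipow J n a -> ipow J k a.
Proof.
move=> hJ + h; elim: h k => {n a} [a|n|n a b Ja h IHb|n a b _ IHa _ IHb] k lekn.
- by move: lekn; rewrite leqn0 => /eqP->; apply: ipow0.
- exact: ipow_zero.
- case: k lekn => [|k] lekn; first exact: ipow0.
  by apply: ipowM => //; apply: IHb.
- by apply: ipowD; [apply: IHa | apply: IHb].
Qed.

Lemma ipow_mul J n k a b : is_ideal J ->
  ipow J n a -> ipow J k b -> ipow J (n + k) (a * b).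
Proof.
move=> hJ ha hb; elim: ha => {n a} [a|n|n a c Ja _ IHc|n a c _ IHa _ IHc].
- exact: (idealM a (ipow_ideal k hJ) hb).
- by rewrite mul0r; apply: ipow_zero.
- by rewrite -mulrA addSn; apply: ipowM.
- by rewrite mulrDl; apply: ipowD.
Qed.

Lemma ipow_exp J n a q : is_ideal J -> ipow J n a -> ipow J (n * q) (a ^+ q).
Proof.
move=> hJ ha; elim: q => [|q IHq]; first by rewrite muln0; apply: ipow0.
by rewrite exprS mulnS; apply: ipow_mul.
Qed.

Lemma ipow_sub J n : is_ideal J -> (0 < n)%N -> ipow J n `<=` J.
Proof.
move=> hJ n0 a h; elim: h n0 => {n a} // [n _|n a b Ja _ _ _|n a b _ IHa _ IHb n0].
- exact: ideal0.
- exact: idealMr.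
- by apply: idealD; auto.
Qed.

(* The Rees algebra R[JT] as a quotient of a polynomial ring. *)
Lemma rees_algebra (s : seq R) J : noetherian R -> is_ideal J ->
  (forall a, a \in s -> J a) ->
  exists (A : comNzRingType) (phi : {rmorphism A -> {poly R}}),
    [/\ noetherian A, forall r, exists F, phi F = r%:P,
        forall a, a \in s -> exists F, phi F = a *: 'X &
        forall F n, ipow J n (phi F)`_n].
Proof.
move=> R_noeth hJ; elim: s => [|a s IHs] sJ.
  exists R, polyC; split=> // [r|r n]; first by exists r.
  by rewrite coefC; case: n => [|n]; [apply: ipow0 | apply: ipow_zero].
have [|A [phi [A_noeth phiC phiX phiJ]]] := IHs.
  by move=> b sb; apply: sJ; rewrite inE sb orbT.
have comm : commr_rmorph phi (a *: 'X) by move=> F; apply: mulrC.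
exists {poly A}, (horner_morph comm); split.
- exact: hilbert_basis.
- by move=> r; have [F <-] := phiC r; exists F%:P; rewrite /= horner_morphC.
- move=> b; rewrite inE => /predU1P[->|/phiX[F <-]].
    by exists 'X; rewrite /= horner_morphX.
  by exists F%:P; rewrite /= horner_morphC.
have Ja : J a by apply: sJ; rewrite mem_head.
have prod (f g : {poly R}) : (forall n, ipow J n f`_n) -> (forall n, ipow J n g`_n) ->
    forall n, ipow J n (f * g)`_n.
  move=> hf hg n; rewrite coefM; apply: ideal_sum => [|i _]; first exact: ipow_ideal.
  by rewrite -[X in ipow J X](subnKC (leq_ord i)); apply: ipow_mul.
move=> F n; rewrite /= /horner_morph horner_coef coef_sum.
apply: ideal_sum => [|i _]; first exact: ipow_ideal.
apply: (prod (map_poly phi F)`_i ((a *: 'X) ^+ i)) => k; first by rewrite coef_map; case: k => [|k]; apply: phiJ.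
elim: (i : nat) k => [|l IHl] k.
  by rewrite expr0 coef1; case: k => [|k]; [apply: ipow0|apply: ipow_zero].
rewrite exprS; apply: (prod (a *: 'X) ((a *: 'X) ^+ l)) => // {}k; rewrite coefZ coefX.
case: k => [|[|k]]; rewrite /= ?mulr0; [exact: ipow0| |exact: ipow_zero].
by apply: ipowM => //; apply: ipow0.
Qed.

Definition padd J P n : set R := [set w | exists a b, [/\ P a, ipow J n b & w = a + b]].

Lemma padd_ideal J P n : is_ideal J -> is_ideal P -> is_ideal (padd J P n).
Proof.
move=> hJ hP; have hI := ipow_ideal n hJ; split.
- by exists 0, 0; rewrite addr0; split=> //; apply: ideal0.
- move=> _ _ [a [b [Pa Jb ->]]] [a' [b' [Pa' Jb' ->]]]; exists (a + a'), (b + b').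
  by split; [apply: idealD|apply: idealD|ring].
- move=> r _ [a [b [Pa Jb ->]]]; exists (r * a), (r * b).
  by split; [apply: idealM|apply: idealM|ring].
Qed.

(** The elements of the Rees algebra with all coefficients in P + (z) form a finitely generated
    ideal. Writing b T^n in its generators puts b into P + z J^(n - c), and z is cancelled modulo
    the prime P. *)
Lemma artin_rees J P z : noetherian R -> is_ideal J -> is_prime P -> ~ P z ->
  exists c, forall n w, padd J P n (z * w) -> padd J P (n - c) w.
Proof.
move=> R_noeth hJ hPp NPz; have [hP _ PM] := hPp.
have [s EJ] := R_noeth _ hJ.
have [|A [phi [A_noeth phiC phiX phiJ]]] := @rees_algebra s J R_noeth hJ.
  by move=> a sa; rewrite EJ; apply: ideal_gen_mem.
have phiI n b : ipow J n b -> exists F, phi F = b *: 'X^n.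
  elim=> {n b} [b|n|n a b Ja _ [G EG]|n a b _ [G EG] _ [H EH]].
  - by have [F EF] := phiC b; exists F; rewrite EF expr0 alg_polyC.
  - by exists 0; rewrite rmorph0 scale0r.
  - suff [F EF] : exists F, phi F = a *: 'X.
      by exists (F * G); rewrite rmorphM EF EG -scalerAl -scalerAr scalerA exprS.
    have hI : is_ideal [set a | exists F, phi F = a *: 'X].
      split=> /= [|b1 b2 [F1 E1] [F2 E2]|r b1 [F1 E1]].
      - by exists 0; rewrite rmorph0 scale0r.
      - by exists (F1 + F2); rewrite rmorphD E1 E2 scalerDl.
      - have [F EF] := phiC r; exists (F * F1).
        by rewrite rmorphM EF E1 mul_polyC scalerA.
    by move: a Ja; rewrite EJ; apply: ideal_gen_min.
  - by exists (G + H); rewrite rmorphD EG EH scalerDl.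
have hPz := ideal_adjP z hP.
pose NN : set A := [set F | forall l, ideal_adj P z (phi F)`_l].
have hN : is_ideal NN.
  split=> [l|F G hF hG l|F G hG l].
  - by rewrite rmorph0 coef0; apply: ideal0.
  - by rewrite rmorphD coefD; apply: idealD.
  - rewrite rmorphM coefM; apply: ideal_sum => // i _; exact: idealM.
have [fs Efs] := A_noeth _ hN.
(* c exceeds the degrees of all generators, so in degree n only coefficients of index above n - c of
   the multipliers contribute, and these lie in the power n - c of J. *)
have [c hc] : exists c, forall f, f \in fs -> (size (phi f) <= c)%N.
  exists (\max_(f <- fs) size (phi f))%N => f sf.
  by rewrite (big_rem f) //= leq_maxl.
exists c => n w [a [b [Pa Jb E]]].
pose T : set R := [set t | exists a b, [/\ P a, ipow J (n - c) b & t = a + z * b]].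
have hI := ipow_ideal (n - c) hJ.
have hT : is_ideal T.
  split; first by exists 0, 0; rewrite mulr0 addr0; split=> //; apply: ideal0.
    move=> _ _ [a1 [b1 [Pa1 Jb1 ->]]] [a2 [b2 [Pa2 Jb2 ->]]]; exists (a1 + a2), (b1 + b2).
    by split; [apply: idealD|apply: idealD|ring].
  move=> r _ [a1 [b1 [Pa1 Jb1 ->]]]; exists (r * a1), (r * b1).
  by split; [apply: idealM|apply: idealM|ring].
have [a' [b' [Pa' Jb' Eb]]] : T b.
  have [F EF] := phiI _ _ Jb.
  have /[!Efs] -[g Eg] : NN F.
    move=> l; rewrite EF coefZ coefXn; have [_|_] := eqVneq l n; last first.
      by rewrite mulr0; apply: ideal0.
    rewrite mulr1 (_ : b = - a + w * z); last by rewrite mulrC E addKr.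
    by exists (- a), w; split=> //; apply: idealN.
  have -> : b = (phi F)`_n by rewrite EF coefZ coefXn eqxx mulr1.
  rewrite Eg rmorph_sum coef_sum; apply: ideal_sum => // i _.
  rewrite rmorphM coefM; apply: ideal_sum => // j _.
  have sf := mem_nth 0 (ltn_ord i); have [lec|ltc] := leqP c (n - j).
    by rewrite (nth_default 0 (leq_trans (hc _ sf) lec)) mulr0; apply: (ideal0 hT).
  have NNi : NN fs`_i by rewrite Efs; apply: ideal_gen_mem.
  have [u [r [Pu Er]]] := NNi (n - j)%N.
  rewrite Er; exists ((phi (g i))`_j * u), ((phi (g i))`_j * r); split.
  - exact: idealM.
  - by apply: idealMr => //; apply: ipow_le (phiJ _ _) => //; lia.
  - by ring.
exists (w - b'), b'; split=> //; last by rewrite subrK.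
suff /PM[|//] : P (z * (w - b')) by [].
by rewrite mulrBr E Eb (_ : _ - _ = a + a'); [apply: idealD|ring].
Qed.

End IdealPowers.

(** * Lower bounds for lengths from a chain of primes *)

Section PrimeChainGrowth.
Variables (R : comNzRingType) (p : nat) (chRp : p \in [pchar R]).
Implicit Types (J P : set R).

Lemma frobD e (a b : R) : (a + b) ^+ (p ^ e) = a ^+ (p ^ e) + b ^+ (p ^ e).
Proof.
by apply: exprDn_pchar; rewrite pnatX (pnatE _ (pcharf_prime chRp)) chRp.
Qed.

Lemma expp_gt0 e : (0 < p ^ e)%N.
Proof. by rewrite expn_gt0 prime_gt0 // (pcharf_prime chRp). Qed.

(* For P = 0 this is the contraction of the n-th power of J extended to the
   perfect closure. *)
Definition cpow J P n : set R :=
  [set w | exists e, padd J P (n * p ^ e) (w ^+ (p ^ e))].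

Lemma padd_frob J P n e a : is_ideal J -> is_ideal P ->
  padd J P n a -> padd J P (n * p ^ e) (a ^+ (p ^ e)).
Proof.
move=> hJ hP [b [c [Pb Jc ->]]]; rewrite frobD; exists (b ^+ (p ^ e)), (c ^+ (p ^ e)).
split=> //; last exact: ipow_exp.
by rewrite -(prednK (expp_gt0 e)) exprS; apply: idealMr.
Qed.

Lemma cpow_ideal J P n : is_ideal J -> is_ideal P -> is_ideal (cpow J P n).
Proof.
move=> hJ hP; split.
- exists 0%N; rewrite expr1; apply: (ideal0 (padd_ideal _ hJ hP)).
- move=> a b [e he] [k hk]; exists (e + k)%N.
  have hI := padd_ideal (n * p ^ (e + k)) hJ hP; rewrite frobD.
  apply: idealD => //; first by rewrite expnD mulnA exprM; apply: padd_frob.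
  by rewrite addnC expnD mulnA exprM; apply: padd_frob.
- move=> r a [e he]; exists e; rewrite exprMn; apply: idealM => //; exact: padd_ideal.
Qed.

Lemma paddS J P P' n k : is_ideal J -> P `<=` P' -> (k <= n)%N ->
  padd J P n `<=` padd J P' k.
Proof.
move=> hJ PP' lekn _ [a [b [Pa Jb ->]]]; exists a, b; split=> //; first exact: PP'.
exact: ipow_le Jb.
Qed.

Lemma cpowS J P P' n k : is_ideal J -> P `<=` P' -> (k <= n)%N ->
  cpow J P n `<=` cpow J P' k.
Proof.
move=> hJ PP' lekn w [e he]; exists e; move: he; apply: paddS => //.
by rewrite leq_mul2r lekn orbT.
Qed.

Lemma cpow_base J P n : is_ideal J -> P `<=` cpow J P n.
Proof.
move=> hJ a Pa; exists 0%N; rewrite expr1; exists a, 0; rewrite addr0.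
by split=> //; apply: ipow_zero.
Qed.

(** The Artin-Rees loss is linear in the exponent of z: after a [p ^ e]-th power it is c i [p ^ e],
    which is the loss c i rescaled. *)
Lemma cpow_colon J P z c n i w : is_ideal J -> is_ideal P ->
  (forall n w, padd J P n (z * w) -> padd J P (n - c) w) ->
  cpow J P n (z ^+ i * w) -> cpow J P (n - c * i) w.
Proof.
move=> hJ hP hc [e he]; exists e; move: he; rewrite exprMn -exprM mulnBl -mulnA.
move: (i * p ^ e)%N (n * p ^ e)%N (w ^+ _) => {i w} i {}n w.
elim: i n w => [|i IHi] n w; first by rewrite muln0 subn0 mul1r.
by rewrite exprS -mulrA => /hc/IHi; rewrite mulnS subnDA.
Qed.

(** With z in P 1 but not in P 0, filter R / C by the ideals C + (z^l), l <= n. The colon ideal of C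
    + (z^(l+1)) at z^l lies in the contracted power for P 1, so each of the n layers has length at
    least n^d by induction. *)
Theorem prime_chain_growth m d (P : nat -> set R) :
  noetherian R -> is_ideal m -> ~ m 1 ->
  (forall i, (i <= d)%N -> is_prime (P i)) ->
  (forall i, (i <= d)%N -> P i `<=` m) ->
  (forall i, (i < d)%N -> P i `<` P i.+1) ->
  exists2 K, (0 < K)%N & forall n, (0 < n)%N ->
    exists2 N, (n ^ d <= N)%N & chain (cpow m (P 0%N) (K * n) : set R^o) N setT.
Proof.
move=> R_noeth hm m1; elim: d P => [|d IHd] P primeP Pm ltP.
  exists 1%N => // n n0; exists 1%N => //; exists (cpow m (P 0%N) (1 * n)).
  have [hP _ _] := primeP 0%N isT.
  split=> //; first exact/ideal_submod/cpow_ideal.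
  exists 1 => // -[e]; rewrite expr1n => -[a [b [Pa hb E]]]; apply: m1; rewrite E.
  apply: idealD => //; first exact: (Pm 0%N).
  by apply: ipow_sub hb => //; rewrite mul1n muln_gt0 n0 expp_gt0.
have [K K0 hK] := IHd (fun i => P i.+1) (fun i => primeP i.+1) (fun i => Pm i.+1)
  (fun i => ltP i.+1).
have [hP0 _ _] := primeP 0%N isT; have [hP1 _ _] := primeP 1%N isT.
have [P01 /existsNP[z /not_implyP[P1z NP0z]]] := ltP 0%N isT.
have [c hc] := artin_rees R_noeth hm (primeP 0%N isT) NP0z.
(* Cancelling z^l with l < n costs at most c n in the exponent, which leaves K n. *)
exists (K + c)%N; first by rewrite addn_gt0 K0.
move=> n n0; have [N1 leN1 hN1] := hK n n0.
set C := cpow m (P 0%N) _; have hC : is_ideal C by apply: cpow_ideal.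
suff H l : (l <= n)%N -> exists2 N, (l * n ^ d <= N)%N &
    chain (ideal_adj C (z ^+ l) : set R^o) N setT.
  have [N leN hN] := H n (leqnn n); exists N; first by rewrite expnS.
  by apply: chain_monol hN; apply: ideal_adjS.
elim: l => [|l IHl] ltln.
  exists 0%N => // a _; exists 0, a; rewrite mulr1 add0r; split=> //; exact: ideal0.
have [N leN hN] := IHl (ltnW ltln); exists (N1 + N)%N.
  by rewrite mulSn leq_add.
apply: chain_cat hN; first exact/ideal_submod/ideal_adjP.
move: hN1; apply: (chain_lin (f := fun a : R^o => z ^+ l * a : R^o)).
- by apply: ideal_submod.
- exact/ideal_submod/ideal_adjP.
- exact/ideal_submod/ideal_adjP.
- apply: ideal_adj_min; [exact: ideal_adjP|exact: ideal_adjS|].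
  by rewrite exprS; apply: idealM; [exact: ideal_adjP|exact: ideal_adj_gen].
- by move=> r a b; rewrite mulrDr scalerAr.
- by move=> a _; apply: idealMr; [exact: ideal_adjP|exact: ideal_adj_gen].
- move=> a _ [i [r [Ci E]]].
  have hC1 := cpow_ideal (K * n) hm hP1.
  rewrite -(subrK (r * z) a); apply: idealD => //; last first.
    by apply: cpow_base => //; apply: idealM.
  have : C (z ^+ l * (a - r * z)) by rewrite mulrBr E (_ : _ - _ = i) // exprS; ring.
  move=> /(cpow_colon hm hP0 hc); apply: cpowS => //.
  rewrite mulnDl; have : (c * l <= c * n)%N by rewrite leq_mul2l (ltnW ltln) orbT.
  lia.
Qed.

End PrimeChainGrowth.

(** * Finite generation over coherent rings *)

Section FinitelyGenerated.
Variable S : comNzRingType.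

Section Span.
Variable V : lmodType S.
Implicit Types K : set V.

Definition span k (f : 'I_k -> V) : set V :=
  [set v | exists w : 'I_k -> S, v = \sum_j w j *: f j].

Definition fg K : Prop := exists k (f : 'I_k -> V), K = span f.

Lemma span_submod k (f : 'I_k -> V) : submod (span f).
Proof.
split; first by exists (fun=> 0); rewrite big1 // => j _; rewrite scale0r.
move=> a _ _ [u ->] [v ->]; exists (fun j => a * u j + v j).
rewrite scaler_sumr -big_split; apply: eq_bigr => j _.
by rewrite scalerDl scalerA.
Qed.

Lemma span_mem k (f : 'I_k -> V) j : span f (f j).
Proof.
exists (fun i => (i == j)%:R); rewrite (bigD1 j) //= eqxx scale1r big1 ?addr0 //.
by move=> i /negPf->; rewrite scale0r.
Qed.

Lemma span_min k (f : 'I_k -> V) K :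
  submod K -> (forall j, K (f j)) -> span f `<=` K.
Proof. by move=> hK fK _ [w ->]; apply: submod_sum => // j _; apply: submodZ. Qed.

Lemma fg_add K1 K2 : fg K1 -> fg K2 -> fg (add_set K1 K2).
Proof.
move=> [k1 [f1 ->]] [k2 [f2 ->]]; exists (k1 + k2)%N.
exists (fun j => match fintype.split j with inl i => f1 i | inr i => f2 i end).
apply/seteqP; split=> [_ [_ [_ [[w1 ->] [w2 ->] ->]]]|_ [w ->]].
  exists (fun j => match fintype.split j with inl i => w1 i | inr i => w2 i end).
  rewrite big_split_ord; congr (_ + _); apply: eq_bigr => i _.
    by rewrite (unsplitK (inl i)).
  by rewrite (unsplitK (inr i)).
exists (\sum_i w (lshift k2 i) *: f1 i), (\sum_i w (rshift k1 i) *: f2 i); split.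
- by exists (fun i => w (lshift k2 i)).
- by exists (fun i => w (rshift k1 i)).
rewrite big_split_ord; congr (_ + _); apply: eq_bigr => i _.
  by rewrite (unsplitK (inl i)).
by rewrite (unsplitK (inr i)).
Qed.

Lemma fg0 : fg [set 0].
Proof.
exists 0%N, (fun=> 0); apply/seteqP; split=> [_ ->|_ [w ->]]; last by rewrite big_ord0.
by exists (fun=> 0); rewrite big_ord0.
Qed.

End Span.

Lemma fg_image (V W : lmodType S) (K : set V) (f : V -> W) :
  linear f -> fg K -> fg (f @` K).
Proof.
move=> lin [k [g ->]]; exists k, (f \o g).
have f0 : f 0 = 0 by rewrite -[0 in LHS](subrr (0 : V)) -scaleN1r addrC lin scaleN1r addNr.
have E w : f (\sum_j w j *: g j) = \sum_j w j *: (f \o g) j.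
  have fD u v : f (u + v) = f u + f v by rewrite -[u]scale1r lin !scale1r.
  rewrite (big_morph f fD f0); apply: eq_bigr => j _.
  by rewrite -[_ *: _]addr0 lin f0 addr0.
by apply/seteqP; split=> [_ [_ [w ->] <-]|_ [w ->]]; [exists w|exists (\sum_j w j *: g j) => //; exists w].
Qed.

(** Coherence in the form in which it is used. It is shared by the coherent ring S and the
    Noetherian ring R, so that finite generation of cocycles is proved once. *)
Definition syz_fg : Prop := forall n (a : 'I_n -> S),
  fg [set u : 'I_n -> S^o | \sum_i u i * a i = 0].

(** The syzygies of the values of f on generators of K give generators of the kernel. *)
Lemma fg_ker (V : lmodType S) (K : set V) (f : V -> S^o) :
  syz_fg -> linear f -> fg K -> fg (K `&` [set v | f v = 0]).
Proof.
move=> syz lin [n [g ->]].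
have f0 : f 0 = 0 by rewrite -[0 in LHS](subrr (0 : V)) -scaleN1r addrC lin scaleN1r addNr.
have E w : f (\sum_j w j *: g j) = \sum_j w j * f (g j).
  have fD u v : f (u + v) = f u + f v by rewrite -[u]scale1r lin !scale1r.
  rewrite (big_morph f fD f0); apply: eq_bigr => j _.
  by rewrite -[_ *: _]addr0 lin f0 addr0.
have [k [G EG]] := syz n (fun i => f (g i)).
exists k, (fun j => \sum_i G j i *: g i).
have EGw (w : 'I_k -> S) :
    \sum_j w j *: (\sum_i G j i *: g i) = \sum_i (\sum_j w j *: G j) i *: g i.
  transitivity (\sum_j \sum_i (w j * G j i) *: g i).
    by apply: eq_bigr => j _; rewrite scaler_sumr; apply: eq_bigr => i _; rewrite scalerA.
  rewrite exchange_big; apply: eq_bigr => i _; rewrite fct_sumE scaler_suml.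
  exact: eq_bigr.
apply/seteqP; split.
  move=> _ [[u ->] /=]; rewrite E => Eu.
  have /[!EG] -[w Ew] : [set u : 'I_n -> S^o | \sum_i u i * f (g i) = 0] u by [].
  by exists w; rewrite EGw Ew.
move=> _ [w ->]; rewrite EGw; split=> /=; first by exists (\sum_j w j *: G j).
rewrite E.
suff : [set u : 'I_n -> S^o | \sum_i u i * f (g i) = 0] (\sum_j w j *: G j) by [].
by rewrite EG; exists w.
Qed.

Lemma fg_kers (V : lmodType S) (K : set V) (T : Type) (r : seq T) (f : T -> V -> S^o) :
  syz_fg -> (forall t, linear (f t)) -> fg K ->
  exists2 K', fg K' & K' `<=` K /\
    (forall v, K' v -> foldr (fun t P => f t v = 0 /\ P) True r) /\
    (forall v, K v -> foldr (fun t P => f t v = 0 /\ P) True r -> K' v).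
Proof.
move=> syz lin Kfg; elim: r => [|t r [K' K'fg [K'K [h1 h2]]]] /=.
  by exists K => //; split=> [v|] //; split=> v.
exists (K' `&` [set v | f t v = 0]); first exact: fg_ker.
split; first by move=> v [/K'K].
by split=> [v [K'v ftv]|v Kv [ftv hr]]; split=> //; [apply: h1 | apply: h2].
Qed.

(** The presentation provided by coherence uses its own generators x. With a = B x and x = C a, the
    syzygies of a are spanned by the rows of 1 - B C and of A C: if u a = 0, then u B = w A for some
    w, and u = u (1 - B C) + w A C. *)
Lemma coherent_syz : coherent S -> syz_fg.
Proof.
move=> coh n a; pose s := [seq a i | i <- enum 'I_n].
have [l [x [k [A [Es syz]]]]] := coh s.
have sz : size s = n by rewrite size_map size_enum_ord.
have Is i : ideal_gen s (a i) by apply/ideal_gen_mem/map_f; rewrite mem_enum.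
have /choice[B hB] i : exists v : 'rV[S]_l, a i = (v *m x) 0 0.
  by have := Is i; rewrite Es.
have /choice[C hC] j : exists c : 'I_n -> S, x j 0 = \sum_i c i * a i.
  have [c Ec] : ideal_gen s (x j 0).
    by rewrite Es; exists (delta_mx 0 j); rewrite -rowE mxE.
  exists (fun i => c (cast_ord (esym sz) i)); rewrite Ec.
  rewrite (reindex (cast_ord (esym sz))) /=; last first.
    by exists (cast_ord sz) => i _; rewrite ?cast_ordK ?cast_ordKV.
  by apply: eq_bigr => i _; rewrite (nth_map i) ?size_enum_ord // nth_ord_enum.
pose aM : 'cV[S]_n := \col_i a i.
pose BM : 'M[S]_(n, l) := \matrix_(i, j) B i 0 j.
pose CM : 'M[S]_(l, n) := \matrix_(j, i) C j i.
have EB : BM *m x = aM.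
  apply/colP => i; rewrite !mxE hB mxE; apply: eq_bigr => j _; by rewrite mxE.
have EC : CM *m aM = x.
  apply/colP => j; rewrite mxE [RHS]hC; apply: eq_bigr => i _; by rewrite !mxE.
have EA : A *m x = 0.
  apply/row_matrixP => i; rewrite row_mul row0; apply/syz.
  by exists (delta_mx 0 i); rewrite rowE.
pose G : 'M[S]_(n + k, n) := col_mx (1%:M - BM *m CM) (A *m CM).
have Ga : G *m aM = 0.
  by rewrite mul_col_mx mulmxBl mul1mx -!mulmxA EC EB EA subrr col_mx0.
exists (n + k)%N, (fun j i => G j i); apply/seteqP; split=> u.
  move=> /= Eu; pose uM : 'rV[S]_n := \row_i u i.
  have : (uM *m BM) *m x = 0.
    rewrite -mulmxA EB; apply/matrixP => i j; rewrite !ord1 !mxE -[RHS]Eu.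
    by apply: eq_bigr => h _; rewrite !mxE.
  move=> /syz[w Ew]; exists (fun j => row_mx uM w 0 j).
  apply: functional_extensionality_dep => i; rewrite fct_sumE.
  have : uM = row_mx uM w *m G.
    by rewrite mul_row_col mulmxBr mulmx1 !mulmxA Ew subrK.
  by move=> /rowP/(_ i); rewrite !mxE.
move=> [w ->] /=.
have : (\row_j w j *m (G *m aM)) 0 0 = 0 by rewrite Ga mulmx0 mxE.
rewrite mulmxA mxE => E; rewrite -[RHS]E; apply: eq_bigr => i _.
rewrite mxE fct_sumE mxE; congr (_ * _); apply: eq_bigr => j _; by rewrite mxE.
Qed.

Lemma noetherian_fg n (K : set ('I_n -> S^o)) : noetherian S -> submod K -> fg K.
Proof.
move=> S_noeth; elim: n K => [|n IHn] K hK.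
  rewrite (_ : K = [set 0]); first exact: fg0.
  apply/seteqP; split=> [u _|_ ->]; last by case: hK.
  by apply: functional_extensionality_dep => -[].
pose I : set S := [set a | exists2 u, K u & u ord0 = a].
have hI : is_ideal I.
  apply: submod_ideal; split; first by exists 0 => //; case: hK.
  by move=> a _ _ [u Ku <-] [v Kv <-]; exists (a *: u + v) => //; apply: hK.2.
have [s Es] := S_noeth _ hI.
have /choice[f fP] (i : 'I_(size s)) : exists u, K u /\ u ord0 = s`_i.
  have : I s`_i by rewrite Es; apply/ideal_gen_mem/mem_nth.
  by case=> u; exists u.
pose up (v : 'I_n -> S^o) : 'I_n.+1 -> S^o :=
  fun i => if unlift ord0 i is Some j then v j else 0.
have up_lin : linear up.
  move=> a u v; apply: functional_extensionality_dep => i.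
  rewrite [RHS]/(a * up u i + up v i) /up.
  by case: unliftP => [j|] _ //; rewrite mulr0; apply: esym (addr0 (0 : S)).
have up0 v : up v ord0 = 0 by rewrite /up unlift_none.
have upK u : u ord0 = 0 -> up (fun j => u (lift ord0 j)) = u.
  move=> u0; apply: functional_extensionality_dep => i; rewrite /up.
  by case: unliftP => [j ->|->].
have hK' : submod (up @^-1` K).
  split; first by rewrite /= (_ : up 0 = 0) ?(upK 0) //; case: hK.
  by move=> a u v /= Ku Kv; rewrite up_lin; apply: hK.2.
rewrite (_ : K = add_set (span f) (up @` (up @^-1` K))); last first.
  apply/seteqP; split=> [u Ku|_ [_ [_ [[w ->] [v Kv <-] ->]]]]; last first.
    apply: submodD => //; apply: submod_sum => // j _; apply: submodZ => //.
    by case: (fP j).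
  have [w Ew] : ideal_gen s (u ord0) by rewrite -Es; exists u.
  pose v := \sum_i w i *: f i.
  have Kv : K v by apply: submod_sum => // j _; apply: submodZ => //; case: (fP j).
  have v0 : v ord0 = u ord0.
    rewrite /v fct_sumE Ew; apply: eq_bigr => i _.
    by rewrite [LHS]/(w i * f i ord0) (fP i).2.
  have uv0 : (u - v) ord0 = 0.
    by rewrite [LHS]/(u ord0 - v ord0) v0; apply: subrr.
  exists v, (u - v); split; [by exists w| |by rewrite addrC subrK].
  exists (fun j => (u - v) (lift ord0 j)) => /=; last first.
    exact: upK.
  by rewrite upK //; apply: submodB.
apply: fg_add; first by exists (size s), f.
by apply: fg_image up_lin _; apply: IHn.
Qed.

Lemma noetherian_syz : noetherian S -> syz_fg.
Proof.
move=> S_noeth n a; apply: noetherian_fg => //; split=> /= [|r u v Eu Ev].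
  by rewrite big1 // => i _; rewrite mul0r.
transitivity (r * (\sum_i u i * a i) + \sum_i v i * a i); last first.
  by rewrite Eu Ev mulr0 addr0.
rewrite mulr_sumr -big_split; apply: eq_bigr => i _ /=.
by rewrite [X in X * _]/(r * u i + v i) mulrDl mulrA.
Qed.

Implicit Types (s : seq S) (c : bitseq -> S^o).

Definition delta (w : bitseq) : bitseq -> S^o := fun v => (v == w)%:R.

(** The functions on all words are not finitely generated; finite generation is obtained for
    cochains supported on the words of length d. *)
Definition supported (W : seq bitseq) : set (bitseq -> S^o) :=
  [set c | forall w, w \notin W -> c w = 0].

Lemma supported_fg W : fg (supported W).
Proof.
elim: W => [|w W IHW].
  rewrite (_ : supported _ = [set 0]); first exact: fg0.
  apply/seteqP; split=> [c h|_ -> //].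
  by apply: functional_extensionality_dep => w; apply: h.
rewrite (_ : supported _ = add_set (span (fun _ : 'I_1 => delta w)) (supported W)).
  by apply: fg_add => //; exists 1%N, (fun=> delta w).
apply/seteqP; split=> [c h|_ [_ [c [[u ->] h ->]]] v].
  exists ((c w) *: delta w), (c - (c w) *: delta w); split.
  - by exists (fun=> c w); rewrite big_ord1.
  - move=> v vW; rewrite [LHS]/((c v : S) - (c w : S) * (v == w)%:R).
    have [->|vw] := eqVneq v w; first by rewrite mulr1; apply: subrr.
    rewrite mulr0; apply: etrans (subr0 (c v)) _; apply: h.
    by rewrite inE negb_or vw.
  - by rewrite addrC subrK.
rewrite inE negb_or big_ord1 => /andP[vw vW].
by rewrite [LHS]/(u ord0 * (v == w)%:R + c v) (negPf vw) mulr0; apply: etrans (add0r (c v)) _; apply: h.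
Qed.

Definition words d : seq bitseq := [seq tval t | t <- enum {: d.-tuple bool}].

Lemma mem_words d w : (w \in words d) = (size w == d).
Proof.
apply/mapP/idP => [[t _ ->]|/eqP sw]; first by rewrite size_tuple.
by exists (Tuple (introT eqP sw)); rewrite ?mem_enum.
Qed.

Definition restrict d c : bitseq -> S^o := fun w => if size w == d then c w else 0.

Lemma restrict_supported d c : supported (words d) (restrict d c).
Proof. by move=> w; rewrite mem_words /restrict => /negPf->. Qed.

Lemma restrict_wt d k c w : wt d k w -> restrict d c w = c w.
Proof. by rewrite /wt /restrict => /andP[->]. Qed.

Lemma kd_eq s k (c c' : bitseq -> S) :
  (forall w, wt (size s) k w -> c w = c' w) ->
  forall w, wt (size s) k.+1 w -> kd s c w = kd s c' w.
Proof.
move=> cc' w hw; apply/eqP; rewrite -subr_eq0 -kdB; apply/eqP.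
by apply: (kd_ideal (@ideal_zero S) _ hw) => v /cc' /= ->; rewrite subrr.
Qed.

(** The cocycles are cut out of a finitely generated module by one linear form for each word of
    weight k + 1. The generators are indexed by all of nat, with default 0, so that initial segments
    can be taken freely. *)
Lemma cocyc_fg s k : syz_fg ->
  exists r (z : nat -> bitseq -> S^o), (forall j, cocyc s [set 0] k (z j)) /\
    forall c, cocyc s [set 0] k c -> exists t : nat -> S,
      forall w, wt (size s) k w -> c w = \sum_(j < r) t j * z j w.
Proof.
move=> syz; pose d := size s.
pose W := [seq w <- words d | count id w == k.+1].
have lin w : linear (fun c : bitseq -> S^o => kd s c w : S^o).
  by move=> a u v; rewrite [LHS]kd_lin.
have [K [r [f EK]] [_ [h1 h2]]] := fg_kers W syz lin (supported_fg (words d)).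
have fold c : foldr (fun w P => kd s c w = 0 /\ P) True W <-> cocyc s [set 0] k c.
  have -> : cocyc s [set 0] k c <-> forall w, w \in W -> kd s c w = 0.
    split=> h w hw; apply: h; move: hw; by rewrite mem_filter mem_words andbC.
  elim: (W) => [|w W' IHW] /=; first by split.
  rewrite IHW; split=> [[h h'] v|h]; first by rewrite inE => /predU1P[->|/h'].
  by split=> [|v vW]; apply: h; rewrite inE ?eqxx ?vW ?orbT.
pose z j := if insub j is Some i then f i else 0.
exists r, z; split=> [j|c hc].
  rewrite /z; case: insubP => [i _ _|_]; last by case: (cocycP s k (@ideal_zero S)).
  by apply/fold/h1; rewrite EK; apply: span_mem.
have : K (restrict d c).
  apply: h2; first exact: restrict_supported.
  apply/fold => w hw; rewrite (kd_eq (k := k) (c' := c)) //; first exact: hc.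
  by move=> v; apply: restrict_wt.
rewrite EK => -[t Et]; exists (fun j => if insub j is Some i then t i else 0) => w hw.
rewrite -(restrict_wt c hw) -/d Et fct_sumE; apply: eq_bigr => j _.
by rewrite /z valK.
Qed.

End FinitelyGenerated.

(** * Removing generators of the cohomology one at a time *)

Section Generators.
Variables (S : comNzRingType) (s : seq S) (k : nat) (z : nat -> bitseq -> S^o).

(** The annihilator of the class of [z l] modulo the classes of the [z i] with i < l, so that S /
    [annih l] is a cyclic subquotient of the cohomology. *)
Definition annih l : set S := [set a | exists t : nat -> S,
  cobd s [set 0] k (fun w => a * z l w - \sum_(i < l) t i * z i w)].

Lemma annih_ideal l : is_ideal (annih l).
Proof.
apply: submod_ideal; have [_ hl] := cobdP s k (@ideal_zero S); split.
  exists (fun=> 0), 0 => w _; rewrite [kd s _ w]kd0 subr0 mul0r big1 ?subr0 // => i _.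
  by rewrite mul0r.
move=> a b1 b2 [t1 h1] [t2 h2]; exists (fun i => a * t1 i + t2 i).
have := hl a _ _ h1 h2; congr (cobd _ _ _ _).
apply: functional_extensionality_dep => w; rewrite scaled_addE.
have -> : \sum_(i < l) (a * t1 i + t2 i) * z i w =
   a * (\sum_(i < l) t1 i * z i w) + \sum_(i < l) t2 i * z i w.
  by rewrite mulr_sumr -big_split; apply: eq_bigr => i _; rewrite mulrDl mulrA.
by rewrite -[a *: b1 + b2]/(a * b1 + b2); ring.
Qed.

Definition generated_below l := forall c, cocyc s [set 0] k c ->
  exists t : nat -> S, cobd s [set 0] k (fun w => c w - \sum_(i < l) t i * z i w).

(** As long as the last generator is redundant it is discarded. That the first l + 1 classes
    generate may be assumed when treating [z l], which is what Nakayama's argument requires. *)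
Lemma eliminate_generators r : generated_below r ->
  (forall l, generated_below l.+1 -> annih l 1) ->
  cocyc s [set 0] k `<=` cobd s [set 0] k.
Proof.
move=> gen_r ann; have [_ hl] := cobdP s k (@ideal_zero S).
suff H l : generated_below (r - l).
  move=> c; have := H r c; rewrite subnn => h /h[t]; congr (cobd _ _ _ _).
  by apply: functional_extensionality_dep => w; rewrite big_ord0 subr0.
elim: l => [|l IHl]; first by rewrite subn0.
have [/eqP|] := posnP (r - l); first by rewrite subn_eq0 => le_rl;
  move: IHl; have -> : (r - l = r - l.+1)%N by lia.
move: IHl; rewrite subnS; case: (r - l)%N => // {}l IHl _ c hc.
have [t Jt] := ann l IHl; have [u hu] := IHl c hc.
exists (fun i => u i + u l * t i); have := hl (u l) _ _ Jt hu; congr (cobd _ _ _ _).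
apply: functional_extensionality_dep => w.
rewrite scaled_addE big_ord_recr /= mul1r.
have -> : \sum_(i < l) (u i + u l * t i) * z i w =
   \sum_(i < l) u i * z i w + u l * \sum_(i < l) t i * z i w.
  by rewrite mulr_sumr -big_split; apply: eq_bigr => i _; rewrite mulrDl mulrA.
by ring.
Qed.

End Generators.

(** * Vanishing over the perfect closure *)

Section KoszulFrobenius.
Variables (R : comNzRingType) (p : nat) (chRp : p \in [pchar R]).

Lemma frobB e (a b : R) : (a - b) ^+ (p ^ e) = a ^+ (p ^ e) - b ^+ (p ^ e).
Proof. by apply/eqP; rewrite -subr_eq opprK -(frobD chRp) subrK. Qed.

Lemma kd_frob (s : seq R) (c : bitseq -> R) e w :
  kd [seq x ^+ (p ^ e) | x <- s] (fun v => c v ^+ (p ^ e)) w = kd s c w ^+ (p ^ e).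
Proof.
have e0 : (0 : R) ^+ (p ^ e) = 0 by rewrite expr0n gtn_eqF ?(expp_gt0 chRp).
elim: s c w => [|x s IHs] c [|[] w] //=.
by rewrite frobB exprMn -(IHs (fun v => c (true :: v))).
Qed.

Lemma frob_sum e (T : Type) (r : seq T) (F : T -> R) :
  (\sum_(i <- r) F i) ^+ (p ^ e) = \sum_(i <- r) F i ^+ (p ^ e).
Proof.
apply: (big_morph (fun x => x ^+ (p ^ e)) (frobD chRp e)).
by rewrite expr0n gtn_eqF ?(expp_gt0 chRp).
Qed.

End KoszulFrobenius.

Lemma kd_map (R S : comNzRingType) (phi : {rmorphism R -> S}) (s : seq R)
    (c : bitseq -> R) w :
  kd [seq phi x | x <- s] (fun v => phi (c v)) w = phi (kd s c w).
Proof.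
elim: s c w => [|x s IHs] c [|[] w] //=; rewrite ?rmorph0 //.
by rewrite rmorphB rmorphM -(IHs (fun v => c (true :: v))).
Qed.

Section Vanishing.
Variables (R : comNzRingType) (p : nat) (chRp : p \in [pchar R]) (m : set R).
Hypotheses (R_noeth : noetherian R) (R_local : local_ring m).
Variables (S : comNzRingType) (chSp : p \in [pchar S]) (phi : {rmorphism R -> S}).
Hypotheses (phi_inj : injective phi)
  (phi_root : forall y, exists n a, y ^+ (p ^ n) = phi a)
  (S_perfect : bijective (fun y : S => y ^+ p)) (S_syz : syz_fg S).

Let frob_inj e : injective (fun y : S => y ^+ (p ^ e)).
Proof.
elim: e => [|e IHe] y z /=; first by rewrite !expr1.
by rewrite expnS !exprM => /IHe/(bij_inj S_perfect).
Qed.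

Let frob_surj e y : exists z : S, z ^+ (p ^ e) = y.
Proof.
elim: e y => [|e IHe] y; first by exists y; rewrite expr1.
have [g _ gK] := S_perfect; have [z Ez] := IHe (g y).
by exists z; rewrite expnSr exprM Ez gK.
Qed.

Lemma uniform_root (ys : seq S) :
  exists e0, forall y, y \in ys -> exists a, y ^+ (p ^ e0) = phi a.
Proof.
elim: ys => [|y ys [e0 he0]]; first by exists 0%N.
have [n [a Ea]] := phi_root y; exists (e0 + n)%N => z; rewrite inE => /predU1P[->|/he0[b Eb]].
  by exists (a ^+ (p ^ e0)); rewrite addnC expnD exprM Ea rmorphXn.
by exists (b ^+ (p ^ n)); rewrite expnD exprM Eb rmorphXn.
Qed.

Variables (d : nat) (P : nat -> set R).
Hypotheses (P_prime : forall i, (i <= d)%N -> is_prime (P i))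
  (P_lt : forall i, (i < d)%N -> P i `<` P i.+1).
Variables (x : seq R) (k : nat).
Hypotheses (x_prim : forall Q, is_prime Q -> (forall a, a \in x -> Q a) -> m `<=` Q)
  (lt_kd : (k < d)%N).

Let s := [seq phi a | a <- x].

Let size_s : size s = size x. Proof. by rewrite size_map. Qed.

(* The multiples of the q-th Frobenius power of z r, modulo those of the z j
   with j < r, form a subquotient of the cohomology of the q-th powers of x
   over R, of length at most C q ^ k, which surjects onto R / (J^[q] S \cap R)
   where J is the annihilator of z r.  If J is proper and finitely generated,
   the length of the latter grows at least as fast as q ^ d. *)
Let annihilator_contra r (z : nat -> bitseq -> S^o) (l : nat) (j : 'I_l -> S) :
  (forall i, cocyc s [set 0] k (z i)) ->
  (forall a : S, (exists t : nat -> S, cobd s [set 0] k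
      (fun w => a * z r w - \sum_(i < r) t i * z i w)) ->
      exists u : 'I_l -> S, a = \sum_i u i * j i) ->
  (forall i, ~ exists b, b * j i = 1) -> False.
Proof.
move=> z_cocyc J_gen j_nunit; have [m_max _] := R_local; have [hm m1 _] := m_max.
(* A single exponent e0 brings into R the generators of J and all values of [z 0], ..., [z r] at
   words of the right length. *)
have [e0 he0] := uniform_root ([seq j i | i <- enum 'I_l] ++
  [seq z ir.1 ir.2 | ir <- [seq (i, w) | i <- iota 0 r.+1, w <- words (size x)]]).
have /choice[a ha] i : exists a, m a /\ j i ^+ (p ^ e0) = phi a.
  have [|b Eb] := he0 (j i); first by rewrite mem_cat map_f ?mem_enum.
  exists b; split=> //; apply: contrapT => /(local_unit R_noeth R_local)[c Ec].
  apply: (j_nunit i); exists (phi c * j i ^+ (p ^ e0).-1).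
  by rewrite -mulrA -exprSr prednK ?(expp_gt0 chRp) // Eb -rmorphM Ec rmorph1.
have z_root e i w : (i <= r)%N -> size w = size x ->
    exists b, z i w ^+ (p ^ (e0 + e)) = phi b.
  move=> leir sw; have [|b Eb] := he0 (z i w).
    rewrite mem_cat; apply/orP; right; apply/mapP; exists (i, w) => //.
    by apply/allpairsP; exists (i, w); rewrite mem_iota mem_words sw /= ltnS.
  by exists (b ^+ (p ^ e)); rewrite expnD exprM Eb rmorphXn.
have [C hC] := koszul_length_bound (s := x) k R_noeth m_max (@ideal_zero R)
  (fun Q hQ _ => x_prim hQ).
have P_sub i : (i <= d)%N -> P i `<=` m.
  by move=> /P_prime[hP P1 _]; apply: (local_proper R_noeth).
have [K K0 hK] := prime_chain_growth chRp R_noeth hm m1 P_prime P_sub P_lt.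
(* Multiplication of the q-th power of [z r] by elements of R carries a chain of length at least n^d
   into the cohomology of the q-th powers of x, whose length is at most C q^k. *)
have bound f n : (0 < n)%N -> (K * n <= p ^ f)%N -> (n ^ d <= C * (p ^ (e0 + f)) ^ k)%N.
  move=> n0 leKn; set q := (p ^ (e0 + f))%N.
  have q0 : (0 < q)%N by apply: expp_gt0 chRp _.
  have [N leN chN] := hK n n0; apply: leq_trans leN _.
  have := hC q.-1; rewrite prednK //; apply; set y := powers x q.-1.
  have Ey : y = [seq b ^+ q | b <- x] by apply: eq_map => b; rewrite prednK.
  have size_y : size y = size x by rewrite size_map.
  have /choice[zeta hzeta] : forall iw : nat * bitseq, exists b : R,
      (iw.1 <= r)%N -> size iw.2 = size x -> z iw.1 iw.2 ^+ q = phi b.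
    move=> [i w] /=; have [|nle] := boolP ((i <= r)%N && (size w == size x)).
      by move=> /andP[leir /eqP sw]; have [b Eb] := z_root f i w leir sw; exists b.
    by exists 0 => leir sw; rewrite leir sw eqxx in nle.
  pose Z i : bitseq -> R^o := fun w => zeta (i, w).
  have ZE i w : (i <= r)%N -> size w = size x -> phi (Z i w) = z i w ^+ q.
    by move=> leir sw; rewrite -(hzeta (i, w)).
  have wt_size h w : wt (size x) h w -> size w = size x by case/andP => /eqP.
  have kd_phi (c : bitseq -> R) w :
      phi (kd y c w) = kd [seq b ^+ q | b <- s] (fun v => phi (c v)) w.
    by rewrite -kd_map Ey -!map_comp; congr (kd _ _ w); apply: eq_map => b /=; rewrite rmorphXn.
  have Zc i : (i <= r)%N -> cocyc y [set 0] k (Z i).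
    move=> leir w; rewrite size_y => hw /=; apply: phi_inj; rewrite rmorph0 kd_phi.
    transitivity (kd [seq b ^+ q | b <- s] (fun v => z i v ^+ q) w).
      apply: (kd_eq (k := k)); rewrite ?size_map // => v /wt_size sv; exact: ZE.
    rewrite kd_frob // z_cocyc ?size_s //.
    by rewrite expr0n gtn_eqF.
  have hB := cobdP y k (@ideal_zero R); have hZ := cocycP y k (@ideal_zero R).
  have hsp := span_submod (fun i : 'I_r => Z i).
  pose A' := add_set (cobd y [set 0] k) (span (fun i : 'I_r => Z i)).
  apply: (@chain_monol _ _ A'); first by move=> c Bc; exists c, 0; rewrite addr0; split=> //; case: hsp.
  have P0 : [set 0] `<=` P 0%N.
    by move=> b ->; have [hP _ _] := P_prime (leq0n d); apply: ideal0.
  have {}chN : chain (cpow p m [set 0] (K * n) : set R^o) N setT.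
    apply: chain_monol chN; exact: cpowS hm P0 (leqnn _).
  move: chN; apply: (chain_lin (f := fun b : R^o => b *: Z r)).
  - by split.
  - exact: add_setP.
  - exact: hZ.
  - move=> _ [c [c' [Bc spc' ->]]]; apply: (submodD hZ); first exact: (cobd_cocyc (@ideal_zero R) Bc).
    by move: c' spc'; apply: (span_min hZ) => i; apply/Zc/ltnW.
  - by move=> b c c' /=; rewrite scalerDl; congr (_ + _); rewrite scalerA.
  - by move=> b _; apply: (submodZ _ hZ); apply: Zc.
  (* Injectivity: taking q-th roots of the relation over R shows that the root beta of b annihilates
     [z r] modulo the earlier generators, so beta lies in J and b is a combination of the
     [a i ^+ (p ^ f)] with coefficients in S. *)
  - move=> b _ [c [_ [[c1 hc1] [t ->] Eb]]].
    have [beta Ebeta] := frob_surj (e0 + f) (phi b).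
    have /choice[t' ht'] (i : nat) : exists u, forall (lt : (i < r)%N), u ^+ q = phi (t (Ordinal lt)).
      have [lt|nlt] := pselect (is_true (i < r)%N); last by exists 0 => lt; case: nlt.
      have [u Eu] := frob_surj (e0 + f) (phi (t (Ordinal lt))); exists u => lt'.
      by rewrite Eu; congr (phi (t _)); apply: val_inj.
    have /choice[c2 hc2] w := frob_surj (e0 + f) (phi (c1 w)).
    have [|u Eu] := J_gen beta.
      exists t', c2 => w; rewrite size_s => hw /=; have sw := wt_size _ _ hw.
      apply/eqP; rewrite subr_eq0; apply/eqP; apply: (@frob_inj (e0 + f)) => /=.
      rewrite (frobB chSp) exprMn Ebeta -/q -ZE // -(kd_frob chSp) -/q.
      rewrite (kd_ext _ _ (c' := fun v => phi (c1 v))) // -kd_phi.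
      have -> : kd y c1 w = c w.
        by apply/esym/eqP; rewrite -subr_eq0; apply/eqP/hc1; rewrite size_y.
      apply/eqP; rewrite subr_eq -rmorphM.
      have -> : b * Z r w = c w + (\sum_i t i *: Z i) w by rewrite -[LHS]/((b *: Z r) w) Eb.
      rewrite rmorphD fct_sumE rmorph_sum (frob_sum chSp); apply/eqP; congr (_ + _).
      apply: eq_bigr => i _; rewrite exprMn (ht' _ (ltn_ord i)) -/q -ZE ?(ltnW (ltn_ord i)) //.
      by rewrite -rmorphM; congr (phi (t _ * _)); apply: val_inj.
    (* The coefficients enter R only after a further [p ^ e1]-th power; the contracted powers [cpow]
       are designed to absorb it. *)
    have [e1 he1] := uniform_root [seq u i ^+ q | i <- enum 'I_l].
    have /choice[v hv] i : exists a, (u i ^+ q) ^+ (p ^ e1) = phi a.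
      by apply: he1; apply/mapP; exists i; rewrite ?mem_enum.
    have Eb1 : b ^+ (p ^ e1) = \sum_i v i * a i ^+ (p ^ f * p ^ e1).
      apply: phi_inj; rewrite rmorphXn -Ebeta Eu !(frob_sum chSp) rmorph_sum.
      apply: eq_bigr => i _; rewrite !exprMn hv rmorphM; congr (_ * _).
      by rewrite -/q /q expnD exprM (ha i).2 rmorphXn -exprM.
    exists e1; exists 0, (b ^+ (p ^ e1)); rewrite add0r; split=> //.
    apply: (@ipow_le _ _ (p ^ f * p ^ e1)) => //; first by rewrite leq_mul2r leKn orbT.
    rewrite Eb1; apply: ideal_sum => [|i _]; first exact: ipow_ideal.
    apply: idealM; first exact: ipow_ideal.
    rewrite -[X in ipow m X]mul1n; apply: ipow_exp => //.
    by rewrite -[a i]mulr1; apply: ipowM; [case: (ha i)|apply: ipow0].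
(* With n the integer part of [p ^ f / K] one has [p ^ f <= 2 * K * n], hence C q^k <= C' n^k. The
   choice of f makes n exceed C', so n^d >= n^(k+1) > C' n^k contradicts [bound]. *)
pose C' := (C * ((p ^ e0) * (2 * K)) ^ k)%N.
pose f := (K * C'.+1)%N; pose n := (p ^ f %/ K)%N.
have p1 : (1 < p)%N by apply/prime_gt1/(pcharf_prime chRp).
have ltf : (f < p ^ f)%N by apply: ltn_expl.
have ltn' : (C' < n)%N.
  by rewrite /n -(mulKn C'.+1 K0) leq_div2r // ltnW.
have n0 : (0 < n)%N by apply: leq_ltn_trans ltn'.
have := bound f n n0; rewrite mulnC leq_trunc_div => /(_ isT).
have le1 : (p ^ f <= 2 * K * n)%N.
  have := divn_eq (p ^ f) K; rewrite -/n; have := ltn_pmod (p ^ f) K0.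
  have : (K <= n * K)%N by rewrite leq_pmull.
  lia.
have le2 : (C * (p ^ (e0 + f)) ^ k <= C' * n ^ k)%N.
  rewrite /C' -mulnA leq_mul2l -expnMn; apply/orP; right.
  case: (k) => [|k']; rewrite ?expn0 // leq_exp2r //.
  by rewrite expnD -mulnA leq_mul2l le1 orbT.
move=> /leq_trans/(_ le2); apply/negP; rewrite -ltnNge.
apply: (@leq_trans (n ^ k.+1)); last by rewrite leq_pexp2l.
by rewrite expnS ltn_mul2r ltn' expn_gt0 n0.
Qed.

Theorem koszul_vanishing : cocyc s [set 0] k `<=` cobd s [set 0] k.
Proof.
have [r [z [z_cocyc z_gen]]] := cocyc_fg s k S_syz.
apply: (@eliminate_generators _ _ _ z r) => [c /z_gen[t Et]|l _].
  by exists t, 0 => w hw; rewrite [kd s _ w]kd0 subr0 /= Et // subrr.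
apply: contrapT => J1; pose J := annih s k z l.
(* J is the first projection of the module of pairs (a, c), where c is a sum of a coboundary and a
   combination of the [z i] with i < l, and [a * z l] agrees with c in weight k. The last condition
   amounts to finitely many linear forms on a finitely generated module. *)
have : fg (J : set S^o).
  pose C := bitseq -> S^o; pose W := [seq w <- words (size s) | count id w == k].
  pose inl (a : S^o) : (S^o * C)%type := (a, 0).
  pose inr (c : C) : (S^o * C)%type := (0, c).
  have inl_lin : linear inl.
    by move=> a u v; congr pair; rewrite /= ?scaler0 ?addr0.
  have inr_lin : linear inr.
    by move=> a u v; congr pair; rewrite /= ?scaler0 ?addr0.
  have kd_linear : linear (fun c : C => kd s c : C).
    by move=> a u v; apply: functional_extensionality_dep => w; apply: kd_lin.
  have fgS : fg (setT : set S^o).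
    exists 1%N, (fun=> 1); apply/seteqP; split=> // a _; exists (fun=> a).
    by rewrite big_ord1 -[RHS]/(a * 1) mulr1.
  pose B : set C := (fun c : C => kd s c : C) @` supported (words (size s)).
  have fgN : fg (add_set (inl @` setT) (inr @` (add_set B (span (fun i : 'I_l => z i))))).
    apply: fg_add; first exact: fg_image.
    apply: fg_image => //; apply: fg_add; last by exists l, (fun i => z i).
    by apply: fg_image => //; apply: supported_fg.
  pose lam w (ac : (S^o * C)%type) : S^o := ac.1 * z l w - ac.2 w.
  have lam_lin w : linear (lam w).
    move=> a u v; rewrite /lam -[RHS]/(a * (u.1 * z l w - u.2 w) + (v.1 * z l w - v.2 w)).
    by rewrite -[LHS]/((a * u.1 + v.1) * z l w - (a * u.2 w + v.2 w)); ring.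
  have [K Kfg [KN [h1 h2]]] := fg_kers W S_syz lam_lin fgN.
  have fold ac : foldr (fun w P => lam w ac = 0 /\ P) True W <->
      forall w, wt (size s) k w -> lam w ac = 0.
    transitivity (forall w, w \in W -> lam w ac = 0); last first.
      split=> hh w hw; apply: hh; move: hw; by rewrite mem_filter mem_words andbC.
    elim: (W) => [|w W' IHW] /=; first by split.
    rewrite IHW; split=> [[hh h'] v|hh]; first by rewrite inE => /predU1P[->|/h'].
    by split=> [|v vW]; apply: hh; rewrite inE ?eqxx ?vW ?orbT.
  rewrite (_ : J = fst @` K); first by apply: fg_image => // a u v.
  apply/seteqP; split=> [a [t [b hb]]|_ [ac Kac <-]].
    pose c : C := (kd s (restrict (size s) b) : C) + \sum_(i < l) t i *: z i.
    exists (a, c) => //; apply: h2.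
      exists (inl a), (inr c); split; first by exists a.
        exists c => //; exists (kd s (restrict (size s) b)), (\sum_(i < l) t i *: z i).
        split=> //; last by exists (fun i => t i).
        by exists (restrict (size s) b) => //; apply: restrict_supported.
      by congr pair; rewrite ?addr0 ?add0r.
    apply/fold => w hw; rewrite /lam /= /c.
    rewrite -[X in _ - X]/(kd s (restrict (size s) b) w + (\sum_(i < l) t i *: z i) w).
    rewrite fct_sumE; have := hb w hw => /= E; rewrite -[RHS]E.
    suff -> : kd s (restrict (size s) b) w = kd s b w by ring.
    case: (k) hw => [|k'] hw; first by rewrite !kd_wt0.
    by apply: kd_eq hw => v; apply: restrict_wt.
  have /fold hlam := h1 _ Kac.
  have [_ [_ [[a _ <-] [c [_ [_ [[b _ <-] [t ->] ->]]] <-] Eac]]] := KN _ Kac.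
  exists (fun i => if insub i is Some i' then t i' else 0), b => w hw /=.
  rewrite -[RHS](hlam w hw) /lam Eac /= -[X in _ = _ - X w]/(0 + (kd s b + \sum_i t i *: z i)).
  rewrite -[X in _ = _ - X]/(0 + (kd s b w + (\sum_i t i *: z i) w)) fct_sumE.
  have -> : \sum_(i < l) (if insub (i : nat) is Some i' then t i' else 0) * z i w =
      \sum_(i < l) t i * z i w by apply: eq_bigr => i _; rewrite valK.
  by rewrite -[a + 0]/(a + 0) addr0; ring.
move=> [n [j EJ]].
apply: (@annihilator_contra l z n j) => // [a Ja|i [b Eb]].
  by have : J a by []; rewrite EJ => -[u ->]; exists u.
apply: J1; rewrite -Eb.
apply: (idealM _ (annih_ideal _ _ _ _)); rewrite -/J EJ; apply: span_mem.
Qed.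

End Vanishing.

(** * Changing exponents *)

Section ChangeOfExponents.
Variable R : comNzRingType.
Implicit Types (t y f s : seq R) (c b g : bitseq -> R) (w : bitseq).

(** Multiplication by [wprod f] is the cochain map from the complex of y to that of [mulseq y f];
    for powers of x these are the transition maps whose direct limit is the Cech complex. *)
Fixpoint wprod f w : R :=
  match f, w with
  | a :: f', b :: w' => (if b then a else 1) * wprod f' w'
  | _, _ => 1
  end.

Fixpoint mulseq y f : seq R :=
  match y, f with
  | a :: y', b :: f' => a * b :: mulseq y' f'
  | _, _ => [::]
  end.

Lemma size_mulseq y f : size f = size y -> size (mulseq y f) = size y.
Proof. by elim: y f => [|a y IHy] [|b f] //= [/IHy->]. Qed.

Lemma kd_mulseq y f c w : size f = size y ->
  kd (mulseq y f) (fun v => wprod f v * c v) w = wprod f w * kd y c w.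
Proof.
elim: y f c w => [|a y IHy] [|b f] c [|[] w] //=; rewrite ?mulr0 // => -[sf].
  rewrite (kd_ext _ _ (c' := fun v => b * (wprod f v * c (true :: v)))); last first.
    by move=> v; rewrite mulrA.
  by rewrite kdZ IHy //; ring.
rewrite (kd_ext _ _ (c' := fun v => wprod f v * c (false :: v))); last first.
  by move=> v; rewrite mul1r.
by rewrite IHy // mul1r.
Qed.

Lemma wprodX f n w : wprod [seq a ^+ n | a <- f] w = wprod f w ^+ n.
Proof.
elim: f w => [|a f IHf] [|b w] /=; rewrite ?expr1n // IHf exprMn.
by case: b; rewrite ?expr1n.
Qed.

Lemma wprod_mul f f' w : size f = size f' ->
  wprod (mulseq f f') w = wprod f w * wprod f' w.
Proof.
elim: f f' w => [|a f IHf] [|a' f'] [|b w] //=; rewrite ?mulr1 // => -[/IHf->].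
by case: b; ring.
Qed.

(* Operators whose value at a word is a multiple of the value of the cochain at
   a single word, whose weight is larger by j' - j. *)
Definition monomial_op (j j' : nat) (o : (bitseq -> R) -> bitseq -> R) : Prop :=
  forall w, exists r v, (forall c, o c w = r * c v) /\
    (r = 0 \/ size v = size w /\ (count id v + j = count id w + j')%N).

(** The operator o applied to the variable at position i; eps is -1 for operators of odd degree,
    giving the Koszul sign for the variables in front. *)
Fixpoint op_at (eps : R) (o : (bitseq -> R) -> bitseq -> R) i c w : R :=
  if i is i'.+1 then
    if w is b :: w' then (if b then eps else 1) * op_at eps o i' (fun v => c (b :: v)) w'
    else 0
  else o c w.

Lemma op_at_monomial eps j j' o i : monomial_op j j' o -> monomial_op j j' (op_at eps o i).
Proof.
move=> ho; elim: i => [//|i IHi] [|b w] /=.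
  by exists 0, [::]; split=> [c|]; [rewrite mul0r|left].
have [r [v [E H]]] := IHi w; exists ((if b then eps else 1) * r), (b :: v); split.
  by move=> c; rewrite E mulrA.
case: H => [->|[sv cv]]; first by left; rewrite mulr0.
by right; rewrite /= sv -!addnA cv.
Qed.

Lemma monomial_vanish j j' o d k k' c : monomial_op j j' o -> (k + j = k' + j')%N ->
  (forall v, wt d k v -> c v = 0) -> forall w, wt d k' w -> o c w = 0.
Proof.
move=> ho Ek hc w /andP[/eqP sw /eqP cw]; have [r [v [-> []]]] := ho w.
  by move=> ->; rewrite mul0r.
move=> [sv cv]; rewrite hc ?mulr0 // /wt sv sw eqxx /=; apply/eqP; lia.
Qed.

Lemma monomialB j j' o c b w : monomial_op j j' o ->
  o (fun v => c v - b v) w = o c w - o b w.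
Proof. by move=> /(_ w)[r [v [E _]]]; rewrite !E mulrBr. Qed.

Lemma monomial_ext j j' o c b w : monomial_op j j' o -> c =1 b -> o c w = o b w.
Proof. by move=> /(_ w)[r [v [E _]]] cb; rewrite !E cb. Qed.

(** In one variable, [tau0] and [sigma0] are the cochain maps K(a) -> K(a f) -> K(f), and [kappa0]
    is the connecting map from K(f) to the shifted K(a). [h0] contracts the composite of the first
    two, [pi0] that of [sigma0] and [kappa0]. *)
Let tau0 (f : R) c w := if w is b :: w' then (if b then f * c (true :: w') else c (false :: w')) else 0.
Let sigma0 (a : R) c w := if w is b :: w' then (if b then c (true :: w') else a * c (false :: w')) else 0.
Let h0 c w := if w is b :: w' then (if b then 0 else c (true :: w')) else 0.
Let pi0 c w := if w is b :: w' then (if b then 0 else c (false :: w')) else 0.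
Let kappa0 c w := if w is b :: w' then (if b then c (false :: w') else 0) else 0.

Let sigma0_mon (a : R) : monomial_op 0 0 (sigma0 a).
Proof.
case=> [|[] w]; last by exists a, (false :: w); split=> [c|] //; right.
  by exists 0, [::]; split=> [c|]; [rewrite mul0r|left].
by exists 1, (true :: w); split=> [c|]; [rewrite mul1r|right].
Qed.

Let h0_mon : monomial_op 0 1 h0.
Proof.
case=> [|[] w]; last first.
  by exists 1, (true :: w); split=> [c|]; [rewrite mul1r|right; rewrite /=; lia].
all: by exists 0, [::]; split=> [c|]; [rewrite mul0r|left].
Qed.

Let pi0_mon : monomial_op 0 0 pi0.
Proof.
case=> [|[] w]; last by exists 1, (false :: w); split=> [c|]; [rewrite mul1r|right].
all: by exists 0, [::]; split=> [c|]; [rewrite mul0r|left].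
Qed.

Let kappa0_mon : monomial_op 1 0 kappa0.
Proof.
case=> [|[] w].
- by exists 0, [::]; split=> [c|]; [rewrite mul0r|left].
- by exists 1, (false :: w); split=> [c|]; [rewrite mul1r|right; rewrite /=; lia].
- by exists 0, [::]; split=> [c|]; [rewrite mul0r|left].
Qed.

Let tau (a : R) := op_at 1 (tau0 a).
Let sigma (a : R) := op_at 1 (sigma0 a).
Let h := op_at (-1) h0.
Let pi := op_at 1 pi0.
Let kappa := op_at (-1) kappa0.

Let kd_const0 s w : kd s (fun=> 0) w = 0. Proof. exact: kd0. Qed.

Let kd_op (e : R) s (o : (bitseq -> R) -> bitseq -> R) c w :
  kd s (fun v => e * o c v) w = e * kd s (o c) w.
Proof. exact: kdZ. Qed.

Variables (a f : R) (y : seq R).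

Let piK t c w : size w = (size t + (size y).+1)%N ->
  pi (size t) (tau f (size t) c) w + kappa (size t) (h (size t) c) w = c w.
Proof.
elim: t c w => [|x t IHt] c [|b w] //= [sw].
  by case: b; rewrite ?addr0 ?add0r.
rewrite /pi /kappa /tau /h /= -[RHS](IHt (fun v => c (b :: v)) w sw).
have pm := op_at_monomial 1 (size t) pi0_mon.
have km := op_at_monomial (-1) (size t) kappa0_mon.
congr (_ + _); last first.
  have [r [v [E _]]] := km w; rewrite /kappa !E /h; case: b; rewrite ?mul1r //; ring.
have [r [v [E _]]] := pm w; rewrite /pi !E /tau; case: b; rewrite ?mul1r //; ring.
Qed.

Let sigma_tau t c w : size w = (size t + (size y).+1)%N ->
  kd (t ++ f :: y) (h (size t) c) w + h (size t) (kd (t ++ a :: y) c) w =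
  sigma a (size t) (tau f (size t) c) w.
Proof.
elim: t c w => [|x t IHt] c [|b w] //= [sw].
  case: b => /=; first by rewrite kd_const0 subr0 addr0.
  by rewrite addrC subrK.
have := IHt (fun v => c (b :: v)) w sw; rewrite /h /sigma /tau.
have hm := op_at_monomial (-1) (size t) h0_mon.
have sm := op_at_monomial 1 (size t) (sigma0_mon a).
case: b => /=; rewrite !mul1r.
  rewrite (kd_op (-1)) (monomialB _ _ _ hm).
  have -> : op_at (-1) h0 (size t) (fun v => x * c (false :: v)) w =
      x * op_at (-1) h0 (size t) (fun v => c (false :: v)) w.
    by have [r [v [E _]]] := hm w; rewrite !E; ring.
  rewrite (monomial_ext _ sm (b := op_at 1 (tau0 f) (size t) (fun v => c (true :: v)))).
    by move=> <-; ring.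
  by move=> v; rewrite mul1r.
rewrite (kd_ext _ _ (c' := op_at (-1) h0 (size t) (fun v => c (false :: v)))); last first.
  by move=> v; rewrite mul1r.
move=> ->; apply: (monomial_ext _ sm) => v; by rewrite mul1r.
Qed.

Let kd_pi t c w : size w = (size t + (size y).+1)%N ->
  kd (t ++ a :: y) (pi (size t) c) w =
  pi (size t) (kd (t ++ a * f :: y) c) w + kappa (size t) (sigma a (size t) c) w.
Proof.
elim: t c w => [|x t IHt] c [|b w] //= [sw].
  by case: b => /=; rewrite ?kd_const0 ?subr0 ?addr0 ?add0r.
have := IHt (fun v => c (b :: v)) w sw; rewrite /pi /sigma /kappa.
have pm := op_at_monomial 1 (size t) pi0_mon.
have km := op_at_monomial (-1) (size t) kappa0_mon.
case: b => /=; rewrite !mul1r.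
  rewrite (kd_op 1) (monomialB _ _ _ pm) mul1r => ->.
  have -> : op_at 1 pi0 (size t) (fun v => x * c (false :: v)) w =
      x * op_at 1 pi0 (size t) (fun v => c (false :: v)) w.
    by have [r [v [E _]]] := pm w; rewrite !E; ring.
  rewrite [X in _ = _ + -1 * X](monomial_ext _ km
    (b := op_at 1 (sigma0 a) (size t) (fun v => c (true :: v)))); first by ring.
  by move=> v; rewrite mul1r.
rewrite (kd_ext _ _ (c' := op_at 1 pi0 (size t) (fun v => c (false :: v)))); last first.
  by move=> v; rewrite mul1r.
by move=> ->; congr (_ + _); apply: (monomial_ext _ km) => v; rewrite mul1r.
Qed.

Let kd_kappa t c w : size w = (size t + (size y).+1)%N ->
  kd (t ++ a :: y) (kappa (size t) c) w = - kappa (size t) (kd (t ++ f :: y) c) w.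
Proof.
elim: t c w => [|x t IHt] c [|b w] //= [sw].
  by case: b => /=; rewrite ?kd_const0 ?mulr0 ?oppr0 // sub0r.
have := IHt (fun v => c (b :: v)) w sw; rewrite /kappa.
have km := op_at_monomial (-1) (size t) kappa0_mon.
case: b => /=; rewrite !mul1r.
  rewrite (kd_op (-1)) (monomialB _ _ _ km) => ->.
  have -> : op_at (-1) kappa0 (size t) (fun v => x * c (false :: v)) w =
      x * op_at (-1) kappa0 (size t) (fun v => c (false :: v)) w.
    by have [r [v [E _]]] := km w; rewrite !E; ring.
  by ring.
move=> <-; apply: kd_ext => v; by rewrite mul1r.
Qed.

Let kd_sigma t c w : size w = (size t + (size y).+1)%N ->
  kd (t ++ f :: y) (sigma a (size t) c) w = sigma a (size t) (kd (t ++ a * f :: y) c) w.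
Proof.
elim: t c w => [|x t IHt] c [|b w] //= [sw].
  by case: b => /=; [rewrite mulrCA mulrA | rewrite kdZ].
have := IHt (fun v => c (b :: v)) w sw; rewrite /sigma.
have sm := op_at_monomial 1 (size t) (sigma0_mon a).
case: b => /=; rewrite !mul1r.
  rewrite (kd_op 1) (monomialB _ _ _ sm) mul1r => ->.
  have -> : op_at 1 (sigma0 a) (size t) (fun v => x * c (false :: v)) w =
      x * op_at 1 (sigma0 a) (size t) (fun v => c (false :: v)) w.
    by have [r [v [E _]]] := sm w; rewrite !E; ring.
  by [].
move=> <-; apply: kd_ext => v; by rewrite mul1r.
Qed.

Let tau_wprod t n c w : size w = (size t + n.+1)%N ->
  tau f (size t) c w = wprod (nseq (size t) 1 ++ f :: nseq n 1) w * c w.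
Proof.
have w1 v : wprod (nseq n 1) v = 1.
  by elim: n v => [|n' IHn] [|[] v] //=; rewrite IHn mulr1.
elim: t c w => [|x t IHt] c [|b w] //= [sw].
  by rewrite w1 mulr1; case: b; rewrite ?mul1r.
rewrite /tau /= -/(tau f (size t) _ _) (IHt (fun v => c (b :: v)) w sw).
by case: b; rewrite !mul1r.
Qed.

Definition koszul_exact s k := cocyc s [set 0] k `<=` cobd s [set 0] k.

(* The three complexes with entry a, a f, f at the given position form a
   homotopy exact triangle. *)
Lemma koszul_injective1 t k (c : bitseq -> R^o) :
  (forall k', k = k'.+1 -> koszul_exact (t ++ f :: y) k') ->
  cocyc (t ++ a :: y) [set 0] k c ->
  cobd (t ++ a * f :: y) [set 0] k
    (fun w => wprod (nseq (size t) 1 ++ f :: nseq (size y) 1) w * c w) ->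
  cobd (t ++ a :: y) [set 0] k c.
Proof.
set d := (size t + (size y).+1)%N.
have sz x : size (t ++ x :: y) = d by rewrite size_cat.
have pm := op_at_monomial 1 (size t) pi0_mon : monomial_op 0 0 (pi (size t)).
have km := op_at_monomial (-1) (size t) kappa0_mon : monomial_op 1 0 (kappa (size t)).
have sm := op_at_monomial 1 (size t) (sigma0_mon a) : monomial_op 0 0 (sigma a (size t)).
have hm := op_at_monomial (-1) (size t) h0_mon : monomial_op 0 1 (h (size t)).
have wts j w : wt d j w -> size w = d by case/andP => /eqP.
move=> ex hc [b hb].
pose E1 w := tau f (size t) c w - kd (t ++ a * f :: y) b w.
have hE1 w : wt d k w -> E1 w = 0.
  move=> hw; rewrite /E1 (@tau_wprod t (size y)) ?(wts _ _ hw) //.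
  by have /= := hb w; rewrite sz => /(_ hw).
case: k ex hc hb hE1 => [|k] ex hc hb hE1.
  exists 0 => w; rewrite sz => hw; rewrite [kd _ _ w]kd0 subr0 /=.
  rewrite -(piK c (wts _ _ hw)).
  rewrite (monomial_vanish pm (erefl (0 + 0)%N) _ hw); last first.
    move=> v hv; have := hE1 v hv; rewrite /E1 kd_wt0 ?subr0 //.
    by rewrite sz.
  have [r [v [-> [->|[_ cv]]]]] := km w; first by rewrite mul0r addr0.
  by case/andP: hw => _ /eqP cw; rewrite cw in cv; lia.
(* E2 is a cocycle one degree below c, for the complex with entry f. If g bounds it, then [pi] b +
   [kappa] g bounds c, because c = [pi] ([tau] c) + [kappa] ([h] c). *)
pose E2 w := sigma a (size t) b w - h (size t) c w.
have hE2 : cocyc (t ++ f :: y) [set 0] k E2.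
  move=> w; rewrite sz => hw /=; rewrite kdB kd_sigma ?(wts _ _ hw) //.
  have := sigma_tau c (wts _ _ hw).
  move=> /(canRL (addrK _)) ->.
  have -> : h (size t) (kd (t ++ a :: y) c) w = 0.
    apply: (monomial_vanish hm (k := k.+2)) hw; first by lia.
    by move=> v; have := hc v; rewrite sz.
  rewrite subr0 -(monomialB _ _ _ sm).
  apply: (monomial_vanish sm (erefl (k.+1 + 0)%N)) hw => v /hE1 E.
  by rewrite -[RHS]oppr0 -E opprB.
have [g hg] := ex k erefl _ hE2.
exists (fun w => pi (size t) b w + kappa (size t) g w) => w; rewrite sz => hw /=.
rewrite kdD kd_pi ?(wts _ _ hw) // kd_kappa ?(wts _ _ hw) //.
rewrite -[X in X - _](piK c (wts _ _ hw)).
have F1 : pi (size t) (tau f (size t) c) w = pi (size t) (kd (t ++ a * f :: y) b) w.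
  apply/eqP; rewrite -subr_eq0 -(monomialB _ _ _ pm); apply/eqP.
  exact: (monomial_vanish pm (erefl (k.+1 + 0)%N)) hw.
have F2 : kappa (size t) (sigma a (size t) b) w - kappa (size t) (h (size t) c) w =
    kappa (size t) (kd (t ++ f :: y) g) w.
  rewrite -(monomialB _ _ _ km); apply/eqP; rewrite -subr_eq0 -(monomialB _ _ _ km).
  apply/eqP; apply: (monomial_vanish km (k := k)) hw; first by lia.
  by move=> v; have := hg v; rewrite sz.
by rewrite F1 -F2; ring.
Qed.

End ChangeOfExponents.

Section Powers.
Variable R : comNzRingType.
Implicit Types (x t y f s : seq R).

Fixpoint powers_of x u : Prop :=
  match x, u with
  | [::], [::] => True
  | a :: x', b :: u' => (exists n, b = a ^+ n.+1) /\ powers_of x' u'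
  | _, _ => False
  end.

Lemma powers_of_cat x1 u1 x2 u2 :
  powers_of x1 u1 -> powers_of x2 u2 -> powers_of (x1 ++ x2) (u1 ++ u2).
Proof. by elim: x1 u1 => [|a x1 IHx] [|b u1] //= [E /IHx h] /h. Qed.

Lemma powers_of_mul x y f : powers_of x y -> powers_of x f -> powers_of x (mulseq y f).
Proof.
elim: x y f => [|a x IHx] [|b y] [|c f] //= [[n ->] /IHx hy] [[n' ->] /hy].
by split=> //; exists (n + n').+1; rewrite -exprD addSn addnS.
Qed.

Lemma powers_of_size x y : powers_of x y -> size y = size x.
Proof. by elim: x y => [|a x IHx] [|b y] //= [_ /IHx->]. Qed.

Lemma powers_of_exp x n : powers_of x [seq a ^+ n.+1 | a <- x].
Proof. by elim: x => //= a x IHx; split=> //; exists n. Qed.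

(** The entries of y are multiplied by those of f one at a time, the finished ones being collected
    in t. The intermediate sequences have unequal exponents, hence exactness is assumed for every
    sequence of positive powers. *)
Lemma koszul_injective x0 t x y f k (c : bitseq -> R^o) :
  (forall k' u, k = k'.+1 -> powers_of (x0 ++ x) u -> koszul_exact u k') ->
  powers_of x0 t -> powers_of x y -> powers_of x f ->
  cocyc (t ++ y) [set 0] k c ->
  cobd (t ++ mulseq y f) [set 0] k (fun w => wprod (nseq (size t) 1 ++ f) w * c w) ->
  cobd (t ++ y) [set 0] k c.
Proof.
move=> ex; elim: x y f x0 t c ex => [|b x IHx] [|a y] [|e f] x0 t c ex //= ht.
  move=> _ _ hc; congr (cobd _ _ _ _); apply: functional_extensionality_dep => w.
  rewrite !cats0; have -> : wprod (nseq (size t) (1 : R)) w = 1; last by rewrite mul1r.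
  by elim: (size t) w => [|n' IHn] [|[] v] //=; rewrite IHn mulr1.
move=> [ha hy] [he hf] hc hb.
have sy := powers_of_size hy; have sf := powers_of_size hf.
have ex1 k' : k = k'.+1 -> koszul_exact (t ++ e :: y) k'.
  by move=> Ek; apply: ex Ek _; apply: powers_of_cat.
apply: (koszul_injective1 ex1 hc).
pose c1 : bitseq -> R^o :=
  fun w => wprod (nseq (size t) 1 ++ e :: nseq (size y) 1) w * c w.
have mul1 z : mulseq z (nseq (size z) 1) = z.
  by elim: z => //= r z ->; rewrite mulr1.
have mul_cat z1 z2 z3 z4 : size z1 = size z2 ->
    mulseq (z1 ++ z3) (z2 ++ z4) = mulseq z1 z2 ++ mulseq z3 z4.
  by elim: z1 z2 => [|r z1 IHz] [|r' z2] //= [/IHz->].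
have hc1 : cocyc (rcons t (a * e) ++ y) [set 0] k c1.
  rewrite cat_rcons => w hw /=.
  have E : t ++ a * e :: y = mulseq (t ++ a :: y) (nseq (size t) 1 ++ e :: nseq (size y) 1).
    by rewrite mul_cat ?size_nseq //= !mul1.
  rewrite {1}E kd_mulseq; last by rewrite !size_cat /= !size_nseq.
  by rewrite hc ?mulr0 //; move: hw; rewrite !size_cat.
have hpow : powers_of (rcons x0 b) (rcons t (a * e)).
  rewrite -!cats1; apply: powers_of_cat => //=; split=> //.
  by case: ha he => n -> [n' ->]; exists (n + n').+1; rewrite -exprD addSn addnS.
rewrite -cat_rcons; apply: (IHx y f (rcons x0 b) (rcons t (a * e)) c1) => //.
  by move=> k' u Ek; rewrite cat_rcons; apply: ex Ek.
rewrite cat_rcons; move: hb; congr (cobd _ _ _ _).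
apply: functional_extensionality_dep => w; rewrite /c1 mulrA; congr (_ * _).
have -> : nseq (size t) 1 ++ e :: f =
    mulseq (nseq (size (rcons t (a * e))) 1 ++ f) (nseq (size t) 1 ++ e :: nseq (size y) 1).
  rewrite size_rcons -addn1 nseqD -catA mul_cat ?size_nseq //=.
  by rewrite sy -sf mul1 mul1r; congr (_ ++ _); elim: (size t) => //= n <-; rewrite mulr1.
by rewrite wprod_mul // !size_cat /= !size_nseq size_rcons sf sy addSnnS.
Qed.

End Powers.

(** * The Cech complex *)

Lemma wprodE (R : comNzRingType) (f : seq R) w : size w = size f ->
  wprod f w = \prod_(j < size f | nth false w j) f`_j.
Proof.
elim: f w => [|a f IHf] [|b w] //=; first by rewrite big_ord0.
move=> [/IHf E].
by rewrite big_mkcond big_ord_recl /= E [in LHS]big_mkcond.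
Qed.

Lemma kd_sum (R : comNzRingType) (s : seq R) (c : bitseq -> R) w : size w = size s ->
  kd s c w = \sum_(j < size s | nth false w j)
    (-1) ^+ count id (take j w) * s`_j * c (set_nth false w j false).
Proof.
elim: s c w => [|x s IHs] c [|b w] //=; first by rewrite big_ord0.
move=> [sw].
rewrite big_mkcond big_ord_recl /=.
have E := IHs (fun v => c (b :: v)) w sw.
case: b E => E; rewrite E big_mkcond /=.
  rewrite mul1r -sumrN; congr (_ + _); apply: eq_bigr => j _ /=.
  by case: ifP => _; rewrite ?oppr0 // add1n exprS mulN1r !mulNr.
by rewrite add0r; apply: eq_bigr => j _.
Qed.

(** * Subsets of the index set as bit sequences *)

Section Words.
Variable d : nat.
Implicit Types I J : {set 'I_d}.

Definition word I : bitseq := [seq i \in I | i <- enum 'I_d].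

Lemma size_word I : size (word I) = d.
Proof. by rewrite size_map size_enum_ord. Qed.

Lemma nth_word I (j : 'I_d) : nth false (word I) j = (j \in I).
Proof. by rewrite (nth_map j) ?size_enum_ord // nth_ord_enum. Qed.

Lemma count_word I : count id (word I) = #|I|.
Proof.
by rewrite count_map -sum1_card -sum1_count big_enum_cond.
Qed.

Lemma wt_word I k : wt d k (word I) = (#|I| == k).
Proof. by rewrite /wt size_word eqxx count_word. Qed.

Lemma word_onto w : size w = d -> exists I, w = word I.
Proof.
move=> sw; exists [set i : 'I_d | nth false w i]%SET.
apply: (@eq_from_nth _ false); first by rewrite size_word.
by move=> i; rewrite sw => ltid; rewrite (nth_word _ (Ordinal ltid)) inE.
Qed.

Lemma set_nth_word J (j : 'I_d) : set_nth false (word J) j false = word (J :\ j)%SET.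
Proof.
have sz : size (set_nth false (word J) j false) = d.
  by rewrite size_set_nth size_word; apply/maxn_idPr.
apply: (@eq_from_nth _ false) => [|i]; first by rewrite sz size_word.
rewrite sz => ltid; rewrite nth_set_nth /=.
by rewrite (nth_word _ (Ordinal ltid)) !(nth_word _ (Ordinal ltid)) !inE -val_eqE /=; case: eqP.
Qed.

Lemma count_take_word J (j : 'I_d) :
  count id (take j (word J)) = #|[set i in J | (i < j)%N]%SET|.
Proof.
rewrite -count_word -[in RHS](cat_take_drop j (word _)) count_cat.
have -> : count id (drop j (word [set i in J | (i < j)%N]%SET)) = 0%N.
  apply/eqP; rewrite -leqn0 leqNgt -has_count; apply/hasPn => b /(nthP false)[i].
  rewrite size_drop size_word nth_drop => lti <-.
  have ltid : (j + i < d)%N by rewrite -ltn_subRL.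
  by rewrite (nth_word _ (Ordinal ltid)) inE /= ltnNge leq_addr andbF.
have size_take_word I : size (take j (word I)) = j.
  by rewrite size_takel // size_word ltnW.
rewrite addn0; congr (count id _).
apply: (@eq_from_nth _ false) => [|i]; first by rewrite !size_take_word.
rewrite size_take_word => ltij; have ltid : (i < d)%N by apply: ltn_trans ltij _.
by rewrite !nth_take // !(nth_word _ (Ordinal ltid)) inE /= ltij andbT.
Qed.

End Words.

Local Notation frac := Defs.frac.

Section Fractions.
Variables (R : comNzRingType) (f : R).

Lemma frac_add a b n : frac f a n + frac f b n = frac f (a + b) n.
Proof. by rewrite fracD; apply/frac_eqP; exists 0%N; rewrite !add0n exprD; ring. Qed.

Lemma frac_sign l a n : (-1) ^+ l * frac f a n = frac f ((-1) ^+ l * a) n.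
Proof.
elim: l => [|l IHl]; first by rewrite !expr0 !mul1r.
by rewrite !exprS -mulrA IHl mulN1r fracN mulNr mul1r mulNr.
Qed.

Lemma frac_sum (T : Type) (r : seq T) (P : pred T) (F : T -> R) n :
  \sum_(i <- r | P i) frac f (F i) n = frac f (\sum_(i <- r | P i) F i) n.
Proof.
apply: esym; apply: (big_morph (fun a => frac f a n)); last exact: frac0.
by move=> a b; rewrite frac_add.
Qed.

Lemma frac_lift a n k : frac f a n = frac f (f ^+ k * a) (n + k).
Proof. by apply/frac_eqP; exists 0%N; rewrite !add0n exprD; ring. Qed.

End Fractions.

Section CechKoszul.
Variables (R : comNzRingType) (d : nat) (x : d.-tuple R).
Implicit Types (I J : {set 'I_d}) (c : bitseq -> R).

Lemma prod_on_wprod I : prod_on x I = wprod x (word I).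
Proof.
rewrite wprodE ?size_word ?size_tuple // /prod_on.
by apply: eq_big => [i|i _]; rewrite ?nth_word ?(tnth_nth 0).
Qed.

Definition xpow n : seq R := [seq a ^+ n | a <- x].

Lemma size_xpow n : size (xpow n) = d. Proof. by rewrite size_map size_tuple. Qed.

(** The canonical map to the Cech complex from the Koszul complex of the n-th powers of x. *)
Definition to_cech k n c : cech x k := fun I : ksub d k => frac _ (c (word (val I))) n.

Arguments to_cech : clear implicits.

Lemma cech_d_to_cech k n c : cech_d (to_cech k n c) = to_cech k.+1 n (kd (xpow n) c).
Proof.
apply: functional_extensionality_dep => J; rewrite /cech_d /to_cech.
pose G (I : {set 'I_d}) : localization (prod_on x (val J)) :=
  frac _ ((-1) ^+ cech_sign I (val J) * (c (word I) * prod_on x (val J :\: I) ^+ n)) n.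
transitivity (\sum_(I : ksub d k | val I \subset val J) G (val I)).
  by apply: eq_bigr => I IJ; rewrite /cech_map (loc_map_frac (prod_onD x IJ)) frac_sign.
(* The subsets of J with one element fewer are indexed by the element removed, as in [kd_sum]; the
   two signs then both count the elements of J below j. *)
transitivity (\sum_(j in val J) G (val J :\ j)%SET).
  rewrite -(big_imset (h := fun I : ksub d k => val I) G) /=; last first.
    by move=> I I' _ _; apply: val_inj.
  rewrite -[RHS](big_imset (h := fun j => (val J :\ j)%SET) G) /=; last first.
    by move=> j j' jJ _ /setP/(_ j); rewrite !inE eqxx jJ andbT; case: eqP.
  apply: eq_bigl => I; apply/imsetP/imsetP => [[[I' cI'] IJ ->]|[j jJ ->]] /=; last first.
    have cj : #|(val J :\ j)%SET| == k.
      by have := cardsD1 j (val J); rewrite jJ (eqP (valP J)) add1n => /eqP;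
        rewrite eqSS eq_sym.
    by exists (exist (fun I : {set 'I_d} => is_true (#|I| == k)) _ cj) => //; apply: subD1set.
  rewrite unfold_in /= in IJ.
  have /cards1P[j Ej] : #|val J :\: I'| == 1%N.
    by rewrite cardsD (finset.setIidPr IJ) (eqP (valP J)) (eqP cI') subSnn.
  have : j \in (val J :\: I')%SET by rewrite Ej inE.
  rewrite inE => /andP[jI' jJ]; exists j => //; apply/setP => i.
  move/setP/(_ i): Ej; rewrite !inE.
  have [->|ij] := eqVneq i j; first by rewrite (negPf jI').
  have [iI'|niI'] /= := boolP (i \in I'); last by move=> ->.
  by move=> _; rewrite (fintype.subsetP IJ).
rewrite frac_sum; congr frac.
rewrite kd_sum ?size_xpow ?size_word //.
apply: eq_big => [j|j jJ]; first by rewrite nth_word.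
have E : (val J :\: (val J :\ j) = [set j])%SET.
  by apply/setP => i; rewrite !inE negb_and negbK; case: eqP => [->|]; rewrite ?jJ //= andNb.
have Esign : cech_sign (val J :\ j)%SET (val J) = #|[set i in val J | (i < j)%N]%SET|.
  rewrite /cech_sign E; apply: eq_card => i; rewrite !inE; congr (_ && _).
  by apply/existsP/idP => [[j']|ltij]; [rewrite inE => /andP[/eqP->]|exists j; rewrite inE eqxx].
rewrite set_nth_word count_take_word Esign E.
have -> : prod_on x [set j]%SET = tnth x j by rewrite /prod_on big_set1.
by rewrite (nth_map 0) ?size_tuple // -(tnth_nth 0) -[RHS]mulrA [c _ * _]mulrC.
Qed.

(** There are finitely many index sets, so the components have a common exponent in the
    denominator. *)
Lemma cech_from k (z : cech x k) : exists n c, z = to_cech k n c.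
Proof.
have /choice[an Han] (I : ksub d k) : exists an : R * nat, z I = frac _ an.1 an.2.
  by have [a [n E]] := frac_surj (z I); exists (a, n).
pose N := (\max_I (an I).2)%N.
have /choice[c hc] (w : bitseq) : exists b : R, forall I : ksub d k, w = word (val I) ->
    frac (prod_on x (val I)) b N = z I.
  have [[I Ew]|nw] := pselect (exists I : ksub d k, w = word (val I)); last first.
    by exists 0 => I Ew; case: nw; exists I.
  have leN : ((an I).2 <= N)%N by apply: leq_bigmax.
  exists (prod_on x (val I) ^+ (N - (an I).2) * (an I).1) => I' Ew'.
  have EI : I' = I.
    apply/val_inj/setP => i; rewrite -!nth_word.
    by rewrite -Ew -Ew'.
  by rewrite EI Han [RHS](frac_lift _ _ _ (N - (an I).2)) subnKC.
exists N, c; apply: functional_extensionality_dep => I.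
by rewrite /to_cech (hc _ I).
Qed.

Lemma coboundary_to_cech k n c : is_coboundary (to_cech k n (kd (xpow n) c)).
Proof.
case: k => [|k] /=; last by exists (to_cech k n c); rewrite cech_d_to_cech.
apply: functional_extensionality_dep => I; rewrite /to_cech kd_wt0 ?frac0 //.
by rewrite size_xpow wt_word (valP I).
Qed.

Lemma coboundary_from k (z : cech x k) : is_coboundary z ->
  exists n c, z = to_cech k n (kd (xpow n) c).
Proof.
case: k z => [|k] z /=; last first.
  by move=> [b ->]; have [n [c ->]] := cech_from b; exists n, c; rewrite cech_d_to_cech.
move=> ->; exists 0%N, (fun=> 0); apply: functional_extensionality_dep => I.
by rewrite /to_cech kd0 frac0.
Qed.

Lemma to_cech_eq k n c n' c' : to_cech k n c = to_cech k n' c' ->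
  exists M, forall w, wt d k w ->
    wprod x w ^+ (M + n') * c w = wprod x w ^+ (M + n) * c' w.
Proof.
move=> E; have /choice[M hM] (I : ksub d k) : exists M,
    prod_on x (val I) ^+ (M + n') * c (word (val I)) =
    prod_on x (val I) ^+ (M + n) * c' (word (val I)).
  by apply/frac_eqP; apply: (congr1 (fun z : cech x k => z I) E).
exists (\max_I M I)%N => w hw; have [sw _] := andP hw.
have [I EI] := word_onto (eqP sw); rewrite EI wt_word in hw *.
have leM : (M (exist (fun I : {set 'I_d} => is_true (#|I| == k)) I hw) <= \max_I M I)%N by apply: leq_bigmax.
have := hM (exist (fun I : {set 'I_d} => is_true (#|I| == k)) I hw); rewrite /= prod_on_wprod.
rewrite -(subnK leM) -!addnA !(exprD _ (_ - _)) -!mulrA => ->.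
by [].
Qed.

Variables (p : nat) (chRp : p \in [pchar R]).

Lemma cech_frobenius_to_cech k n c :
  cech_frobenius p (to_cech k n c) = to_cech k (n * p) (fun w => c w ^+ p).
Proof. by apply: functional_extensionality_dep => I; rewrite /cech_frobenius /to_cech fracX. Qed.

Lemma iter_cech_frobenius k n c e :
  iter e (@cech_frobenius _ _ x p k) (to_cech k n c) =
  to_cech k (n * p ^ e) (fun w => c w ^+ (p ^ e)).
Proof.
elim: e => [|e IHe]; first by rewrite muln1.
rewrite iterS IHe cech_frobenius_to_cech -mulnA -expnSr; congr to_cech.
by apply: functional_extensionality_dep => w; rewrite -exprM -expnSr.
Qed.

Local Open Scope quotient_scope.

Lemma frobenius_coboundary k (z : cech x k) e :
  injective (@lc_frobenius R d x p chRp k) -> cech_d z = 0 ->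
  is_coboundary (iter e (@cech_frobenius _ _ x p k) z) -> is_coboundary z.
Proof.
move=> inj; elim: e z => [//|e IHe] z hz; rewrite iterSr => hF.
have one : is_coboundary (cech_frobenius p z) -> is_coboundary z.
  pose Z := Cocycle (introT eqP hz : is_cocycle z) => hFz.
  have F0 : cech_frobenius p (0 : cech x k) = 0.
    by have := cech_frobenius_zmod_morphism chRp (0 : cech x k) 0; rewrite !subrr.
  have : \pi_(local_cohomology x k) Z = \pi_(local_cohomology x k) (0 : cocycle x k).
    apply: inj; rewrite !pi_lc_frobenius; apply/eqP; rewrite -Quotient.idealrBE unfold_in.
    by apply/asboolP; rewrite raddfB /= F0 subr0.
  by move=> /eqP; rewrite -Quotient.idealrBE subr0 unfold_in => /asboolP.
apply: one; apply: IHe => //.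
transitivity (cech_frobenius p (cech_d z)); first exact: cech_d_frobenius.
have p_gt0 := prime_gt0 (pcharf_prime chRp).
apply: functional_extensionality_dep => J; rewrite /cech_frobenius.
rewrite (_ : cech_d z J = 0); first by rewrite expr0n gtn_eqF.
exact: (congr1 (fun u : cech x k.+1 => u J) hz).
Qed.

End CechKoszul.

Arguments to_cech {R d} x k n c.

(** * Cohen-Macaulayness *)

Lemma kd_eq_size (R : comNzRingType) (s : seq R) (c c' : bitseq -> R) w :
  (forall v, size v = size s -> c v = c' v) -> size w = size s -> kd s c w = kd s c' w.
Proof.
move=> cc' sw; rewrite !kd_sum //; apply: eq_bigr => j _; rewrite cc' //.
by rewrite size_set_nth sw; apply/maxn_idPr.
Qed.

Lemma powers_of_complement (R : comNzRingType) (x u : seq R) : powers_of x u ->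
  exists N f, powers_of x f /\ mulseq u f = [seq a ^+ N.+1 | a <- x].
Proof.
(* Proving the claim for all large N lets the induction choose one exponent for the whole list. *)
suff H : powers_of x u -> exists N0, forall N, (N0 <= N)%N ->
    exists f, powers_of x f /\ mulseq u f = [seq a ^+ N.+1 | a <- x].
  by move=> /H[N0 /(_ N0 (leqnn _))[f hf]]; exists N0, f.
elim: x u => [|a x IHx] [|b u] //=; first by exists 0%N => N _; exists [::].
move=> [[n ->] /IHx[N0 hN0]]; exists (N0 + n.+1)%N => N leN.
have [|f [hf Ef]] := hN0 N; first by apply: leq_trans leN; apply: leq_addr.
exists (a ^+ (N - n.+1).+1 :: f); split; first by split=> //; exists (N - n.+1)%N.
rewrite /= Ef -exprD; congr (_ ^+ _ :: _).
have : (n.+1 <= N)%N by apply: leq_trans leN; apply: leq_addl.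
by move=> h; rewrite addSn addnS -addSn subnKC.
Qed.

(** * Descent of the vanishing from the perfect closure to R *)

Section Descent.
Variables (R : comNzRingType) (p : nat) (chRp : p \in [pchar R]) (m : set R).
Hypotheses (R_noeth : noetherian R) (R_local : local_ring m).
Variables (S : comNzRingType) (chSp : p \in [pchar S]) (phi : {rmorphism R -> S}).
Hypotheses (phi_inj : injective phi)
  (phi_root : forall y, exists n a, y ^+ (p ^ n) = phi a)
  (S_perfect : bijective (fun y : S => y ^+ p)) (S_syz : syz_fg S).
Variables (d : nat) (x : d.-tuple R).
Hypotheses (x_chain : has_prime_chain R d)
  (x_prim : forall Q, is_prime Q -> (forall a, a \in x -> Q a) -> m `<=` Q)
  (F_inj : forall k, (k <= d)%N -> injective (@lc_frobenius R d x p chRp k)).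

Let mulseq_xpow n n' : mulseq (xpow x n) (xpow x n') = xpow x (n + n').
Proof. by rewrite /xpow; elim: (tval x) => //= a s ->; rewrite exprD. Qed.

(** Over S the cocycle bounds; a [p ^ e]-th power clears the roots in the bounding cochain, and
    Frobenius commutes with the differential up to raising the sequence to that power. *)
Let frobenius_boundary n k (c : bitseq -> R^o) : (k < d)%N ->
  cocyc (xpow x n.+1) [set 0] k c ->
  exists e b, forall w, wt d k w ->
    c w ^+ (p ^ e) = kd (xpow x (n.+1 * p ^ e)) b w.
Proof.
move=> ltkd hc; have [P [P_prime P_lt]] := x_chain; set y := xpow x n.+1.
have size_y : size y = d by apply: size_xpow.
have y_prim Q : is_prime Q -> (forall a, a \in y -> Q a) -> m `<=` Q.
  move=> hQ yQ; apply: x_prim => // a ax; apply: (prime_exp (n := n.+1)) => //.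
  exact/yQ/map_f.
have vanish := koszul_vanishing chRp R_noeth R_local chSp phi_inj phi_root S_perfect
  S_syz P_prime P_lt y_prim ltkd.
have [|b hb] := vanish (fun w => phi (c w)).
  move=> w; rewrite size_map => hw /=; rewrite [LHS]kd_map hc //; exact: rmorph0.
have [e he] := uniform_root phi_root [seq b w | w <- words d].
have /choice[beta hbeta] w : exists a, size w = d -> b w ^+ (p ^ e) = phi a.
  have [sw|/eqP nw] := eqVneq (size w) d; last by exists 0 => /nw.
  have [|a Ea] := he (b w); last by exists a.
  by apply: map_f; rewrite mem_words sw.
exists e, beta => w hw; have /andP[/eqP sw _] := hw.
have Ey : xpow x (n.+1 * p ^ e) = [seq a ^+ (p ^ e) | a <- y].
  by rewrite /y /xpow -map_comp; apply: eq_map => a /=; rewrite exprM.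
apply: phi_inj; rewrite rmorphXn -kd_map Ey -map_comp.
have := hb w; rewrite size_map size_y => /(_ hw)/eqP; rewrite subr_eq0 => /eqP ->.
rewrite -(kd_frob chSp) -map_comp.
have -> : [seq ((fun a : S => a ^+ (p ^ e)) \o phi) i | i <- y] =
    [seq (phi \o (fun a => a ^+ (p ^ e))) i | i <- y].
  by apply: eq_map => a /=; rewrite rmorphXn.
by apply: kd_eq_size; rewrite size_map size_y // => v /hbeta.
Qed.

Theorem koszul_exact_powers k u : (k < d)%N -> powers_of x u -> koszul_exact u k.
Proof.
(* The bound n gives strong induction on the degree, simultaneously for all u. *)
move=> ltkd; have {ltkd} [n ltkn ltnd] : exists2 n, (k < n)%N & (n <= d)%N by exists d.
elim: n => [//|n IHn] in k ltkn ltnd u *.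
have ltkd : (k < d)%N by apply: leq_trans ltkn _.
move=> hu c hc.
have size_u : size u = d by rewrite (powers_of_size hu) size_tuple.
have [N [f [hf Ef]]] := powers_of_complement hu.
have size_f : size f = d by rewrite (powers_of_size hf) size_tuple.
pose c1 : bitseq -> R^o := fun w => wprod f w * c w.
have hc1 : cocyc (xpow x N.+1) [set 0] k c1.
  move=> w; rewrite size_xpow => hw /=.
  by rewrite /xpow -Ef kd_mulseq ?size_f // hc ?size_u ?mulr0.
have [e [b hb]] := frobenius_boundary ltkd hc1.
have hz : cech_d (to_cech x k N.+1 c1) = 0.
  rewrite cech_d_to_cech; apply: functional_extensionality_dep => J.
  by rewrite /to_cech hc1 ?frac0 // size_xpow wt_word (valP J).
have zb : is_coboundary (to_cech x k N.+1 c1).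
  apply: (frobenius_coboundary (F_inj (ltnW ltkd)) hz (e := e)); rewrite iter_cech_frobenius.
  suff -> : to_cech x k (N.+1 * p ^ e) (fun w => c1 w ^+ (p ^ e)) =
      to_cech x k (N.+1 * p ^ e) (kd (xpow x (N.+1 * p ^ e)) b).
    exact: coboundary_to_cech.
  apply: functional_extensionality_dep => I.
  by rewrite /to_cech hb // wt_word (valP I).
have [n' [b' /to_cech_eq[M hM]]] := coboundary_from zb.
(* f equalizes the exponents and M + n' is what equality of fractions requires. The additional 1
   keeps the exponents positive, as [powers_of] demands. *)
pose g := mulseq f (xpow x (M + n').+1).
have size_g : size g = d by rewrite size_mulseq ?size_xpow.
have hg : powers_of x g by apply: powers_of_mul => //; apply: powers_of_exp.
have mulA s1 s2 s3 : mulseq s1 (mulseq s2 s3) = mulseq (mulseq s1 s2) s3 :> seq R.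
  by elim: s1 s2 s3 => [|a s1 IHs] [|a' s2] [|a'' s3] //=; rewrite IHs mulrA.
apply: (@koszul_injective _ [::] [::] x u g) => //.
  by move=> k' u' Ek; apply: IHn; rewrite Ek in ltkn; [rewrite -ltnS|rewrite ltnW].
exists (fun w => wprod (xpow x (M + N.+1).+1) w * b' w) => w /=.
rewrite size_mulseq ?size_u // => hw.
have -> : mulseq u g = mulseq (xpow x n') (xpow x (M + N.+1).+1).
  by rewrite /g mulA Ef -/(xpow x N.+1) !mulseq_xpow; congr xpow; lia.
rewrite kd_mulseq ?size_xpow // wprod_mul ?size_f ?size_xpow // !wprodX.
apply/eqP; rewrite subr_eq0; apply/eqP.
transitivity (wprod x w * (wprod x w ^+ (M + n') * c1 w)); last first.
  by rewrite (hM w hw) exprS -!mulrA.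
by rewrite /c1 exprS; ring.
Qed.

End Descent.

(** * From Koszul vanishing to depth, and from depth to dimension *)

Section RegularSequence.
Variables (R : comNzRingType) (m : set R).
Hypotheses (R_noeth : noetherian R) (R_local : local_ring m).
Implicit Types s : seq R.

(* Nakayama: multiplication by a is onto on the cohomology of s. *)
Lemma koszul_exact_tail a s k : m a -> koszul_exact (a :: s) k.+1 -> koszul_exact s k.
Proof.
move=> ma ex; have [r [z [z_cocyc z_gen]]] := cocyc_fg s k (noetherian_syz R_noeth).
have hI := @ideal_zero R; have [m_max _] := R_local; have [hm m1 _] := m_max.
apply: (@eliminate_generators _ _ _ z r) => [c /z_gen[t Et]|l gen].
  by exists t, 0 => w hw; rewrite [kd s _ w]kd0 subr0 /= Et // subrr.
(* Placed in the component that contains the new variable, [z l] is a cocycle of [a :: s]. Since it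
   bounds, [z l] is a times a cocycle b up to a coboundary. *)
have hjoin : cocyc (a :: s) [set 0] k.+1 (join 0 (z l)).
  apply/cocyc_cons => //; split=> w hw.
    by have := kd0 s w; apply.
  have -> : tl false (join 0 (z l)) w = 0 by [].
  by rewrite mulr0 sub0r; have /= := z_cocyc l w hw; move=> E; apply/eqP; rewrite oppr_eq0; apply/eqP.
have /cobd_cons[//|b [e [h0 h1]]] := ex _ hjoin.
have hb : cocyc s [set 0] k b.
  move=> w hw; have := h0 w hw; rewrite [join _ _ _]/(0 : R) sub0r /= => /eqP.
  by rewrite oppr_eq0 => /eqP.
have [t [g ht]] := gen b hb.
(* Expanding b in the generators moves the term [a * t l * z l] to the left; as a is in m, the
   coefficient 1 - a t_l is a unit. *)
have J1 : annih s k z l (1 - a * t l).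
  exists (fun i => a * t i), (fun w => a * g w - e w) => w hw /=.
  rewrite kdB kdZ; have := h1 w; rewrite wt_true => /(_ hw) /= /eqP.
  rewrite subr_eq0 => /eqP Ez.
  have := ht w hw; rewrite /= big_ord_recr /= => Eg.
  have -> : \sum_(i < l) a * t i * z i w = a * \sum_(i < l) t i * z i w.
    by rewrite mulr_sumr; apply: eq_bigr => i _; rewrite mulrA.
  transitivity (a * (b w - (\sum_(i < l) t i * z i w + t l * z l w) - kd s g w)).
    by rewrite mulrBl mul1r {1}Ez; ring.
  by rewrite Eg mulr0.
have [|u Eu] := @local_unit _ R_noeth m (1 - a * t l) R_local.
  move=> h; apply: m1; rewrite -(subrK (a * t l) 1); apply: idealD => //.
  exact: idealMr.
by rewrite -Eu; apply: idealM J1; apply: annih_ideal.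
Qed.

Lemma kd_top s y :
  ideal_gen s y <-> exists c : bitseq -> R^o, kd s c (nseq (size s) true) = y.
Proof.
elim: s y => [|a s IHs] y.
  split=> [[r ->]|[c <-]]; first by exists 0; rewrite big_ord0.
  exact: ideal0 (ideal_genP _).
split=> [/ideal_gen_cons[r [t [/IHs[c <-] ->]]]|[c <-]] /=.
  by exists (join (fun=> r) (fun v => - c v)); rewrite /= kdN opprK mulrC.
apply/ideal_gen_cons; exists (c (false :: nseq (size s) true)).
exists (- kd s (tl true c) (nseq (size s) true)); split; last by rewrite mulrC.
by apply: idealN; [apply: ideal_genP | apply/IHs; exists (tl true c)].
Qed.

Lemma wt_top d w : wt d d w -> w = nseq d true.
Proof.
move=> /andP[/eqP <- cw]; apply/all_pred1P; rewrite all_count -(eqP cw).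
by apply/eqP/eq_count => -[].
Qed.

(** The complex of [x :: s] is built on that of s, so exactness passes to tails and regularity is
    obtained from the last entry forwards; hence the reversal. *)
Lemma koszul_exact_regular s :
  (forall a, a \in s -> m a) -> (forall k, (k < size s)%N -> koszul_exact s k) ->
  forall i, (i < size s)%N -> forall a,
    ideal_gen (take i (rev s)) ((rev s)`_i * a) -> ideal_gen (take i (rev s)) a.
Proof.
elim: s => [//|x s IHs] sm ex i /=; rewrite ltnS leq_eqVlt => /predU1P[->|ltis] a.
  rewrite rev_cons -cats1 -(size_rev s) take_size_cat // nth_cat ltnn subnn /=.
  have rev_gen : ideal_gen (rev s) = ideal_gen s.
    by apply/seteqP; split; apply: ideal_gen_min; rewrite ?ideal_genP //;
      [exact: ideal_genP|move=> b; rewrite mem_rev; apply: ideal_gen_mem|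
       exact: ideal_genP|move=> b hb; apply: ideal_gen_mem; rewrite mem_rev].
  rewrite rev_gen => /kd_top[v Ev].
  have hI := @ideal_zero R.
  (* A relation [x * a] in (s) makes a, in the top degree of s, part of a cocycle of [x :: s]; a
     cochain bounding it exhibits a in (s) by [kd_top]. *)
  have hc : cocyc (x :: s) [set 0] (size s) (join (fun=> a) v).
    apply/cocyc_cons => //; split=> w; last first.
      by move=> /wt_top ->; apply/eqP; rewrite subr_eq0; apply/eqP; exact: esym Ev.
    by move=> /andP[/eqP sw /eqP cw]; have := count_size id w; rewrite cw sw ltnn.
  have /cobd_cons[//|b [_ [h0 _]]] := ex (size s) (ltnSn _) _ hc.
  apply/kd_top; exists b; apply/esym/eqP; rewrite -subr_eq0; apply/eqP/h0.
  by rewrite /wt size_nseq eqxx count_nseq mul1n /=.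
rewrite rev_cons -cats1 takel_cat; last by rewrite size_rev ltnW.
rewrite nth_cat size_rev ltis; apply: IHs => // [b sb|k ltk].
  by apply: sm; rewrite inE sb orbT.
by apply: (koszul_exact_tail (a := x)); [apply: sm; rewrite mem_head|apply: ex].
Qed.

(** This bounds depth by dimension: the last element x of the sequence is regular modulo the
    preceding ones, which leaves room for a prime inside Q that contains these but not x. *)
Lemma regular_prime_chain s :
  (forall i, (i < size s)%N ->
    forall a, ideal_gen (take i s) (s`_i * a) -> ideal_gen (take i s) a) ->
  forall Q, is_prime Q -> ideal_gen s `<=` Q ->
  exists P : nat -> set R, [/\ forall i, (i <= size s)%N -> is_prime (P i),
    forall i, (i < size s)%N -> P i `<` P i.+1 & P (size s) = Q].
Proof.
elim/last_ind: s => [|s x IHs] reg Q hQ sQ; first by exists (fun=> Q).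
have [hQi Q1 QM] := hQ.
have hI := ideal_genP s.
have regx a : ideal_gen s (x * a) -> ideal_gen s a.
  have := reg (size s); rewrite size_rcons ltnSn -cats1 take_size_cat // nth_cat ltnn subnn.
  by apply.
have Qx : Q x by apply/sQ/ideal_gen_mem; rewrite mem_rcons mem_head.
have sQ' : ideal_gen s `<=` Q.
  by apply: ideal_gen_min => // a sa; apply/sQ/ideal_gen_mem; rewrite mem_rcons inE sa orbT.
(* A prime disjoint from M lies in Q and does not contain x. M is disjoint from the ideal of s,
   since powers of x can be cancelled modulo that ideal. *)
pose M : set R := [set a | exists u n, ~ Q u /\ a = x ^+ n * u].
have [||||P [hP sP PM]] := @prime_avoiding R R_noeth (ideal_gen s) M.
- exact: hI.
- by exists 1, 0%N; rewrite expr0 mul1r.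
- move=> _ _ [u [n [Qu ->]]] [u' [n' [Qu' ->]]]; exists (u * u'), (n + n')%N.
  by split; [move=> /QM[]|rewrite exprD; ring].
- move=> a sa [u [n [Qu Ea]]]; move: sa; rewrite {a}Ea; elim: n => [|n IHn].
    by rewrite expr0 mul1r => /sQ'.
  by rewrite exprS -mulrA => /regx.
have PQ : P `<=` Q.
  move=> a Pa; apply: contrapT => Qa; apply: (PM a Pa); exists a, 0%N.
  by rewrite expr0 mul1r.
have NPx : ~ P x by move=> /PM; apply; exists 1, 1%N; rewrite expr1 mulr1.
have [|C [C_prime C_lt EC]] := IHs _ P hP sP.
  move=> i ltis a; have lti : (i < size (rcons s x))%N by rewrite size_rcons ltnW.
  by have := reg i lti a; rewrite -cats1 takel_cat 1?ltnW // nth_cat ltis.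
exists (fun i => if (i <= size s)%N then C i else Q); rewrite size_rcons; split=> [i _|i|].
- by case: ifP => // /C_prime.
- rewrite ltnS leq_eqVlt => /predU1P[->|ltis] /=; last first.
    by rewrite ltis orbT; apply: C_lt.
  by rewrite eqxx ltnn EC; split=> // /(_ x Qx).
- by rewrite ltnn.
Qed.

End RegularSequence.

Theorem corollary3p15 (p : nat) (p_prime : prime p)
    (R : comNzRingType) (chRp : p \in [pchar R]) (m : set R)
    (R_noetherian : noetherian R) (R_local : local_ring m)
    (R_reduced : reduced_ring R)
    (R_quotient : exists (A : comNzRingType) (n : set A),
       gorenstein_local n /\
       exists f : {rmorphism A -> R}, forall y, exists x, f x = y) :
  F_coherent chRp -> F_injective chRp m -> cohen_macaulay m.
Proof.
move=> R_coh [d [x [[[x_chain x_max] xm x_rad] F_inj]]].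
have [[hm m1 m_max] _] := R_local.
have m_prime : is_prime m.
  split=> // a b mab; have [ma|Nma] := pselect (m a); first by left.
  right; have [c Ec] := local_unit R_noetherian R_local Nma.
  by rewrite -[b]mul1r -Ec -mulrA; apply: idealM.
have x_m a : a \in x -> m a by move=> /tnthP[i ->].
have x_prim Q : is_prime Q -> (forall a, a \in x -> Q a) -> m `<=` Q.
  move=> hQ xQ a /x_rad[n xan]; apply: (prime_exp hQ (n := n)).
  by have [hQi _ _] := hQ; apply: (ideal_gen_min hQi xQ).
pose S := perfect_closure chRp.
pose phi : {rmorphism R -> S} := to_perfect_closure chRp.
have phi_inj : injective phi.
  move=> a b /eqP; rewrite -subr_eq0 -rmorphB => /eqP/to_perfect_closure_eq0[n].
  by move=> /R_reduced/eqP; rewrite subr_eq0 => /eqP.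
have chSp : p \in [pchar S] by apply: (rmorph_pchar phi).
have exact k : (k < size x)%N -> koszul_exact x k.
  rewrite size_tuple => ltkd.
  apply: (koszul_exact_powers (S := S) (phi := phi) R_noetherian R_local chSp phi_inj _ _ _
    x_chain x_prim F_inj ltkd).
  - exact: to_perfect_closure_root.
  - exact: perfect_closure_perfect.
  - exact: coherent_syz.
  - by rewrite -[X in powers_of _ X]map_id; elim: (tval x) => //= a s IHs; split=> //; exists 0%N.
(* The reversed system of parameters shows that the depth is at least d. Conversely, a regular
   sequence in m gives a chain of primes of its length ending at m, and [x_max] bounds this length
   by d. *)
exists d; split=> //; split=> [|s sm [_ reg]].
  exists (rev x); rewrite size_rev size_tuple; split=> // [a|]; first by rewrite mem_rev; apply: x_m.
  split; last first.
    by rewrite size_rev; apply: (koszul_exact_regular R_noetherian R_local x_m exact).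
  by move=> x1; apply: m1; apply: (ideal_gen_min hm _ x1) => a; rewrite mem_rev; apply: x_m.
have [P [P_prime P_lt _]] := regular_prime_chain R_noetherian reg m_prime (ideal_gen_min hm sm).
by apply: x_max; exists P.
Qed.
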